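(* Let $n\ge1$ and let $x$, $y$ be two sets of indeterminates. Then $$\sum_{\rho \vdash n+1}\frac{\theta^\rho_{(n+1)}(\alpha)\,J_\rho^\alpha(x)\,E_2^\perp J_\rho^\alpha(y)}{j_\rho(\alpha)} = \sum_{\gamma \vdash n}\frac{\theta^\gamma_{(n)}(\alpha)\,J_\gamma^\alpha(y)\,[D(\alpha),E_2]J_\gamma^\alpha(x)}{j_\gamma(\alpha)},$$ where $E_2^\perp$ acts on the variables $y$ and $[D(\alpha),E_2]$ acts on the variables $x$.
   Context: $z_\lambda=\prod_i i^{m_i(\lambda)}m_i(\lambda)!$; $p_\lambda$ are power sum symmetric functions; $\langle p_\lambda,p_\mu\rangle_\alpha=\alpha^{\ell(\lambda)}z_\lambda\delta_{\lambda\mu}$. For a box $s$ of the Young diagram of $\lambda$, $a(s),l(s)$ are its arm and leg lengths; $h_\lambda(\alpha)=\prod_s(\alpha a(s)+l(s)+1)$, $h'_\lambda(\alpha)=\prod_s(\alpha(1+a(s))+l(s))$, $j_\lambda(\alpha)=h_\lambda(\alpha)h'_\lambda(\alpha)$. $J^\alpha_\lambda$ are the Jack symmetric functions (orthogonal for $\langle\cdot,\cdot\rangle_\alpha$, triangular with respect to monomial functions, normalized by $[m_\lambda]J^\alpha_\lambda=h_\lambda(\alpha)$), and $\theta^\lambda_\mu(\alpha)$ is defined by $J^\alpha_\lambda=\sum_\mu\theta^\lambda_\mu(\alpha)p_\mu$; $(k)$ is the one-part partition. $D(\alpha)= \frac{\alpha}{2}\sum_{i}x_i^2\frac{\partial^2}{\partial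 x_i^2}+\sum_{i}\sum_{j\neq i}\frac{x_ix_j}{x_i-x_j}\frac{\partial}{\partial x_i}$ is the Laplace–Beltrami operator; $E_2=\sum_{k\ge1}kp_{k+1}\frac{\partial}{\partial p_k}$ and $E_2^\perp=\sum_{k\ge1}(k+1)p_k\frac{\partial}{\partial p_{k+1}}$; $[A,B]=AB-BA$. *)

(* Defs.v *)
From HB Require Import structures.
From mathcomp Require Import all_boot all_order all_algebra.
From mathcomp Require Import fraction.
From mathcomp Require Import mpoly.

Set Implicit Arguments.
Unset Strict Implicit.
Unset Printing Implicit Defensive.

Import Order.TTheory GRing.Theory Num.Theory.
Local Open Scope ring_scope.

Definition is_partition (n : nat) (l : seq nat) : bool :=
  [&& sorted geq l, all (fun k => 0 < k)%N l & sumn l == n].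

Definition seqs_upto (n : nat) : seq (seq nat) :=
  flatten [seq [seq [seq nat_of_ord x | x <- tval t] | t <- enum {: k.-tuple 'I_n.+1}]
          | k <- iota 0 n.+1].

Definition partitions (n : nat) : seq (seq nat) :=
  [seq l <- seqs_upto n | is_partition n l].

(* Boxes of the Young diagram of l are the (i, j) with i < size l and
   j < l_i (0-indexed).  conj_part l j = l'_{j+1} (column length). *)
Definition conj_part (l : seq nat) (j : nat) : nat := count (fun r => j < r)%N l.
Definition arm (l : seq nat) (i j : nat) : nat := (nth 0%N l i - j.+1)%N.
Definition leg (l : seq nat) (i j : nat) : nat := (conj_part l j - i.+1)%N.

Definition dominated (mu la : seq nat) : bool :=
  (sumn mu == sumn la) &&
  all (fun k => sumn (take k mu) <= sumn (take k la))%N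
      (iota 0 (size mu + size la).+1).

Section Jack.
Variable R : realFieldType.

Definition hook_h (a : R) (l : seq nat) : R :=
  \prod_(i < size l) \prod_(j < nth 0%N l i)
     (a * (arm l i j)%:R + (leg l i j)%:R + 1).
Definition hook_h' (a : R) (l : seq nat) : R :=
  \prod_(i < size l) \prod_(j < nth 0%N l i)
     (a * (1 + (arm l i j)%:R) + (leg l i j)%:R).
Definition jfun (a : R) (l : seq nat) : R := hook_h a l * hook_h' a l.

(* Symmetric functions of degree <= K in power-sum coordinates:        *)
(* {mpoly R[K]}, the variable 'X_i standing for p_{i+1}.                *)
Variable K : nat.

Definition pmon (mu : seq nat) : 'X_{1..K} := [multinom count_mem i.+1 mu | i < K].

Definition theta (f : {mpoly R[K]}) (mu : seq nat) : R := f@_(pmon mu).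

(* z_la for the partition with multiplicities m (m i = m_{i+1}(la)) *)
Definition zee (m : 'X_{1..K}) : nat := (\prod_(i < K) (i.+1 ^ m i * (m i)`!))%N.

(* <p_la, p_mu>_a = a^{l(la)} z_la delta *)
Definition pinner (a : R) (f g : {mpoly R[K]}) : R :=
  \sum_(m <- msupp f) f@_m * g@_m * a ^+ mdeg m * (zee m)%:R.

(* Evaluation in K actual variables x_1..x_K: p_k |-> sum_j x_j^k. *)
Definition psum_x (k : nat) : {mpoly R[K]} := \sum_(j < K) 'X_j ^+ k.
Definition ev (f : {mpoly R[K]}) : {mpoly R[K]} :=
  f \mPo [tuple psum_x i.+1 | i < K].

Definition xshape (e : 'X_{1..K}) : seq nat :=
  sort geq [seq e i | i <- enum 'I_K & (0 < e i)%N].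
Definition xmon (la : seq nat) : 'X_{1..K} := [multinom nth 0%N la i | i < K].

(* J is the family of Jack symmetric functions (for partitions of size <= K):
   orthogonal for <.,.>_a, triangular w.r.t. monomial symmetric functions
   in dominance order, with [m_la] J_la = h_la(a). *)
Definition IsJack (a : R) (J : seq nat -> {mpoly R[K]}) : Prop :=
  (forall la mu, is_partition (sumn la) la -> is_partition (sumn mu) mu ->
     (sumn la <= K)%N -> (sumn mu <= K)%N -> la != mu ->
     pinner a (J la) (J mu) = 0)
  /\ (forall la, is_partition (sumn la) la -> (sumn la <= K)%N ->
     (forall e, e \in msupp (ev (J la)) -> dominated (xshape e) la)
     /\ (ev (J la))@_(xmon la) = hook_h a la).

Definition frac (u : {mpoly R[K]}) : {fraction {mpoly R[K]}} :=
  @FracField.tofrac _ u.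

Definition LB (a : R) (u : {mpoly R[K]}) : {fraction {mpoly R[K]}} :=
  frac ((a / 2%:R)%:MP * \sum_(i < K) 'X_i ^+ 2 * mderiv i (mderiv i u))
  + \sum_(i < K) \sum_(j < K | j != i)
       frac ('X_i * 'X_j) / frac ('X_i - 'X_j) * frac (mderiv i u).

(* Dop is D(a) transported to power-sum coordinates. *)
Definition IsLBop (a : R) (Dop : {mpoly R[K]} -> {mpoly R[K]}) : Prop :=
  forall f, frac (ev (Dop f)) = LB a (ev f).

(* E_2 = sum_k k p_{k+1} d/dp_k  and  E_2^perp = sum_k (k+1) p_k d/dp_{k+1}
   (k = i+1, variable index i <-> p_{i+1}). *)
Definition E2 (f : {mpoly R[K]}) : {mpoly R[K]} :=
  \sum_(i < K) \sum_(j < K | nat_of_ord j == i.+1)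
     (i.+1)%:R *: ('X_j * mderiv i f).
Definition E2perp (f : {mpoly R[K]}) : {mpoly R[K]} :=
  \sum_(i < K) \sum_(j < K | nat_of_ord j == i.+1)
     (i.+2)%:R *: ('X_i * mderiv j f).

(* f(x) g(y) in Lambda(x) (x) Lambda(y): polynomials in the p_k(y) with
   coefficients polynomials in the p_k(x). *)
Definition tens (f g : {mpoly R[K]}) : {mpoly {mpoly R[K]}[K]} :=
  f%:MP * map_mpoly (fun c : R => c%:MP_[K]) g.

End Jack.

(* Main.v *)
(* Write E_la = alpha n(la') - n(la), the eigenvalue of D(alpha) on J_la.  In power sums D(alpha)
   satisfies [d/dp_1, D(alpha)] = E_2^perp, and multiplication by p_1 is adjoint to d/dp_1 up to
   alpha.  With beta(rho, ga) = <dJ_rho/dp_1, J_ga>, the coefficient of J_ga in E_2^perp J_rho is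
   therefore (E_rho - E_ga) beta / j_ga, and that of J_rho in [D(alpha), E_2] J_ga is
   (E_rho - E_ga)^2 beta / j_rho.  The two sides agree because
   theta^rho_(n+1) = (E_rho - E_ga) theta^ga_(n) as soon as beta is nonzero.

   This last relation comes from the principal specialization of J_la, the product of
   X + alpha a' - l' over the boxes of la (a', l' the coarm and the coleg): theta^la_(n) is its
   coefficient of X, and rho is ga plus one box, of content E_rho - E_ga.  The specialization is
   computed by removing columns: in l(la) variables, J_la is proportional to x_1 ... x_l(la)
   times the Jack polynomial of la without its first column.  The norm formula
   <J_la, J_la> = j_la follows by removing rows in the same way from the image of J_la under
   p_k |-> - alpha p_k, an eigenfunction for the parameter 1 / alpha.  All these identities rest
   on uniqueness of eigenfunctions: the action of D(alpha) on the leading exponents determines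
   the eigenvalue, and E is strictly increasing in the dominance order. *)

(* Only p_1, ..., p_K with K = n + 1 are available and the operators are truncated accordingly: the
   power-sum formula for D(alpha) agrees with the differential operator only in degrees at most K.
   Hence the homogeneity predicate [wt], carried through the whole proof. The number N of variables
   is kept independent of K: with N below the number of rows a Jack function vanishes, with N equal
   to it the function is divisible by x_1 ... x_N.

   Different partitions can share an eigenvalue, for instance (4,1,1) and (3,3) for every alpha. So
   each uniqueness argument first confines the exponents below a fixed partition in the dominance
   order, where positivity of alpha makes E injective.

   Of the Pieri rule for p_1 only the support is used, together with the content of the added box.
   It is extracted from the operator sum_i d/dx_i, which in N variables is N d/dp_1 + E_2^perp:
   choosing N next to the number of rows of rho settles the case of a new row, and all other cases
   lose a column. This is also why the principal specialization is first found up to a scalar, by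
   induction on the degree, and normalized afterwards. *)
Require Import Defs.
From HB Require Import structures.
From mathcomp Require Import all_boot all_order all_algebra.
From mathcomp Require Import fraction.
From mathcomp Require Import perm mpoly.
From mathcomp Require Import ring lra zify.

Set Implicit Arguments.
Unset Strict Implicit.
Unset Printing Implicit Defensive.

Import Order.TTheory GRing.Theory Num.Theory.
Local Open Scope ring_scope.
#[local] Arguments conj_part : simpl never.

(** * Dominance order and the statistics n and n' *)
Section SeqOrder.
Local Open Scope nat_scope.
Implicit Types (s u : seq nat) (t : nat).

(* Number of boxes of the diagram of [s] outside its first [t] columns. *)
Definition ts s t : nat := \sum_(x <- s) (x - t).

Lemma ts_nil t : ts [::] t = 0.
Proof. by rewrite /ts big_nil. Qed.

Lemma ts_cons x s t : ts (x :: s) t = (x - t) + ts s t.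
Proof. by rewrite /ts big_cons. Qed.

Lemma ts0 s : ts s 0 = sumn s.
Proof. by rewrite sumnE /ts; apply: eq_bigr => x _; rewrite subn0. Qed.

Lemma conj_part_cons x s t : conj_part (x :: s) t = (t < x) + conj_part s t.
Proof. by []. Qed.

Lemma tsS s t : ts s t = conj_part s t + ts s t.+1.
Proof.
elim: s => [|x s IH]; first by rewrite !ts_nil.
rewrite !ts_cons IH conj_part_cons; case: ltnP => /=; lia.
Qed.

Lemma conj_part_le s t t' : t <= t' -> conj_part s t' <= conj_part s t.
Proof. by move=> le; apply: sub_count => x /= h; apply: leq_ltn_trans h. Qed.

Lemma ts_perm s u t : perm_eq s u -> ts s t = ts u t.
Proof. by move=> h; rewrite /ts (perm_big _ h). Qed.

Lemma ts_pos s t : ts [seq x <- s | 0 < x] t = ts s t.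
Proof.
rewrite /ts big_filter [RHS](bigID (fun x => 0 < x)) /=.
by rewrite [X in _ + X]big1 ?addn0 // => x; case: x.
Qed.

Lemma conj_part0 s : all (fun k => 0 < k) s -> conj_part s 0 = size s.
Proof. by move=> h; apply/eqP; rewrite /conj_part -all_count. Qed.

(* [qs s] and [mn s] are Macdonald's n(s') and n(s), for sequences that need not be sorted. *)
Definition qs s : nat := \sum_(x <- s) 'C(x, 2).

Fixpoint mn s : nat :=
  if s is x :: s' then \sum_(y <- s') minn x y + mn s' else 0.

Lemma qs_cons x s : qs (x :: s) = 'C(x, 2) + qs s.
Proof. by rewrite /qs big_cons. Qed.

Lemma sum_lt B x : x <= B -> \sum_(t < B) (t < x) = x.
Proof.
elim: B => [|B IH]; first by rewrite leqn0 => /eqP ->; rewrite big_ord0.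
rewrite leq_eqVlt big_ord_recr /= => /orP [/eqP ->|h].
  rewrite ltnS leqnn (eq_bigr (fun=> 1)) ?sum_nat_const ?card_ord ?muln1 ?addn1 //.
  by move=> i _; rewrite ltnS ltnW.
by rewrite IH // ltnNge -ltnS h addn0.
Qed.

Lemma bin2_lt B x : x <= B -> 'C(x, 2) = \sum_(t < B) t * (t < x).
Proof.
move=> h; rewrite -bin2_sum big_mkord (big_ord_widen _ (fun t => t) h) big_mkcond.
by apply: eq_bigr => t _; case: ltnP; rewrite ?muln1 ?muln0.
Qed.

Lemma bin2_subn B x : x <= B -> 'C(x, 2) = \sum_(t < B) (x - t.+1).
Proof.
elim: x B => [|x IH] B h; first by rewrite big1 // => i _; rewrite sub0n.
case: B h => // B h; rewrite big_ord_recl binS bin1 (IH B) // addnC.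
by rewrite subSS subn0; congr (_ + _); apply: eq_bigr.
Qed.

(** As a sum of tails, [qs] is visibly monotone for [domle]; the bound [B] only makes the sum
    finite. *)
Lemma qs_ts B s : all (fun x => x <= B) s -> qs s = \sum_(t < B) ts s t.+1.
Proof.
elim: s => [|x s IH] /=; first by rewrite /qs big_nil big1 // => i _; rewrite ts_nil.
case/andP=> hx hs; rewrite qs_cons (bin2_subn hx) IH // -big_split /=.
by apply: eq_bigr => t _; rewrite ts_cons.
Qed.

Lemma qs_conj_part B s : all (fun x => x <= B) s ->
  qs s = \sum_(t < B) t * conj_part s t.
Proof.
elim: s => [|x s IH] /=; first by rewrite /qs big_nil big1 // => i _; rewrite muln0.
case/andP=> hx hs; rewrite qs_cons (bin2_lt hx) IH // -big_split /=.
by apply: eq_bigr => t _; rewrite mulnDr.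
Qed.

Lemma sumn_conj_part B s : all (fun x => x <= B) s -> sumn s = \sum_(t < B) conj_part s t.
Proof.
elim: s => [|x s IH] /=; first by rewrite big1.
case/andP=> hx hs; rewrite -{1}(sum_lt hx) IH // -big_split /=.
by apply: eq_bigr.
Qed.

Lemma sum_lt_conj_part B x s : x <= B ->
  \sum_(t < B) (t < x) * conj_part s t = \sum_(y <- s) minn x y.
Proof.
move=> hx; elim: s => [|y s IH]; first by rewrite big_nil big1 // => i _; rewrite muln0.
rewrite big_cons -IH -(@sum_lt B (minn x y)); last by rewrite geq_min hx.
rewrite -big_split /=; apply: eq_bigr => t _; rewrite conj_part_cons mulnDr leq_min.
by rewrite mulnb.
Qed.

(** [minn x y] is the number of columns meeting both rows, so [mn] counts pairs of boxes in a common
    column. *)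
Lemma mn_conj_part B s : all (fun x => x <= B) s ->
  mn s = \sum_(t < B) 'C(conj_part s t, 2).
Proof.
elim: s => [|x s IH] /=; first by rewrite big1.
case/andP=> hx hs; rewrite -(sum_lt_conj_part _ hx) IH // -big_split /=.
apply: eq_bigr => t _; rewrite conj_part_cons; case: (t < x).
  by rewrite mul1n add1n binS bin1 addnC.
by rewrite mul0n.
Qed.

Lemma bin2_sqr c : ('C(c, 2) * 2 + c = c * c).
Proof. by elim: c => // c IH; rewrite binS bin1; lia. Qed.

Lemma all_leq_sumn s : all (fun x => x <= sumn s) s.
Proof.
apply/allP; elim: s => //= y s IH x; rewrite inE => /orP [/eqP ->|/IH]; lia.
Qed.

Lemma all_leqW B B' s : B <= B' -> all (fun x => x <= B) s -> all (fun x => x <= B') s.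
Proof. by move=> h; apply: sub_all => x /leq_trans; apply. Qed.

(* Dominance order read off the columns, so that it applies to unsorted exponents. *)
Definition domle s u := sumn s = sumn u /\ forall t, ts s t <= ts u t.

Lemma domle_refl s : domle s s.
Proof. by split. Qed.

Lemma domle_trans u s v : domle s u -> domle u v -> domle s v.
Proof. by case=> e1 h1 [e2 h2]; split=> [|t]; [rewrite e1|apply: leq_trans (h2 t)]. Qed.

Lemma ts_eq0 s t : all (fun x => x <= t) s -> ts s t = 0.
Proof.
by move=> h; rewrite /ts big_seq big1 // => x /(allP h) le; apply/eqP; rewrite subn_eq0.
Qed.

Lemma domle_dec s u : domle s u \/ ~ domle s u.
Proof.
have [e|ne] := eqVneq (sumn s) (sumn u); last by right=> -[/eqP]; rewrite (negbTE ne).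
have [/allP h|/allPn [t _ nt]] := boolP (all (fun t => ts s t <= ts u t) (iota 0 (sumn s))).
  left; split=> // t; have [lt|ge] := ltnP t (sumn s); first by apply: h; rewrite mem_iota.
  by rewrite ts_eq0 //; apply: all_leqW ge (all_leq_sumn s).
by right=> -[_ /(_ t)]; rewrite (negbTE nt).
Qed.

Lemma domle_qs s u : domle s u -> qs s <= qs u.
Proof.
move=> [e h]; have hs := all_leq_sumn s; have hu := all_leq_sumn u.
rewrite -e in hu; rewrite (qs_ts hs) (qs_ts hu); exact: leq_sum.
Qed.

(** The tails are compared term by term, so equality of their sums forces equality of each. *)
Lemma domle_qs_eq s u : domle s u -> qs s = qs u -> ts s =1 ts u.
Proof.
move=> [e h]; have hs := all_leq_sumn s; have hu := all_leq_sumn u.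
rewrite -e in hu; rewrite (qs_ts hs) (qs_ts hu) => /eqP.
have /leqifP := leqif_sum (fun (i : 'I_(sumn s)) (_ : true) => leqif_eq (h i.+1)).
case: forallP => [H _ _|_ lt /eqP eq]; last by rewrite eq ltnn in lt.
case=> [|t]; first by rewrite !ts0.
case: (ltnP t (sumn s)) => lt; first exact/eqP/(H (Ordinal lt)).
by rewrite !ts_eq0 //; apply: all_leqW (leqW lt) _.
Qed.

(* Abel summation against the decreasing column lengths. *)
Lemma domle_mn s u : domle s u -> mn u <= mn s.
Proof.
move=> [e h]; have hs := all_leq_sumn s; have hu := all_leq_sumn u.
rewrite -e in hu; rewrite (mn_conj_part hs) (mn_conj_part hu).
set B := sumn s in hs hu *.
(* Put d_n = [ts u n - ts s n], which is nonnegative with d_0 = 0. At column t the lengths of [s]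
   and [u] differ by d_(t+1) - d_t, and their squares by that times the sum of the two lengths,
   which decreases with t. The invariant is the Abel sum with its boundary term, written without
   subtraction. *)
have H n : \sum_(t < n) conj_part u t * conj_part u t
     + ts u n * (conj_part s n + conj_part u n)
     <= \sum_(t < n) conj_part s t * conj_part s t
      + ts s n * (conj_part s n + conj_part u n).
  elim: n => [|n IH]; first by rewrite !big_ord0 !ts0 e.
  rewrite !big_ord_recr /=; move: IH; rewrite (tsS s) (tsS u).
  have := h n.+1; have := conj_part_le s (leqnSn n); have := conj_part_le u (leqnSn n).
  move: (\sum_(_ < _) _) (\sum_(_ < _) _) => x y; nia.
have {H} := leq_trans (leq_addr _ _) (H B).
rewrite (ts_eq0 hs) mul0n addn0.
under eq_bigr do rewrite -bin2_sqr.
under [X in _ <= X -> _]eq_bigr do rewrite -bin2_sqr.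
by rewrite !big_split -!big_distrl /= -!sumn_conj_part // -e; lia.
Qed.

(** Multiplicities are second differences of [ts], the first differences being the column lengths.
    Zeros are invisible to [ts], whence [0 < v]. *)
Lemma ts_eq_count s u : ts s =1 ts u -> forall v, 0 < v -> count_mem v s = count_mem v u.
Proof.
move=> h [//|v] _.
have c t : conj_part s t = conj_part u t by have := tsS s t; have := tsS u t; rewrite !h; lia.
have E w : count_mem v.+1 w = conj_part w v - conj_part w v.+1.
  elim: w => // x w IH; rewrite !conj_part_cons /= IH.
  have := conj_part_le w (leqnSn v); lia.
by rewrite !E !c.
Qed.

Lemma partition_count_inj n m s u : is_partition n s -> is_partition m u ->
  (forall v, 0 < v -> count_mem v s = count_mem v u) -> s = u.
Proof.
case/and3P=> ss ps _; case/and3P=> su pu _ h.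
apply: (sorted_eq _ _ ss su).
- by move=> x y z /= h1 h2; apply: leq_trans h2 h1.
- by move=> x y /= /anti_leq.
apply/allP=> v; rewrite mem_cat => hv; apply/eqP/h.
by case/orP: hv => hv; [apply: (allP ps)|apply: (allP pu)].
Qed.

Lemma partition_ts_inj n m s u : is_partition n s -> is_partition m u ->
  ts s =1 ts u -> s = u.
Proof. by move=> ps pu h; apply: (partition_count_inj ps pu); apply: ts_eq_count. Qed.

Lemma partition_domle_anti n m s u : is_partition n s -> is_partition m u ->
  domle s u -> domle u s -> s = u.
Proof.
move=> ps pu [_ h1] [_ h2]; apply: (partition_ts_inj ps pu) => t.
by apply/eqP; rewrite eqn_leq h1 h2.
Qed.

Lemma partition_sumn n s : is_partition n s -> sumn s = n.
Proof. by case/and3P=> _ _ /eqP. Qed.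

Lemma partition_self n s : is_partition n s -> is_partition (sumn s) s.
Proof. by move=> h; rewrite (partition_sumn h). Qed.

Lemma size_ts n s : is_partition n s -> size s = ts s 0 - ts s 1.
Proof. by case/and3P=> _ ps _; rewrite -(conj_part0 ps) tsS addnK. Qed.

Lemma domle_size n m s u : is_partition n s -> is_partition m u -> domle s u -> size u <= size s.
Proof.
move=> ps pu [e h]; rewrite (size_ts ps) (size_ts pu) !ts0 e; exact: leq_sub2l.
Qed.

Lemma domle_qs_lt n m s u : is_partition n s -> is_partition m u ->
  domle s u -> s != u -> qs s < qs u.
Proof.
move=> ps pu le; apply: contraNT; rewrite -leqNgt => ge.
apply/eqP/(partition_ts_inj ps pu)/(domle_qs_eq le)/eqP.
by rewrite eqn_leq domle_qs.
Qed.

(** Each part is at most [t + (x - t)]. In the sorted case equality holds when exactly the parts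
    above [t] are taken ([sumn_take_ts]); together the two facts translate partial sums of rows into
    tails. *)
Lemma sumn_take_le k s t : sumn (take k s) <= k * t + ts s t.
Proof.
by elim: s k => [|x s IH] [|k] //=; rewrite ts_cons mulSn; have := IH k; lia.
Qed.

Lemma sumn_take_ts s t : sorted geq s ->
  sumn (take (conj_part s t) s) = conj_part s t * t + ts s t.
Proof.
elim: s => [|x s IH] /= hp; first by rewrite ts_nil mul0n.
have hs : sorted geq s by apply: path_sorted hp.
rewrite conj_part_cons ts_cons; case: ltnP => hx /=.
  by rewrite add1n mulSn IH //; lia.
have hall : all (fun y => y <= t) s.
  have tr : transitive geq by move=> y z w /= h1 h2; apply: leq_trans h2 h1.
  apply: sub_all (order_path_min tr hp) => y /= hy; exact: leq_trans hy hx.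
rewrite (ts_eq0 hall) (_ : conj_part s t = 0) ?take0 //=; first by lia.
apply/eqP; rewrite /conj_part -leqn0 leqNgt -has_count; apply/hasPn => y /(allP hall).
by rewrite -leqNgt.
Qed.

(** For given [t] the partial sums are compared at the number of parts of [s] exceeding [t], where
    the bound by tails is attained for [s]. *)
Lemma dominated_domle s u : sorted geq s -> dominated s u -> domle s u.
Proof.
move=> hs /andP [/eqP e /allP h]; split=> // t.
have := h (conj_part s t); rewrite mem_iota add0n /= => /(_ _).
have hc : conj_part s t < (size s + size u).+1 by rewrite ltnS (leq_trans (count_size _ _)) ?leq_addr.
move=> /(_ hc); rewrite (sumn_take_ts _ hs).
have := sumn_take_le (conj_part s t) u t; lia.
Qed.
End SeqOrder.

(** * Columns and conjugation *)
Section Columns.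
Local Open Scope nat_scope.
Implicit Types (s u : seq nat) (t : nat).

Definition drop_col s := [seq x.-1 | x <- s & 1 < x].

Lemma conj_part_drop_col s t : conj_part (drop_col s) t = conj_part s t.+1.
Proof.
rewrite /conj_part /drop_col count_map count_filter; apply: eq_count => x /=; lia.
Qed.

Lemma ts_drop_col s t : ts (drop_col s) t = ts s t.+1.
Proof.
rewrite /ts /drop_col big_map big_filter [RHS](bigID (fun x => 1 < x)) /=.
rewrite [X in _ + X]big1 ?addn0; last by move=> x h; lia.
by apply: eq_bigr => x h; lia.
Qed.

Lemma sumn_drop_col s : all (fun k => 0 < k) s -> sumn (drop_col s) + size s = sumn s.
Proof. by move=> h; rewrite -!ts0 ts_drop_col (tsS s 0) conj_part0 // addnC. Qed.

Lemma drop_col_partition n s : is_partition n s -> is_partition (sumn (drop_col s)) (drop_col s).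
Proof.
case/and3P=> ss ps _; apply/and3P; split=> //.
  rewrite /drop_col; apply: (homo_sorted (e := geq)) => [x y /= h|]; first by lia.
  by apply: sorted_filter ss => x y z /= h1 h2; apply: leq_trans h2 h1.
by apply/allP => x /mapP [y]; rewrite mem_filter => /andP [h _] ->; lia.
Qed.

Lemma sumn_drop_col_lt n s : is_partition n s -> s != [::] -> sumn (drop_col s) < sumn s.
Proof.
case/and3P=> _ ps _ h; rewrite -(sumn_drop_col ps) -addn1 leq_add2l lt0n size_eq0.
by apply: h.
Qed.

Lemma size_drop_col s : size (drop_col s) <= size s.
Proof. by rewrite size_map size_filter count_size. Qed.

Lemma drop_col_inj n m s u : is_partition n s -> is_partition m u -> size s = size u ->
  drop_col s = drop_col u -> s = u.
Proof.
move=> ps pu e h; apply: (partition_ts_inj ps pu) => -[|t]; last by rewrite -!ts_drop_col h.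
have [/and3P [_ qs _] /and3P [_ qu _]] := (ps, pu).
by rewrite !ts0 -(sumn_drop_col qs) -(sumn_drop_col qu) h e.
Qed.

Lemma qs_drop_col s : all (fun k => 0 < k) s -> qs s = qs (drop_col s) + sumn (drop_col s).
Proof.
move=> h; have hs := all_leqW (leqnSn _) (all_leq_sumn s).
have hd := all_leq_sumn (drop_col s).
have /(all_leqW)/(_ hd) {}hd : sumn (drop_col s) <= sumn s by rewrite -(sumn_drop_col h) leq_addr.
rewrite (qs_ts hs) (qs_ts hd) big_ord_recl /= -ts_drop_col ts0 addnC; congr (_ + _).
by apply: eq_bigr => i _; rewrite -ts_drop_col.
Qed.

Lemma mn_drop_col s : all (fun k => 0 < k) s -> mn s = mn (drop_col s) + 'C(size s, 2).
Proof.
move=> h; have hs := all_leqW (leqnSn _) (all_leq_sumn s).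
have hd := all_leq_sumn (drop_col s).
have /(all_leqW)/(_ hd) {}hd : sumn (drop_col s) <= sumn s by rewrite -(sumn_drop_col h) leq_addr.
rewrite (mn_conj_part hs) (mn_conj_part hd) big_ord_recl conj_part0 // addnC.
by congr (_ + _); apply: eq_bigr => i _; rewrite conj_part_drop_col.
Qed.

Lemma mn_cons m s : all (fun x => x <= m) s -> mn (m :: s) = sumn s + mn s.
Proof.
move=> h /=; congr (_ + _); rewrite sumnE big_seq [RHS]big_seq.
by apply: eq_bigr => x /(allP h) /minn_idPr.
Qed.

Lemma partition_cons n m s : is_partition n (m :: s) ->
  [/\ is_partition (sumn s) s, 0 < m & all (fun x => x <= m) s].
Proof.
case/and3P=> /= ss /andP [m0 ps] _; split=> //.
  by apply/and3P; split=> //; apply: path_sorted ss.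
by apply: (order_path_min _ ss) => x y z /= h1 h2; apply: leq_trans h2 h1.
Qed.

Lemma conj_part_eq0 s t : all (fun x => x <= t) s -> conj_part s t = 0.
Proof.
move=> h; apply/eqP; rewrite /conj_part -leqn0 leqNgt -has_count; apply/hasPn => y /(allP h).
by rewrite -leqNgt.
Qed.

Lemma nth_conj_part s i j : sorted geq s -> (j < nth 0 s i) = (i < conj_part s j).
Proof.
elim: s i => [|x s IH] i hs; first by rewrite nth_nil.
have hs' : sorted geq s by apply: path_sorted hs.
rewrite conj_part_cons; case: (ltnP j x) => h.
  by case: i => [|i] /=; rewrite ?h // IH.
have all_j : all (fun y => y <= j) (x :: s).
  rewrite /= h; apply: sub_all (order_path_min _ hs) => [y /= hy|y z w /= h1 h2].
    exact: leq_trans h.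
  exact: leq_trans h2 h1.
rewrite conj_part_eq0; last by case/andP: all_j.
rewrite ltn0; apply/negbTE; rewrite -leqNgt.
have [lt|ge] := ltnP i (size (x :: s)); first exact: (all_nthP 0 all_j). by rewrite (nth_default 0 ge).
Qed.

(** The conjugate partition padded with zeros to length [K], so that it can serve as an exponent
    vector in [K] variables; comparisons go through [ts], which ignores the padding. *)
Definition conj_seq K s := mkseq (conj_part s) K.

Lemma sumn_conj_seq K s : all (fun x => x <= K) s -> sumn (conj_seq K s) = sumn s.
Proof.
move=> h; rewrite (sumn_conj_part h) sumnE /conj_seq big_map -[in LHS](subn0 K) big_mkord.
by [].
Qed.

Lemma qs_conj_seq K s : all (fun x => x <= K) s -> qs (conj_seq K s) = mn s.
Proof.
move=> h; rewrite (mn_conj_part h) /qs /conj_seq big_map -[in LHS](subn0 K) big_mkord.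
by [].
Qed.

Lemma mn_rcons s x : mn (rcons s x) = mn s + \sum_(y <- s) minn y x.
Proof.
elim: s => [|y s IH] /=; first by rewrite !big_nil.
by rewrite IH -cats1 big_cat big_seq1 /= big_cons; lia.
Qed.

Lemma mn_conj_seq K s : all (fun x => x <= K) s -> mn (conj_seq K s) = qs s.
Proof.
move=> h; rewrite (qs_conj_part h) /conj_seq.
have {h} H n : mn (mkseq (conj_part s) n) = \sum_(t < n) t * conj_part s t.
  elim: n => [|n IH]; first by rewrite big_ord0.
  rewrite mkseqS mn_rcons IH big_ord_recr /=; congr (_ + _).
  rewrite big_map big_seq (eq_bigr (fun=> conj_part s n)) => [|i].
    by rewrite -big_seq big_const_seq count_predT size_iota iter_addn_0 mulnC.
  by rewrite mem_iota => /andP [_ hi]; apply/minn_idPr/conj_part_le/ltnW.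
exact: H.
Qed.

Lemma conj_part_mkseq (c : nat -> nat) K k t : (forall i j, i <= j -> c j <= c i) ->
  (k < conj_part (mkseq c K) t) = (k < K) && (t < c k).
Proof.
move=> hc; rewrite -nth_conj_part.
  by case: (ltnP k K) => h; [rewrite nth_mkseq|rewrite nth_default ?size_mkseq].
apply/(sortedP 0) => i; rewrite size_mkseq => h.
by rewrite !nth_mkseq ?(ltnW h) //; apply/hc/ltnW.
Qed.

Lemma conj_part_conj_seq K s k t :
  (k < conj_part (conj_seq K s) t) = (k < K) && (t < conj_part s k).
Proof. by apply: conj_part_mkseq => i j; apply: conj_part_le. Qed.

Lemma conj_part_conj_seqK K s k : all (fun x => x <= K) s -> size s <= K ->
  conj_part (conj_seq K (conj_seq K s)) k = conj_part s k.
Proof.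
move=> hK hs; have le t : conj_part s t <= K by apply: leq_trans hs; apply: count_size.
apply/eqP; rewrite eqn_leq; apply/andP; split; rewrite leqNgt; apply/negP.
  by rewrite conj_part_conj_seq => /andP [_]; rewrite conj_part_conj_seq ltnn andbF.
move=> h; have : conj_part (conj_seq K (conj_seq K s)) k < conj_part (conj_seq K (conj_seq K s)) k.
  rewrite conj_part_conj_seq (leq_trans h (le k)) conj_part_conj_seq h andbT /=.
  have [//|ge] := ltnP k K; move: h; rewrite [conj_part s k]conj_part_eq0 //.
  exact: all_leqW ge hK.
by rewrite ltnn.
Qed.

Lemma conj_part_ts s u : ts s =1 ts u -> conj_part s =1 conj_part u.
Proof. by move=> h t; have := tsS s t; have := tsS u t; rewrite !h; lia. Qed.

Lemma ts_conj_part s u : conj_part s =1 conj_part u -> ts s =1 ts u.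
Proof.
move=> h t; have [n] := ubnP (maxn (sumn s) (sumn u) - t); elim: n t => // n IH t lt.
case: (leqP (maxn (sumn s) (sumn u)) t) => [le|gt].
  rewrite !ts_eq0 //; apply: all_leqW (all_leq_sumn _); apply: leq_trans le.
    exact: leq_maxr.
  exact: leq_maxl.
by rewrite (tsS s) (tsS u) h IH //; lia.
Qed.

Lemma conj_seq_ext K s u : conj_part s =1 conj_part u -> conj_seq K s = conj_seq K u.
Proof. by move=> h; apply: eq_map. Qed.

(** Conjugation is an involution up to padding and order as long as [u] fits in a K by K square. *)
Lemma ts_conj_seq_swap K s u : all (fun x => x <= K) u -> size u <= K ->
  ts s =1 ts (conj_seq K u) -> ts u =1 ts (conj_seq K s).
Proof.
move=> hK hs /conj_part_ts/(conj_seq_ext K) e; apply: ts_conj_part => t.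
by rewrite e conj_part_conj_seqK.
Qed.

Lemma ts_conj_seq_shift K s u t : all (fun x => x <= K) s ->
  (forall k, conj_part u k = conj_part s k.+1) ->
  ts (conj_seq K s) t = (conj_part s 0 - t) + ts (conj_seq K u) t.
Proof.
(* The additional column with index [K] is empty; it allows the first entry to be split off while a
   list of length [K] remains. *)
move=> h e; have z : ts (mkseq (conj_part s) K.+1) t = ts (conj_seq K s) t.
  by rewrite mkseqS -cats1 /ts big_cat big_seq1 /= conj_part_eq0 // sub0n addn0.
rewrite -z -ts_cons /conj_seq /mkseq /= (iotaDl 1) -map_comp; congr (ts (_ :: _) _).
exact: eq_map.
Qed.

(** Let [A] be the set of indices with value above [t]: there the sum of [f] is the tail plus
    [#|A| * t], and [sumn_take_le] bounds the other side. *)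
Lemma domle_partial_sums (I : finType) (f : I -> nat) s :
  \sum_i f i = sumn s ->
  (forall A : {set I}, \sum_(i in A) f i <= sumn (take #|A| s)) ->
  domle [seq f i | i <- enum I] s.
Proof.
move=> e h; split; first by rewrite sumnE big_map big_enum.
move=> t; rewrite {1}/ts big_map big_enum /=.
set A := [set i | t < f i].
have -> : \sum_i (f i - t) = \sum_(i in A) (f i - t).
  rewrite [RHS]big_mkcond; apply: eq_bigr => i _; rewrite inE.
  by case: ltnP => // le; apply/eqP; rewrite subn_eq0.
have E : \sum_(i in A) f i = \sum_(i in A) (f i - t) + #|A| * t.
  rewrite -sum_nat_const -big_split /=; apply: eq_bigr => i; rewrite inE => /ltnW.
  by move/subnK.
by have := sumn_take_le #|A| s t; have := h A; rewrite E; lia.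
Qed.
End Columns.

(** * Contents and hooks *)
Section Contents.
Variable R : realFieldType.
Implicit Types (a b x : R) (s l : seq nat).

(* Eigenvalue of the Laplace-Beltrami operator on the Jack polynomial of shape [s]. *)
Definition eps b s : R := b * (qs s)%:R - (mn s)%:R.

(** Along dominance both [b * qs] and [- mn] are nondecreasing, so equal eigenvalues force equal
    [qs]. *)
Lemma eps_inj b s u : 0 < b -> domle s u -> eps b s = eps b u -> ts s =1 ts u.
Proof.
move=> b0 h e; apply: (domle_qs_eq h); apply/eqP; rewrite eqn_leq domle_qs //=.
rewrite -(ler_nat R) -(ler_pM2l b0).
have : (mn u)%:R <= (mn s)%:R :> R by rewrite ler_nat domle_mn.
by move: e; rewrite /eps; lra.
Qed.

Lemma eps_ts b s u : ts s =1 ts u -> eps b s = eps b u.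
Proof.
have H v w : ts v =1 ts w -> domle v w by move=> h; split=> [|t]; rewrite -?ts0 h.
move=> h; rewrite /eps; have h' : ts u =1 ts s by move=> t; rewrite h.
have -> : qs s = qs u by apply/eqP; rewrite eqn_leq !domle_qs //; apply: H.
by have -> : mn s = mn u by apply/eqP; rewrite eqn_leq !domle_mn //; apply: H.
Qed.

Lemma eps_drop_col b s : all (fun k => 0 < k)%N s ->
  eps b s = eps b (drop_col s) + b * (sumn (drop_col s))%:R - 'C(size s, 2)%:R.
Proof. by move=> h; rewrite /eps qs_drop_col // mn_drop_col // !natrD; ring. Qed.

Lemma eps_cons b m s : all (fun k => k <= m)%N s ->
  eps b (m :: s) = eps b s + b * 'C(m, 2)%:R - (sumn s)%:R.
Proof. by move=> h; rewrite /eps qs_cons mn_cons // !natrD; ring. Qed.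

(** Conjugation exchanges [qs] and [mn]: this is the duality between the parameters a and 1 / a on
    eigenvalues. *)
Lemma eps_conj_seq a K s : a != 0 -> all (fun k => k <= K)%N s ->
  eps a (conj_seq K s) = - a * eps a^-1 s.
Proof.
by move=> a0 h; rewrite /eps qs_conj_seq // mn_conj_seq // mulrBr mulNr mulVKf // mulNr opprK addrC.
Qed.

Definition content_poly a l : {poly R} :=
  \prod_(i < size l) \prod_(j < nth 0%N l i) ('X + (a * j%:R - i%:R)%:P).

Lemma prod_rows (A : comPzRingType) (g : nat -> nat -> A) l N : (size l <= N)%N ->
  \prod_(i < size l) \prod_(j < nth 0%N l i) g i j
  = \prod_(i < N) \prod_(j < nth 0%N l i) g i j.
Proof.
move=> h; rewrite (big_ord_widen _ (fun i => \prod_(j < nth 0%N l i) g i j) h).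
rewrite big_mkcond; apply: eq_bigr => i _; case: ltnP => // ge.
by rewrite nth_default // big_ord0.
Qed.

Lemma content_polyE a l x :
  (content_poly a l).[x] = \prod_(i < size l) \prod_(j < nth 0%N l i) (x + a * j%:R - i%:R).
Proof.
rewrite /content_poly horner_prod; apply: eq_bigr => i _; rewrite horner_prod.
by apply: eq_bigr => j _; rewrite hornerD hornerX hornerC addrA.
Qed.

Lemma nth_drop_col n l i : is_partition n l -> nth 0%N (drop_col l) i = (nth 0%N l i).-1.
Proof.
move=> pl; have [/and3P [sl _ _] /and3P [sd _ _]] := (pl, drop_col_partition pl).
have H j : (j < nth 0 (drop_col l) i)%N = (j < (nth 0 l i).-1)%N.
  by rewrite nth_conj_part // conj_part_drop_col -nth_conj_part //; lia.
apply/eqP; rewrite eqn_leq; apply/andP; split; rewrite leqNgt; apply/negP.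
  by rewrite H ltnn.
by rewrite -H ltnn.
Qed.

Lemma nth_partition_gt0 n l i : is_partition n l -> (i < size l)%N -> (0 < nth 0%N l i)%N.
Proof. by case/and3P=> _ h _ lt; apply: (all_nthP 0%N h). Qed.

(** The first column contributes the factors x - i; every other box loses 1 from its coarm, which
    evaluation at [x + a] compensates. *)
Lemma content_poly_drop_col n a l x : is_partition n l ->
  (content_poly a l).[x] = \prod_(i < size l) (x - i%:R) * (content_poly a (drop_col l)).[x + a].
Proof.
move=> pl; rewrite !content_polyE.
rewrite (prod_rows (fun i j => x + a + a * j%:R - i%:R) (size_drop_col l)) -big_split /=.
apply: eq_bigr => i _; rewrite (nth_drop_col i pl).
have := nth_partition_gt0 pl (ltn_ord i); case: (nth 0%N l i) => // m _ /=.
rewrite big_ord_recl mulr0 addr0; congr (_ * _).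
by apply: eq_bigr => j _; rewrite lift0 -addn1 natrD; ring.
Qed.

Lemma hook_h_gt0 a l : 0 < a -> 0 < hook_h a l.
Proof.
move=> a0; rewrite /hook_h; apply: prodr_gt0 => i _; apply: prodr_gt0 => j _.
have h1 : 0 <= a * (arm l i j)%:R by rewrite mulr_ge0 ?ler0n ?ltW.
have h2 : 0 <= (leg l i j)%:R :> R by rewrite ler0n.
lra.
Qed.

Lemma content_poly_gt0 a l N : 0 < a -> (size l <= N)%N -> 0 < (content_poly a l).[N%:R].
Proof.
move=> a0 h; rewrite content_polyE; apply: prodr_gt0 => i _; apply: prodr_gt0 => j _.
have : i%:R < N%:R :> R by rewrite ltr_nat (leq_trans (ltn_ord i)).
have : 0 <= a * j%:R by rewrite mulr_ge0 ?ler0n ?ltW.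
lra.
Qed.

(** Row by row, with N = [size l] and row i of length m + 1: the content factor of the last box and
    the hook factor of the first box are both a m + N - i, and all the other factors are those of
    [drop_col l]. *)
Lemma hook_h_col n a l : is_partition n l ->
  (content_poly a l).[(size l)%:R] * hook_h a (drop_col l)
  = hook_h a l * (content_poly a (drop_col l)).[(size l)%:R].
Proof.
move=> pl; rewrite !content_polyE /hook_h.
have [/and3P [sl pos _] /and3P [sd _ _]] := (pl, drop_col_partition pl).
rewrite (prod_rows (fun i j => (size l)%:R + a * j%:R - i%:R) (size_drop_col l)).
rewrite (prod_rows (fun i j => a * (arm (drop_col l) i j)%:R + (leg (drop_col l) i j)%:R + 1) (size_drop_col l)).
rewrite -!big_split /=; apply: eq_bigr => i _; rewrite /arm (nth_drop_col i pl).
have := nth_partition_gt0 pl (ltn_ord i); case: (nth 0%N l i) => // m _ /=.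
rewrite big_ord_recr [in RHS]big_ord_recl /= -mulrA [RHS]mulrC.
congr (_ * (_ * _)); last first.
  by apply: eq_bigr => j _; rewrite /leg conj_part_drop_col /bump leq0n add1n !subSS.
rewrite /leg conj_part0 // subSS subn0 natrB; last by rewrite ltn_ord.
by rewrite -addn1 natrD; ring.
Qed.

Lemma content_poly_cols n m a l x : is_partition n l -> all (fun k => k <= m)%N l ->
  (content_poly a l).[x] = \prod_(j < m) \prod_(i < conj_part l j) (x + a * j%:R - i%:R).
Proof.
move=> pl lm; have [/and3P [sl pos _]] := pl; rewrite content_polyE.
have ha i : (nth 0 l i <= m)%N.
  by have [lt|ge] := ltnP i (size l); [apply: (all_nthP 0%N lm)|rewrite (nth_default _ ge)].
have hb j : (conj_part l j <= size l)%N by apply: count_size.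
under eq_bigr => i _ do
  rewrite (big_ord_widen _ (fun j => x + a * j%:R - i%:R) (ha i)) big_mkcond.
under [RHS]eq_bigr => j _ do
  rewrite (big_ord_widen _ (fun i => x + a * j%:R - i%:R) (hb j)) big_mkcond.
rewrite exchange_big /=; apply: eq_bigr => j _; apply: eq_bigr => i _.
by rewrite nth_conj_part.
Qed.

(** At x = - a m the bottom box of column j contributes minus the factor of [hook_h'] at box j of
    the first row (see [hook_h'_row]); the boxes above it form column j of [l]. *)
Lemma content_poly_row n a m l : is_partition n (m :: l) ->
  (content_poly a (m :: l)).[- (a * m%:R)]
  = \prod_(j < m) (- (a * (m%:R - j%:R) + (conj_part l j)%:R)) * (content_poly a l).[- (a * m%:R)].
Proof.
move=> pl; have [pl' m0 lm] := partition_cons pl.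
have lm' : all (fun k => k <= m)%N (m :: l) by rewrite /= leqnn.
rewrite (content_poly_cols _ _ pl lm') (content_poly_cols _ _ pl' lm) -big_split /=.
apply: eq_bigr => j _; rewrite conj_part_cons ltn_ord add1n big_ord_recr /= mulrC.
by congr (_ * _); ring.
Qed.

Lemma content_poly_row_neq0 a m l : 0 < a -> all (fun k => k <= m)%N l ->
  (content_poly a l).[- (a * m%:R)] != 0.
Proof.
move=> a0 lm; rewrite content_polyE; apply/prodf_neq0 => i _; apply/prodf_neq0 => j _.
apply: ltr0_neq0; have : j%:R < m%:R :> R.
  by rewrite ltr_nat (leq_trans (ltn_ord j)) //; apply: (all_nthP 0%N lm).
move=> h; have : a * j%:R < a * m%:R by rewrite ltr_pM2l.
have : 0 <= i%:R :> R by rewrite ler0n.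
lra.
Qed.

Lemma hook_h'_row n a m l : is_partition n (m :: l) ->
  hook_h' a (m :: l)
  = \prod_(j < m) (a * (m%:R - j%:R) + (conj_part l j)%:R) * hook_h' a l.
Proof.
move=> pl; have [/and3P [sl _ _] m0 lm] := partition_cons pl.
rewrite /hook_h' big_ord_recl /=; congr (_ * _).
  apply: eq_bigr => j _; rewrite /arm /leg /= conj_part_cons ltn_ord add1n subSS subn0.
  rewrite natrB; last by rewrite ltn_ord.
  by rewrite -addn1 natrD; ring.
apply: eq_bigr => i _; apply: eq_bigr => j _; rewrite /arm /leg /= conj_part_cons.
suff -> : (j < m)%N by rewrite /bump leq0n !add1n subSS.
exact: leq_trans (ltn_ord j) (all_nthP 0%N lm _ (ltn_ord i)).
Qed.
End Contents.

(** * Operators on power sums *)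
Section PowerSums.
Variables (R : realFieldType) (K : nat).
Implicit Types (f g h : {mpoly R[K]}) (m : 'X_{1..K}) (a b c s : R) (i j k l : 'I_K).

Lemma mpoly_indX (P : {mpoly R[K]} -> Prop) :
  (forall c, P c%:MP) -> (forall f g, P f -> P g -> P (f + g)) ->
  (forall i f, P f -> P ('X_i * f)) -> forall f, P f.
Proof.
move=> PC PD PX f; rewrite [f]mpolyE.
apply: (big_ind P) => [||m _]; [exact: (PC 0)|exact: PD|].
rewrite -mul_mpolyC; move: (f@_m) => c; have [d] := ubnP (mdeg m).
elim: d m => // d IH m ltd; have [->|] := eqVneq m 0%MM; first by rewrite mpolyX0 mulr1.
rewrite -mdeg_eq0 mdegE sum_nat_eq0 => /forallPn [i]; rewrite implyTb => mi.
have e : m = (U_(i) + (m - U_(i)))%MM by rewrite addmC submK // lep1mP.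
rewrite e mpolyXD mulrCA; apply/PX/IH.
by move: ltd; rewrite {1}e mdegD mdeg1.
Qed.

(** [pinner] sums over the support of its first argument only; symmetry and additivity are proved
    after enlarging the supports to a common list. *)
Lemma sum_msupp_sub (w : 'X_{1..K} -> R) f (r : seq 'X_{1..K}) :
  uniq r -> {subset msupp f <= r} ->
  \sum_(m <- msupp f) f@_m * w m = \sum_(m <- r) f@_m * w m.
Proof.
move=> ur sub; rewrite [RHS](bigID (mem (msupp f))) /= [X in _ + X]big1 ?addr0.
  rewrite -[RHS]big_filter; apply: perm_big; apply: uniq_perm.
  - exact: msupp_uniq.
  - exact: filter_uniq.
  - by move=> m; rewrite mem_filter; case: (boolP (m \in msupp f)) => //= /sub ->.
by move=> m /memN_msupp_eq0 ->; rewrite mul0r.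
Qed.

Lemma pinnerE a f g : pinner a f g
  = \sum_(m <- msupp f) f@_m * (g@_m * a ^+ mdeg m * (zee m)%:R).
Proof. by apply: eq_bigr => m _; rewrite !mulrA. Qed.

Lemma pinnerDl a f g h : pinner a (f + g) h = pinner a f h + pinner a g h.
Proof.
rewrite !pinnerE; set r := undup (msupp f ++ msupp g).
have ur : uniq r by apply: undup_uniq.
rewrite !(@sum_msupp_sub _ _ r) // -?big_split /=.
- by apply: eq_bigr => m _; rewrite mcoeffD mulrDl.
- by move=> m hm; rewrite mem_undup mem_cat hm orbT.
- by move=> m hm; rewrite mem_undup mem_cat hm.
- by move=> m /msuppD_le; rewrite mem_undup.
Qed.

Lemma pinnerZl a c f h : pinner a (c *: f) h = c * pinner a f h.
Proof.
have [->|c0] := eqVneq c 0; first by rewrite scale0r mul0r /pinner msupp0 big_nil.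
rewrite /pinner (perm_big _ (msuppZ _ c0)) mulr_sumr.
by apply: eq_bigr => m _; rewrite mcoeffZ !mulrA.
Qed.

Lemma pinnerC a f g : pinner a f g = pinner a g f.
Proof.
rewrite !pinnerE; set r := undup (msupp f ++ msupp g).
have ur : uniq r by apply: undup_uniq.
rewrite !(@sum_msupp_sub _ _ r) //.
- by apply: eq_bigr => m _; ring.
- by move=> m hm; rewrite mem_undup mem_cat hm orbT.
- by move=> m hm; rewrite mem_undup mem_cat hm.
Qed.

Lemma pinnerDr a f g h : pinner a h (f + g) = pinner a h f + pinner a h g.
Proof. by rewrite pinnerC pinnerDl !(pinnerC _ h). Qed.

Lemma pinnerZr a c f h : pinner a h (c *: f) = c * pinner a h f.
Proof. by rewrite pinnerC pinnerZl (pinnerC _ h). Qed.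

Lemma pinner0l a f : pinner a 0 f = 0.
Proof. by rewrite -(scale0r 0) pinnerZl mul0r. Qed.

Lemma pinner_suml a (I : Type) (r : seq I) (P : pred I) (F : I -> {mpoly R[K]}) h :
  pinner a (\sum_(x <- r | P x) F x) h = \sum_(x <- r | P x) pinner a (F x) h.
Proof. exact: (big_morph (fun f => pinner a f h) (fun f g => pinnerDl a f g h) (pinner0l a h)). Qed.

Lemma pinner_sumr a (I : Type) (r : seq I) (P : pred I) (F : I -> {mpoly R[K]}) h :
  pinner a h (\sum_(x <- r | P x) F x) = \sum_(x <- r | P x) pinner a h (F x).
Proof. by rewrite pinnerC pinner_suml; apply: eq_bigr => x _; rewrite pinnerC. Qed.

Lemma pinnerBl a f g h : pinner a (f - g) h = pinner a f h - pinner a g h.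
Proof. by rewrite pinnerDl -scaleN1r pinnerZl mulN1r. Qed.

Lemma pinnerXl a m g : pinner a 'X_[m] g = g@_m * a ^+ mdeg m * (zee m)%:R.
Proof. by rewrite /pinner msuppX big_seq1 mcoeffX eqxx mul1r. Qed.

Lemma zeeD1 m k : zee (U_(k) + m) = (zee m * (k.+1 * (m k).+1))%N.
Proof.
rewrite /zee (bigD1 k) //= [in RHS](bigD1 k) //= mnmDE mnm1E eqxx add1n expnS factS.
rewrite (eq_bigr (fun i : 'I_K => (i.+1 ^ m i * (m i)`!)%N)); first by lia.
by move=> i ne; rewrite mnmDE mnm1E eq_sym (negbTE ne).
Qed.

Lemma pinner_mulX a k f g :
  pinner a ('X_k * f) g = a * (k.+1)%:R * pinner a f g^`M(k).
Proof.
rewrite [f]mpolyE mulr_sumr !pinner_suml mulr_sumr; apply: eq_bigr => m _.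
rewrite -scalerAr !pinnerZl -mpolyXD !pinnerXl mcoeff_mderiv zeeD1 mdegD mdeg1 exprS.
by rewrite addmC -mulr_natr !natrM; ring.
Qed.

Lemma pinner_gt0 a f : 0 < a -> f != 0 -> 0 < pinner a f f.
Proof.
move=> a0; rewrite -msupp_eq0 /pinner; case: (msupp f) (@mcoeff_msupp _ _ f) => // m r hm _.
have H x : 0 < a ^+ mdeg x * (zee x)%:R.
  rewrite mulr_gt0 ?exprn_gt0 // ltr0n prodn_gt0 // => i.
  by rewrite muln_gt0 expn_gt0 fact_gt0.
rewrite big_cons ltr_wpDr //.
  apply: sumr_ge0 => x _; rewrite -mulrA; apply: mulr_ge0; last exact: ltW.
  by rewrite -expr2 sqr_ge0.
rewrite -mulrA; apply: mulr_gt0 => //; rewrite -expr2 exprn_even_gt0 //=.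
by rewrite -hm inE eqxx.
Qed.

(** [mnmwgt] gives p_(i+1) the weight i + 1, so this is homogeneity of degree [n] in the variables
    x; 0 has every weight. *)
Definition wt n f := forall m, f@_m != 0 -> mnmwgt m = n.

Lemma wt0 n : wt n 0.
Proof. by move=> m; rewrite mcoeff0 eqxx. Qed.

Lemma wtD n f g : wt n f -> wt n g -> wt n (f + g).
Proof.
move=> hf hg m; rewrite mcoeffD; have [e|/hf //] := eqVneq f@_m 0.
by rewrite e add0r => /hg.
Qed.

Lemma wtZ n c f : wt n f -> wt n (c *: f).
Proof. by move=> hf m; rewrite mcoeffZ mulf_eq0 negb_or => /andP [_ /hf]. Qed.

Lemma wtB n f g : wt n f -> wt n g -> wt n (f - g).
Proof. by move=> hf hg; rewrite -scaleN1r; apply/wtD/wtZ. Qed.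

Lemma wt_sum n (I : Type) (r : seq I) (P : pred I) (F : I -> {mpoly R[K]}) :
  (forall x, P x -> wt n (F x)) -> wt n (\sum_(x <- r | P x) F x).
Proof. by move=> h; apply: (big_ind (wt n)) => //; [exact: wt0|exact: wtD]. Qed.

Lemma wt_deriv n k f : wt (n + k.+1) f -> wt n f^`M(k).
Proof.
move=> hf m; rewrite mcoeff_mderiv -mulr_natr mulf_eq0 negb_or => /andP [/hf + _].
by rewrite mnmwgtD mnmwgt1 => /eqP; rewrite eqn_add2r => /eqP.
Qed.

Lemma wt_deriv0 n k f : (n < k.+1)%N -> wt n f -> f^`M(k) = 0.
Proof.
move=> lt hf; apply/mpolyP => m; rewrite mcoeff_mderiv mcoeff0.
have [->|/hf] := eqVneq f@_(m + U_(k)) 0; first by rewrite mul0rn.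
by rewrite mnmwgtD mnmwgt1; lia.
Qed.

Lemma mcoeff_mulXm m0 g m :
  ('X_[m0] * g)@_m = if (m0 <= m)%MM then g@_(m - m0) else 0.
Proof.
rewrite mulrC; case: ifPn => h; first by rewrite -{1}(submK h) addmC mcoeffMX.
apply: memN_msupp_eq0; rewrite (perm_mem (msuppMX _ _)); apply: contra h.
by case/mapP => m' _ ->; apply: lem_addr.
Qed.

Lemma wt_mulX n k f : wt n f -> wt (n + k.+1) ('X_k * f).
Proof.
move=> hf m; rewrite mcoeff_mulXm; case: ifP => [h|_]; last by rewrite eqxx.
by move=> /hf <-; rewrite -mnmwgt1 -mnmwgtD submK.
Qed.

Lemma wt_deriv' n k f : wt n f -> wt (n - k.+1) f^`M(k).
Proof.
move=> hf; have [lt|ge] := ltnP n k.+1; first by rewrite (wt_deriv0 lt hf); apply: wt0.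
by apply: wt_deriv; rewrite subnK.
Qed.

Lemma mcoeff_mulXd k g m : ('X_k * g^`M(k))@_m = g@_m *+ m k.
Proof.
rewrite mcoeff_mulXm lep1mP; case: eqP => /= [->|/eqP mk]; first by rewrite mulr0n.
have le : (U_(k) <= m)%MM by rewrite lep1mP.
rewrite mcoeff_mderiv submK // mnmBE mnm1E eqxx.
by rewrite subn1 prednK // lt0n.
Qed.

(** The Euler operator, the sum of k p_k d/dp_k. By [wtP] homogeneity is an eigenvalue equation, a
    form that passes through evaluation ([euler_evs]). *)
Definition weight_op f : {mpoly R[K]} := \sum_(k < K) (k.+1)%:R *: ('X_k * f^`M(k)).

Lemma mcoeff_weight_op f m : (weight_op f)@_m = (mnmwgt m)%:R * f@_m.
Proof.
rewrite /weight_op raddf_sum /= /mnmwgt natr_sum mulr_suml; apply: eq_bigr => k _.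
by rewrite mcoeffZ mcoeff_mulXd natrM -mulr_natr; ring.
Qed.

Lemma wtP n f : wt n f <-> weight_op f = n%:R *: f.
Proof.
split=> [h|h m hm].
  apply/mpolyP => m; rewrite mcoeff_weight_op mcoeffZ.
  by have [->|/h ->] := eqVneq f@_m 0; rewrite ?mulr0.
move: (congr1 (mcoeff m) h); rewrite mcoeff_weight_op mcoeffZ => /(mulIf hm) /eqP.
by rewrite eqr_nat => /eqP.
Qed.

(** With d_k = d/dp_k this is the classical a/2 sum i j p_(i+j) d_i d_j + 1/2 sum (i+j) p_i p_j
    d_(i+j) + (a-1)/2 sum k (k-1) p_k d_k. Indices are shifted by one and the terms with i + j > K
    are cut off, which is harmless in degrees at most K. *)
Definition LB_psum a f : {mpoly R[K]} :=
  \sum_(i < K) \sum_(j < K) \sum_(k < K | (i + j).+1 == k)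
     ((a / 2 * (i.+1)%:R * (j.+1)%:R) *: ('X_k * f^`M(j)^`M(i))
      + ((k.+1)%:R / 2) *: ('X_i * ('X_j * f^`M(k))))
  + \sum_(k < K) ((a - 1) / 2 * (k.+1)%:R * k%:R) *: ('X_k * f^`M(k)).

Lemma pinner_deriv a k f g : a != 0 ->
  pinner a f^`M(k) g = (a * (k.+1)%:R)^-1 * pinner a f ('X_k * g).
Proof.
move=> a0; rewrite [in RHS]pinnerC pinner_mulX mulKf; first exact: pinnerC.
by rewrite mulf_neq0 // pnatr_eq0.
Qed.

(** Adjunction exchanges the terms p_(i+j) d_i d_j with the terms p_i p_j d_(i+j), constants
    included; the diagonal terms are self-adjoint. *)
Lemma LB_psum_selfadj a f g : a != 0 -> pinner a (LB_psum a f) g = pinner a f (LB_psum a g).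
Proof.
move=> a0; have n0 (i : 'I_K) : (i.+1)%:R != 0 :> R by rewrite pnatr_eq0.
rewrite /LB_psum pinnerDl pinnerDr; congr (_ + _); last first.
  rewrite pinner_suml pinner_sumr; apply: eq_bigr => k _.
  rewrite pinnerZl pinnerZr; congr (_ * _).
  by rewrite pinner_mulX pinner_deriv // mulVKf // mulf_neq0.
rewrite pinner_suml pinner_sumr; apply: eq_bigr => i _.
rewrite pinner_suml pinner_sumr; apply: eq_bigr => j _.
rewrite pinner_suml pinner_sumr; apply: eq_bigr => k _.
rewrite pinnerDl pinnerDr !pinnerZl !pinnerZr addrC; congr (_ + _).
  rewrite !pinner_mulX mderiv_comm pinner_deriv //.
  by field; rewrite !nat1r !n0 a0.
rewrite pinner_mulX !pinner_deriv // (mulrCA 'X_j).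
by field; rewrite !nat1r !n0 a0.
Qed.

(** The adjoint of p_(k+1) brings a (k+1) and that of d/dp_k brings 1 / (a k); with the factor k of
    [E2] exactly k + 1 is left, free of a. *)
Lemma E2_adj a f g : a != 0 -> pinner a (E2 f) g = pinner a f (E2perp g).
Proof.
move=> a0; have n0 (i : 'I_K) : (i.+1)%:R != 0 :> R by rewrite pnatr_eq0.
rewrite /E2 /E2perp !(pinner_suml, pinner_sumr); apply: eq_bigr => i _.
rewrite !(pinner_suml, pinner_sumr); apply: eq_bigr => j /eqP e.
rewrite pinnerZl pinnerZr pinner_mulX pinner_deriv // e.
by field; rewrite !nat1r !n0 a0.
Qed.

Lemma wt_E2 n f : wt n f -> wt n.+1 (E2 f).
Proof.
move=> hf; apply: wt_sum => i _; apply: wt_sum => j /eqP e; apply: wtZ.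
have [lt|ge] := ltnP n i.+1; first by rewrite (wt_deriv0 lt hf) mulr0; apply: wt0.
rewrite (_ : n.+1 = n - i.+1 + j.+1)%N; first exact/wt_mulX/wt_deriv'.
by rewrite e addnS subnK.
Qed.

Lemma wt_E2perp n f : wt n.+1 f -> wt n (E2perp f).
Proof.
move=> hf; apply: wt_sum => i _; apply: wt_sum => j /eqP e; apply: wtZ.
have [lt|ge] := ltnP n i.+1.
  by rewrite (wt_deriv0 _ hf) ?mulr0; [apply: wt0|rewrite e].
rewrite (_ : n = n - i.+1 + i.+1)%N; last by rewrite subnK.
apply/wt_mulX/wt_deriv; rewrite e addnS subnK //.
Qed.

Lemma wt_LB_psum a n f : wt n f -> wt n (LB_psum a f).
Proof.
move=> hf; have H k : wt n ('X_k * f^`M(k)).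
  have [lt|ge] := ltnP n k.+1; first by rewrite (wt_deriv0 lt hf) mulr0; apply: wt0.
  by rewrite -[n in wt n _](subnK ge); apply/wt_mulX/wt_deriv'.
apply: wtD; last by apply: wt_sum => k _; apply: wtZ.
apply: wt_sum => i _; apply: wt_sum => j _; apply: wt_sum => k /eqP e.
apply: wtD; apply: wtZ.
  have [lt|ge] := ltnP n k.+1.
    have [lt'|ge'] := ltnP n j.+1.
      by rewrite (wt_deriv0 lt' hf) mderiv0 mulr0; apply: wt0.
    rewrite (@wt_deriv0 (n - j.+1)) ?mulr0; first exact: wt0.
      by lia.
    exact: wt_deriv'.
  rewrite -[n in wt n _](subnK ge); apply: wt_mulX.
  rewrite (_ : n - k.+1 = n - j.+1 - i.+1)%N; last by lia.
  by do 2 apply: wt_deriv'.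
have [lt|ge] := ltnP n k.+1; first by rewrite (wt_deriv0 lt hf) !mulr0; apply: wt0.
rewrite (_ : n = n - k.+1 + j.+1 + i.+1)%N; last by lia.
by do 2 apply: wt_mulX; exact: wt_deriv'.
Qed.

Lemma mderivXX i k : ('X_i : {mpoly R[K]})^`M(k) = (i == k)%:R%:MP.
Proof.
rewrite mderivX mnm1E; case: eqP => [->|_]; last by rewrite scale0r.
rewrite scale1r (_ : (U_(k) - U_(k))%MM = 0%MM) ?mpolyX0 //.
by apply/mnmP => l; rewrite mnmBE subnn mnm0E.
Qed.

(** Only the terms p_i p_j d_(i+j) with i = 1 or j = 1 contribute: p_1 is never a p_(i+j), and its
    diagonal term has coefficient 0. The two cases are equal by symmetry, which cancels the factor
    1/2. *)
Lemma mderiv0_LB_psum a f (o : 'I_K) : o = 0%N :> nat ->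
  (LB_psum a f)^`M(o) = LB_psum a f^`M(o) + E2perp f.
Proof.
move=> o0; rewrite /LB_psum mderivD.
have dX i : (i != o) -> ('X_i : {mpoly R[K]})^`M(o) = 0.
  by move=> ne; rewrite mderivXX (negbTE ne).
have -> : (\sum_(k < K) ((a - 1) / 2 * (k.+1)%:R * k%:R) *: ('X_k * f^`M(k)))^`M(o)
   = \sum_(k < K) ((a - 1) / 2 * (k.+1)%:R * k%:R) *: ('X_k * f^`M(o)^`M(k)).
  rewrite raddf_sum /=; apply: eq_bigr => k _; rewrite mderivZ mderivM mderiv_comm.
  have [->|ne] := eqVneq k o; first by rewrite o0 mulr0 !scale0r.
  by rewrite dX // mul0r add0r.
rewrite addrAC; congr (_ + _).
rewrite raddf_sum /=.
transitivity (\sum_(i < K) \sum_(j < K) \sum_(k < K | (i + j).+1 == k)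
     (((a / 2 * (i.+1)%:R * (j.+1)%:R) *: ('X_k * f^`M(o)^`M(j)^`M(i))
      + ((k.+1)%:R / 2) *: ('X_i * ('X_j * f^`M(o)^`M(k))))
     + ((k.+1)%:R / 2) *: ((i == o)%:R *: ('X_j * f^`M(k)) + (j == o)%:R *: ('X_i * f^`M(k))))).
  apply: eq_bigr => i _; rewrite raddf_sum; apply: eq_bigr => j _.
  rewrite raddf_sum; apply: eq_bigr => k /eqP e /=.
  rewrite mderivD !mderivZ !mderivM !mderivXX (_ : (k == o) = false); last first.
    by apply/negbTE; rewrite -(inj_eq val_inj) /= o0 -e.
  rewrite mpolyC0 mul0r add0r (mderiv_comm i o) (mderiv_comm j o) (mderiv_comm k o).
  by rewrite -!mul_mpolyC; ring.
have H (c : 'I_K -> 'I_K -> R) (F : 'I_K -> 'I_K -> {mpoly R[K]}) :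
    \sum_(i < K) \sum_(j < K) \sum_(k < K | (i + j).+1 == k)
      (c i j *: ((i == o)%:R *: F j k))
    = \sum_(j < K) \sum_(k < K | k == j.+1 :> nat) c o j *: F j k.
  rewrite (bigD1 o) //= [X in _ + X]big1 ?addr0; last first.
    move=> i ne; apply: big1 => j _; apply: big1 => k _.
    by rewrite (negbTE ne) scale0r scaler0.
  apply: eq_bigr => j _; apply: eq_big => k; first by rewrite o0 eq_sym.
  by rewrite eqxx scale1r.
set S := (X in _ = X + _).
suff -> : E2perp f = \sum_(i < K) \sum_(j < K) \sum_(k < K | (i + j).+1 == k)
      ((k.+1)%:R / 2) *: ((i == o)%:R *: ('X_j * f^`M(k)))
   + \sum_(i < K) \sum_(j < K) \sum_(k < K | (i + j).+1 == k)
      ((k.+1)%:R / 2) *: ((j == o)%:R *: ('X_i * f^`M(k))).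
  rewrite /S -!big_split; apply: eq_bigr => i _; rewrite -!big_split; apply: eq_bigr => j _.
  by rewrite -!big_split; apply: eq_bigr => k _ /=; rewrite [in LHS]scalerDr.
have -> : \sum_(i < K) \sum_(j < K) \sum_(k < K | (i + j).+1 == k)
      ((k.+1)%:R / 2) *: ((j == o)%:R *: ('X_i * f^`M(k)))
   = \sum_(i < K) \sum_(j < K) \sum_(k < K | (i + j).+1 == k)
      ((k.+1)%:R / 2) *: ((i == o)%:R *: ('X_j * f^`M(k))).
  rewrite exchange_big /=; apply: eq_bigr => i _; apply: eq_bigr => j _.
  by apply: eq_bigl => k; rewrite addnC.
have -> : \sum_(i < K) \sum_(j < K) \sum_(k < K | (i + j).+1 == k)
      ((k.+1)%:R / 2) *: ((i == o)%:R *: ('X_j * f^`M(k)))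
  = \sum_(j < K) \sum_(k < K | k == j.+1 :> nat) ((o + j).+2%:R / 2) *: ('X_j * f^`M(k)).
  rewrite -(H (fun i j => ((i + j).+2)%:R / 2) (fun j k => 'X_j * f^`M(k))).
  by apply: eq_bigr => i _; apply: eq_bigr => j _; apply: eq_bigr => k /eqP ->.
rewrite -big_split; apply: eq_bigr => j _; rewrite -big_split; apply: eq_bigr => k _ /=.
by rewrite -scalerDl o0 add0n; congr (_ *: _); field.
Qed.
End PowerSums.

(** * Evaluation in finitely many variables *)
Section Evaluation.
Variables (R : realFieldType) (K : nat).
Implicit Types (f g h F G : {mpoly R[K]}) (m : 'X_{1..K}) (a b c s t : R) (i j k l : 'I_K).

Definition psx (N n : nat) : {mpoly R[K]} := \sum_(j < K | (j < N)%N) 'X_j ^+ n.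

Definition evt s N : K.-tuple {mpoly R[K]} := [tuple s *: psx N i.+1 | i < K].

(* [evs s N] evaluates [p_k] at [s] times the power sum of the first [N] variables. *)
Local Notation evs s N := (comp_mpoly (evt s N)).

Lemma ev_evs f : ev f = evs 1 K f.
Proof.
rewrite /ev; congr (_ \mPo _); apply: eq_from_tnth => i; rewrite !tnth_mktuple scale1r.
by apply: eq_bigl => j; rewrite ltn_ord.
Qed.

Lemma evsX s N i : evs s N 'X_i = s *: psx N i.+1.
Proof. by rewrite comp_mpolyXU (nth_map i) ?size_enum_ord // nth_ord_enum. Qed.

Lemma comp_mpoly_deriv n (lq : K.-tuple {mpoly R[n]}) f (l : 'I_n) :
  (f \mPo lq)^`M(l) = \sum_(k < K) (f^`M(k) \mPo lq) * (tnth lq k)^`M(l).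
Proof.
elim/mpoly_indX: f => [c|f g IHf IHg|i f IH].
- by rewrite comp_mpolyC mderivC big1 // => k _; rewrite mderivC comp_mpoly0 mul0r.
- rewrite comp_mpolyD mderivD IHf IHg -big_split /=; apply: eq_bigr => k _.
  by rewrite mderivD comp_mpolyD mulrDl.
have Xi : 'X_i \mPo lq = tnth lq i by rewrite comp_mpolyXU -tnth_nth.
rewrite rmorphM /= Xi mderivM IH.
have -> : (tnth lq i)^`M(l) * (f \mPo lq)
    = \sum_(k < K) (i == k)%:R * (f \mPo lq) * (tnth lq k)^`M(l).
  rewrite (bigD1 i) //= eqxx mul1r mulrC big1 ?addr0 // => k ne.
  by rewrite eq_sym (negbTE ne) !mul0r.
rewrite mulr_sumr -big_split /=.
apply: eq_bigr => k _; rewrite mderivM mderivXX comp_mpolyD !rmorphM /= Xi.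
by rewrite comp_mpolyC mpolyC_nat mulrDl mulrA.
Qed.

Lemma mderiv_Xn l j n : ('X_j ^+ n.+1 : {mpoly R[K]})^`M(l)
  = (j == l)%:R *: ((n.+1)%:R *: 'X_j ^+ n).
Proof.
elim: n => [|n IH]; first by rewrite expr1 expr0 mderivXX scale1r -mul_mpolyC mulr1.
rewrite exprS mderivM IH mderivXX -!mul_mpolyC.
case: eqP => [->|_]; last by rewrite mpolyC0; ring.
by rewrite exprS -[n.+2%:R]natr1 mpolyCD; ring.
Qed.

Lemma mderiv_psx l N n : (psx N n.+1)^`M(l)
  = if (l < N)%N then (n.+1)%:R *: 'X_l ^+ n else 0.
Proof.
rewrite /psx raddf_sum /=; under eq_bigr => j _ do rewrite mderiv_Xn.
case: ifPn => h.
  rewrite (bigD1 l) //= eqxx scale1r big1 ?addr0 // => j /andP [_ /negbTE ->].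
  by rewrite scale0r.
apply: big1 => j hj; case: eqP => [e|_]; last by rewrite scale0r.
by rewrite -e hj in h.
Qed.

Lemma mderiv_evs l s N f : (l < N)%N ->
  (evs s N f)^`M(l) = \sum_(k < K) (s * (k.+1)%:R) *: (evs s N f^`M(k) * 'X_l ^+ k).
Proof.
move=> h; rewrite comp_mpoly_deriv; apply: eq_bigr => k _.
by rewrite tnth_mktuple mderivZ mderiv_psx h scalerA scalerAr.
Qed.

Lemma mderiv_evs0 l s N f : (N <= l)%N -> (evs s N f)^`M(l) = 0.
Proof.
move=> h; rewrite comp_mpoly_deriv; apply: big1 => k _.
by rewrite tnth_mktuple mderivZ mderiv_psx ltnNge h scaler0 mulr0.
Qed.

(** Obtained from the chain rule [mderiv_evs] and x_i x_j (x_i^k - x_j^k) / (x_i - x_j) = sum_(r <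
    k) x_i^(r+1) x_j^(k-r). *)
Definition evs_quot s N f i j : {mpoly R[K]} := \sum_(k < K) (s * (k.+1)%:R) *:
  (evs s N f^`M(k) * \sum_(r < k) 'X_i ^+ r.+1 * 'X_j ^+ (k - r)).

Lemma evs_quot_rel s N f i j : (i < N)%N -> (j < N)%N ->
  ('X_i - 'X_j) * evs_quot s N f i j = 'X_i * 'X_j * ((evs s N f)^`M(i) - (evs s N f)^`M(j)).
Proof.
move=> hi hj; rewrite !mderiv_evs // -sumrB !mulr_sumr; apply: eq_bigr => k _.
rewrite -scalerBr -mulrBr -!scalerAr; congr (_ *: _).
rewrite mulrCA [RHS]mulrCA; congr (_ * _); rewrite subrXX mulrCA; congr (_ * _).
rewrite mulr_sumr (reindex_inj rev_ord_inj) /=; apply: eq_bigr => r _.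
rewrite subKn; last exact: ltn_ord.
by rewrite (_ : k.-1 - r = k - r.+1)%N ?exprS; [ring|lia].
Qed.

(* [G] is the Laplace-Beltrami operator in [N] variables applied to [F]: [Gf i j] stands for
   the quotient of [x_i x_j (d_i F - d_j F)] by [x_i - x_j], which avoids fractions. *)
Definition LBrel b N F G := exists2 Gf : 'I_K -> 'I_K -> {mpoly R[K]},
  forall i j, (i < N)%N -> (j < N)%N -> i != j ->
    ('X_i - 'X_j) * Gf i j = 'X_i * 'X_j * (F^`M(i) - F^`M(j))
  & G = (b / 2) *: (\sum_(l < K | (l < N)%N) 'X_l ^+ 2 * F^`M(l)^`M(l))
      + 2^-1 *: \sum_(i < K | (i < N)%N) \sum_(j < K | (j < N)%N && (j != i)) Gf i j.

Lemma sum_antidiagonal (V : zmodType) (g : nat -> nat -> V) (k : nat) : (k < K)%N ->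
  \sum_(i < K) \sum_(j < K | (i + j).+1 == k) g i j = \sum_(r < k) g r (k - r.+1)%N.
Proof.
move=> hk; rewrite (big_ord_widen _ (fun r => g r (k - r.+1)%N) (ltnW hk)).
rewrite [RHS]big_mkcond; apply: eq_bigr => i _; case: ltnP => h.
  have lt : (k - i.+1 < K)%N by lia.
  rewrite (big_pred1 (Ordinal lt)) // => j; rewrite /= -val_eqE /=; lia.
by apply: big_pred0 => j; lia.
Qed.

(** The three equations match the three kinds of terms of [LB_psum]: products p_i p_j, second
    derivatives, diagonal terms. They are used for (s, t, b) = (1, 1, a) and for (- a, - 1/a,
    1/a). *)
Lemma LBrel_evs a b s t N n f : wt n f -> (n <= K)%N ->
  s * t = 1 -> t * a = b * s -> t * (a - 1) = b - 1 ->
  LBrel b N (evs s N f) (t *: evs s N (LB_psum a f)).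
Proof.
move=> hf hn st ta tb; exists (evs_quot s N f); first by move=> i j hi hj _; apply: evs_quot_rel.
have P1 : \sum_(l < K | (l < N)%N) 'X_l ^+ 2 * (evs s N f)^`M(l)^`M(l)
  = \sum_(i < K) \sum_(k < K) (s ^+ 2 * (i.+1)%:R * (k.+1)%:R) *: (evs s N f^`M(k)^`M(i) * psx N (i + k).+2)
    + \sum_(k < K) (s * (k.+1)%:R * k%:R) *: (evs s N f^`M(k) * psx N k.+1).
  transitivity (\sum_(l < K | (l < N)%N)
    (\sum_(i < K) \sum_(k < K) (s ^+ 2 * (i.+1)%:R * (k.+1)%:R) *: (evs s N f^`M(k)^`M(i) * 'X_l ^+ (i + k).+2)
    + \sum_(k < K) (s * (k.+1)%:R * k%:R) *: (evs s N f^`M(k) * 'X_l ^+ k.+1))).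
    apply: eq_bigr => l hl; rewrite mderiv_evs // exchange_big /= -big_split raddf_sum mulr_sumr.
    apply: eq_bigr => k _ /=; rewrite mderivZ mderivM mderiv_evs // -scalerAr.
    rewrite mulrDr scalerDr; congr (_ + _).
      rewrite mulr_suml mulr_sumr scaler_sumr; apply: eq_bigr => i _.
      rewrite -!scalerAl -!scalerAr scalerA; congr (_ *: _); first by ring.
      by rewrite -[(i + k).+2]addn2 !(exprD _ (i + k)) exprD; ring.
    case: (nat_of_ord k) => [|n'].
      by rewrite expr0 mderivC !mulr0 scaler0 scale0r.
    rewrite mderiv_Xn eqxx scale1r -!scalerAr scalerA; congr (_ *: _).
    by rewrite mulrCA -exprD.
  rewrite big_split /=; congr (_ + _).
    rewrite exchange_big; apply: eq_bigr => i _; rewrite exchange_big; apply: eq_bigr => k _ /=.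
    by rewrite -scaler_sumr -mulr_sumr.
  by rewrite exchange_big; apply: eq_bigr => k _ /=; rewrite -scaler_sumr -mulr_sumr.
(* For fixed i, summing over j different from i gives a full power sum minus the term j = i; for
   each of the k values of r that term is x_i^(k+1). *)
have P2 : \sum_(i < K | (i < N)%N) \sum_(j < K | (j < N)%N && (j != i)) evs_quot s N f i j
  = \sum_(k < K) (s * (k.+1)%:R) *: (evs s N f^`M(k) *
      (\sum_(r < k) psx N r.+1 * psx N (k - r.+1).+1 - k%:R *: psx N k.+1)).
  transitivity (\sum_(i < K | (i < N)%N) \sum_(k < K) (s * (k.+1)%:R) *: (evs s N f^`M(k) *
      (\sum_(r < k) 'X_i ^+ r.+1 * psx N (k - r.+1).+1 - k%:R *: 'X_i ^+ k.+1))).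
    apply: eq_bigr => i hi; rewrite exchange_big; apply: eq_bigr => k _ /=.
    rewrite -scaler_sumr -mulr_sumr; congr (_ *: (_ * _)); rewrite exchange_big /=.
    rewrite scaler_nat -[X in _ *+ X](card_ord k) -sumr_const -sumrB; apply: eq_bigr => r _.
    rewrite -mulr_sumr /psx (bigD1 i hi) /= mulrDr -exprD.
    rewrite (_ : r.+1 + _ = k.+1)%N; last by have := ltn_ord r; lia.
    by rewrite addrAC subrr add0r subnSK.
  rewrite exchange_big; apply: eq_bigr => k _ /=.
  rewrite -scaler_sumr -mulr_sumr; congr (_ *: (_ * _)).
  rewrite sumrB -scaler_sumr exchange_big /=; congr (_ - _).
  by apply: eq_bigr => r _; rewrite -mulr_suml.
have D1 : evs s N (\sum_(i < K) \sum_(j < K) \sum_(k < K | (i + j).+1 == k)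
     ((a / 2 * (i.+1)%:R * (j.+1)%:R) *: ('X_k * f^`M(j)^`M(i))
      + ((k.+1)%:R / 2) *: ('X_i * ('X_j * f^`M(k)))))
  = \sum_(i < K) \sum_(k < K) (a / 2 * s * (i.+1)%:R * (k.+1)%:R) *:
        (evs s N f^`M(k)^`M(i) * psx N (i + k).+2)
    + \sum_(k < K) ((k.+1)%:R / 2 * s ^+ 2) *:
        (evs s N f^`M(k) * (\sum_(r < k) psx N r.+1 * psx N (k - r.+1).+1)).
  transitivity (\sum_(i < K) \sum_(j < K) \sum_(k < K | (i + j).+1 == k)
      (a / 2 * s * (i.+1)%:R * (j.+1)%:R) *: (evs s N f^`M(j)^`M(i) * psx N (i + j).+2)
     + \sum_(i < K) \sum_(j < K) \sum_(k < K | (i + j).+1 == k)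
      ((k.+1)%:R / 2 * s ^+ 2) *: (evs s N f^`M(k) * (psx N i.+1 * psx N j.+1))).
    rewrite raddf_sum -big_split; apply: eq_bigr => i _ /=.
    rewrite raddf_sum -big_split; apply: eq_bigr => j _ /=.
    rewrite raddf_sum -big_split; apply: eq_bigr => k /eqP e /=.
    rewrite comp_mpolyD !comp_mpolyZ !rmorphM /= !evsX -e.
    by rewrite -!mul_mpolyC; congr (_ + _); ring.
  congr (_ + _).
    apply: eq_bigr => i _; apply: eq_bigr => j _.
    case: (ltnP (i + j).+1 K) => h.
      by rewrite (big_pred1 (Ordinal h)) // => k; rewrite /= -val_eqE /= eq_sym.
    (* Here p_(i+j+2) has been truncated away, but the second derivative multiplying it vanishes
       because n <= K. *)
    rewrite big_pred0 => [|k]; last by have := ltn_ord k; lia.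
    rewrite (@wt_deriv0 _ _ (n - j.+1)) ?comp_mpoly0 ?mul0r ?scaler0 //; first by lia.
    exact: wt_deriv'.
  under eq_bigr => i _ do rewrite (exchange_big_dep xpredT) //=.
  rewrite exchange_big /=; apply: eq_bigr => k _.
  rewrite -(sum_antidiagonal (fun r u => psx N r.+1 * psx N u.+1)) //.
  rewrite mulr_sumr scaler_sumr; apply: eq_bigr => i _.
  by rewrite mulr_sumr scaler_sumr.
rewrite P1 P2 {P1 P2} /LB_psum comp_mpolyD D1 {D1} raddf_sum /=.
rewrite !scalerDr -!addrA; congr (_ + _).
  rewrite !scaler_sumr; apply: eq_bigr => i _; rewrite !scaler_sumr; apply: eq_bigr => k _.
  rewrite !scalerA; congr (_ *: _).
  transitivity (t * a * (s / 2 * (i.+1)%:R * (k.+1)%:R)); first by field.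
  by rewrite ta; field.
rewrite !scaler_sumr -!big_split; apply: eq_bigr => k _ /=.
rewrite comp_mpolyZ rmorphM /= evsX mulrBr !scalerBr -!scalerAl -!scalerAr !scalerA.
rewrite (mulrC (psx N k.+1)) [RHS]addrCA; congr (_ + _).
  by congr (_ *: _); transitivity (s * t * (s * (k.+1)%:R / 2)); [field|rewrite st; field].
rewrite -scalerBl; congr (_ *: _).
transitivity (t * (a - 1) * (s * (k.+1)%:R * k%:R / 2)); first by field.
by rewrite tb; field.
Qed.
Lemma evs_sum s N (I : Type) (r : seq I) (P : pred I) (F : I -> {mpoly R[K]}) :
  evs s N (\sum_(x <- r | P x) F x) = \sum_(x <- r | P x) evs s N (F x).
Proof. exact: raddf_sum. Qed.

Lemma mcoeff_sum m (I : Type) (r : seq I) (P : pred I) (F : I -> {mpoly R[K]}) :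
  (\sum_(x <- r | P x) F x)@_m = \sum_(x <- r | P x) (F x)@_m.
Proof. exact: raddf_sum. Qed.
End Evaluation.

(** * Leading exponents of eigenfunctions *)
Section Coefficients.
Variables (R : realFieldType) (K : nat).
Implicit Types (f g h F G H : {mpoly R[K]}) (m e : 'X_{1..K}) (b c : R) (i j k l : 'I_K).

Definition vs e : seq nat := [seq e i | i <- enum 'I_K].

Lemma size_vs e : size (vs e) = K.
Proof. by rewrite size_map size_enum_ord. Qed.

Lemma ts_vs e t : ts (vs e) t = (\sum_(i < K) (e i - t))%N.
Proof. by rewrite /ts big_map big_enum. Qed.

Lemma sumn_vs e : sumn (vs e) = mdeg e.
Proof. by rewrite -ts0 ts_vs mdegE; apply: eq_bigr => i _; rewrite subn0. Qed.

Lemma vs_leq e : all (fun x => x <= mdeg e)%N (vs e).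
Proof. by rewrite -sumn_vs all_leq_sumn. Qed.

Lemma qs_vs e : qs (vs e) = (\sum_(i < K) 'C(e i, 2))%N.
Proof. by rewrite /qs big_map big_enum. Qed.

Lemma mn_map (f : 'I_K -> nat) (r : seq 'I_K) : uniq r ->
  (mn [seq f i | i <- r] * 2 = \sum_(i <- r) \sum_(j <- r | j != i) minn (f i) (f j))%N.
Proof.
elim: r => [|x r IH] /=; first by rewrite big_nil.
case/andP=> xr ur; rewrite big_cons big_cons eqxx /= mulnDl {}IH // big_map.
have -> : (\sum_(j <- r | j != x) minn (f x) (f j) = \sum_(j <- r) minn (f x) (f j))%N.
  rewrite big_seq_cond [RHS]big_seq; apply: eq_bigl => j.
  by case: eqP => [->|_]; rewrite ?andbT // (negbTE xr).
have -> : (\sum_(i <- r) \sum_(j <- x :: r | j != i) minn (f i) (f j)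
   = \sum_(i <- r) minn (f i) (f x) + \sum_(i <- r) \sum_(j <- r | j != i) minn (f i) (f j))%N.
  rewrite -big_split big_seq [RHS]big_seq; apply: eq_bigr => i ir; rewrite big_cons.
  by case: eqP => [e|//]; rewrite e ir in xr.
rewrite muln2 -addnn -addnA; congr (_ + (_ + _))%N.
by apply: eq_bigr => i _; rewrite minnC.
Qed.

Lemma mn_vs e : (mn (vs e) * 2 = \sum_(i < K) \sum_(j < K | j != i) minn (e i) (e j))%N.
Proof.
rewrite mn_map ?enum_uniq // big_enum; apply: eq_bigr => i _.
by rewrite big_enum_cond.
Qed.

(** Moves [r] units of exponent from x_j to x_i; the subtraction is truncated, so this is meaningful
    for [r <= e j]. *)
Definition raise e i j r : 'X_{1..K} := (e + U_(i) *+ r - U_(j) *+ r)%MM.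

Lemma raiseE e i j r l : raise e i j r l = (e l + (i == l) * r - (j == l) * r)%N.
Proof. by rewrite mnmBE mnmDE !mulmnE !mnm1E. Qed.

Lemma raise0 e i j : raise e i j 0 = e.
Proof. by apply/mnmP => l; rewrite raiseE !muln0 subn0 addn0. Qed.

Lemma raise_sum (p : nat -> nat) e i j r : i != j ->
  (\sum_(l < K) p (raise e i j r l) + (p (e i) + p (e j))
   = \sum_(l < K) p (e l) + (p (e i + r) + p (e j - r)))%N.
Proof.
move=> ne; have ne' : j != i by rewrite eq_sym.
rewrite (bigD1 i) //= (bigD1 j) //= [X in _ = (X + _)%N](bigD1 i) //= [X in _ = (_ + X + _)%N](bigD1 j) //=.
rewrite !raiseE !eqxx (negbTE ne) (negbTE ne') !mul1n mul0n subn0 addn0.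
rewrite (eq_bigr (fun l => p (e l))); first by lia.
move=> l /andP [h1 h2]; rewrite raiseE ![_ == l]eq_sym (negbTE h1) (negbTE h2).
by rewrite addn0 subn0.
Qed.

Lemma raise_domle e i j r : i != j -> (e j <= e i)%N -> (r <= e j)%N ->
  domle (vs e) (vs (raise e i j r)).
Proof.
move=> ne le lr; have H t : (ts (vs e) t <= ts (vs (raise e i j r)) t)%N.
  by rewrite !ts_vs; have := raise_sum (fun x => x - t)%N e r ne; lia.
split=> //; have := raise_sum (fun x => x) e r ne; rewrite !sumn_vs !mdegE /=; lia.
Qed.

Lemma bin2D (x r : nat) : ('C(x + r, 2) = 'C(x, 2) + 'C(r, 2) + x * r)%N.
Proof. by have := bin2_sqr (x + r); have := bin2_sqr x; have := bin2_sqr r; nia. Qed.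

Lemma raise_qs e i j r : i != j -> (e j <= e i)%N -> (r <= e j)%N -> (0 < r)%N ->
  (qs (vs e) < qs (vs (raise e i j r)))%N.
Proof.
move=> ne le lr r0; rewrite !qs_vs.
have := raise_sum (fun x => 'C(x, 2)) e r ne.
have := bin2D (e i) r; have := bin2D (e j - r) r; rewrite subnK // => -> ->.
move=> h; rewrite -(ltn_add2r ('C(e i, 2) + ('C(e j - r, 2) + 'C(r, 2) + (e j - r) * r))).
rewrite h; suff : ((e j - r) * r < e i * r)%N by lia.
by rewrite ltn_mul2r r0 /=; lia.
Qed.

Section Relation.
Variables (i j : 'I_K) (F G : {mpoly R[K]}).
Hypotheses (ne : i != j)
  (rel : ('X_i - 'X_j) * G = 'X_i * 'X_j * (F^`M(i) - F^`M(j))).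

(** The coefficient of x^e x_i in the relation: a recursion for [G] along the exponents obtained by
    moving units from x_j to x_i, which stops when x_j is exhausted. *)
Lemma coef_rel e : G@_e - (if (0 < e j)%N then G@_(raise e i j 1) else 0)
  = (if (0 < e j)%N then F@_(raise e i j 1) *+ (e i).+1 else 0) - F@_e *+ e j.
Proof.
have := congr1 (mcoeff (e + U_(i))) rel; rewrite mulrBl mulrBr !mcoeffB.
have r1 : (e + U_(i) - U_(j))%MM = raise e i j 1 by rewrite /raise !mulm1n.
have le_i : (U_(i) <= e + U_(i))%MM by rewrite lep1mP mnmDE mnm1E eqxx addn1.
have le_j : (U_(j) <= e + U_(i))%MM = (0 < e j)%N.
  by rewrite lep1mP mnmDE mnm1E (negbTE ne) addn0 lt0n.
have -> : ('X_i * G)@_(e + U_(i)) = G@_e by rewrite mcoeff_mulXm le_i addmK.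
have -> : ('X_j * G)@_(e + U_(i)) = if (0 < e j)%N then G@_(raise e i j 1) else 0.
  by rewrite mcoeff_mulXm le_j r1.
have -> : ('X_i * 'X_j * F^`M(j))@_(e + U_(i)) = F@_e *+ e j.
  by rewrite -mulrA mcoeff_mulXm le_i addmK mcoeff_mulXd.
have -> : ('X_i * 'X_j * F^`M(i))@_(e + U_(i))
   = if (0 < e j)%N then F@_(raise e i j 1) *+ (e i).+1 else 0.
  rewrite mulrAC mulrC mcoeff_mulXm le_j r1 mcoeff_mulXd raiseE eqxx.
  by rewrite eq_sym (negbTE ne) mul0n subn0 mul1n addn1.
by [].
Qed.

Lemma raise_raise e r : (0 < e j)%N -> raise (raise e i j 1) i j r = raise e i j r.+1.
Proof.
move=> h; apply/mnmP => l; rewrite !raiseE.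
case: (eqVneq j l) => [<-|]; last by rewrite !mul0n; lia.
by rewrite (negbTE ne); lia.
Qed.

Lemma coef_rel0 e : (forall r, (r <= e j)%N -> F@_(raise e i j r) = 0) -> G@_e = 0.
Proof.
have [d] := ubnP (e j); elim: d e => // d IH e ltd h.
move: (coef_rel e); have h0 := h 0%N isT; rewrite raise0 in h0.
rewrite h0 mul0rn subr0; case: (ltnP 0 (e j)) => [pos|_]; last by rewrite subr0.
have ej : raise e i j 1 j = (e j).-1.
  by rewrite raiseE eqxx (negbTE ne); lia.
have -> : G@_(raise e i j 1) = 0.
  by apply: IH => [|r]; rewrite ej => *; rewrite ?raise_raise ?h //; lia.
by rewrite (h 1%N) // mul0rn !subr0.
Qed.

(** The coefficients of [G] further along the string vanish by [coef_rel0], so the recursion leaves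
    only the term of [F] at [e]. *)
Lemma coef_rel1 e : (forall r, (0 < r <= e j)%N -> F@_(raise e i j r) = 0) ->
  G@_e = - (F@_e *+ e j).
Proof.
move=> h; move: (coef_rel e); case: (ltnP 0 (e j)) => [pos|_]; last by rewrite subr0 sub0r.
have ej : raise e i j 1 j = (e j).-1.
  by rewrite raiseE eqxx (negbTE ne); lia.
have -> : G@_(raise e i j 1) = 0.
  by apply: coef_rel0 => r; rewrite ej => *; rewrite ?raise_raise ?h //; lia.
by rewrite (h 1%N) ?pos // mul0rn sub0r subr0.
Qed.
End Relation.

Lemma mcoeff_X2d l F e : ('X_l ^+ 2 * F^`M(l)^`M(l))@_e = ('C(e l, 2) * 2)%:R * F@_e.
Proof.
rewrite expr2 -mulrA mcoeff_mulXm lep1mP; case: eqP => [->|/eqP h]; first by rewrite mul0r.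
have le : (U_(l) <= e)%MM by rewrite lep1mP.
rewrite mcoeff_mulXd mcoeff_mderiv submK // mnmBE mnm1E eqxx subn1 prednK ?lt0n //.
rewrite -mulrnA mulr_natl; congr (_ *+ _); have := bin2_sqr (e l).
by case: (e l) h => // n _; nia.
Qed.

Lemma mcoeff_LBrel_sum b N F e (Gf : 'I_K -> 'I_K -> {mpoly R[K]}) :
  ((b / 2) *: (\sum_(l < K | (l < N)%N) 'X_l ^+ 2 * F^`M(l)^`M(l))
      + 2^-1 *: \sum_(i < K | (i < N)%N) \sum_(j < K | (j < N)%N && (j != i)) Gf i j)@_e
  = b * (\sum_(l < K | (l < N)%N) 'C(e l, 2))%:R * F@_e
    + 2^-1 * \sum_(i < K | (i < N)%N) \sum_(j < K | (j < N)%N && (j != i)) (Gf i j)@_e.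
Proof.
rewrite mcoeffD !mcoeffZ !raddf_sum /=; congr (_ + _ * _); last first.
  by apply: eq_bigr => i _; rewrite raddf_sum.
under eq_bigr => l _ do rewrite mcoeff_X2d natrM -mulrA.
by rewrite -mulr_suml -natr_sum; field.
Qed.

Definition in_vars N e := forall l, (N <= l)%N -> e l = 0%N.

(** The coefficient of a quotient at [e] involves [F] only at exponents where units have moved
    towards the larger of two entries, and these dominate [e]. *)
Lemma LBrel_support b N F G e : LBrel b N F G ->
  (forall e', domle (vs e) (vs e') -> F@_e' = 0) -> G@_e = 0.
Proof.
case=> Gf rel -> h; rewrite mcoeff_LBrel_sum h ?mulr0 ?add0r; last exact: domle_refl.
rewrite big1 ?mulr0 // => i hi; apply: big1 => j /andP [hj ji].
have ij : i != j by rewrite eq_sym.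
have D : 'X_i - 'X_j != 0 :> {mpoly R[K]}.
  apply/eqP => /(congr1 (mcoeff U_(i))); rewrite mcoeffB !mcoeffXU eqxx (negbTE ji).
  by rewrite mcoeff0 subr0 => /eqP; rewrite oner_eq0.
have [le|/ltnW le] := leqP (e j) (e i).
  by apply: (coef_rel0 ij (rel i j hi hj ij)) => r lr; apply/h/raise_domle.
(* The same quotient satisfies the relation with i and j exchanged, so the larger exponent can
   always be the one that is raised. *)
have rel' : ('X_j - 'X_i) * Gf i j = 'X_j * 'X_i * (F^`M(j) - F^`M(i)).
  by rewrite -opprB mulNr (rel i j) // -mulrN opprB (mulrC 'X_i).
by apply: (coef_rel0 ji rel') => r lr; apply/h/raise_domle.
Qed.

(** At a top exponent each quotient contributes minus the smaller of the two exponents, which gives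
    [- mn] once the sum over ordered pairs is halved; the second-order part gives [b * qs]. *)
Lemma LBrel_top b N F G e : LBrel b N F G -> in_vars N e ->
  (forall e', F@_e' != 0 -> (qs (vs e') <= qs (vs e))%N) ->
  G@_e = eps b (vs e) * F@_e.
Proof.
case=> Gf rel -> hN h; rewrite mcoeff_LBrel_sum.
have H i j : (i < N)%N -> (j < N)%N -> j != i -> (Gf i j)@_e = - (F@_e *+ minn (e i) (e j)).
  move=> hi hj ji; have ij : i != j by rewrite eq_sym.
  have Z k l : k != l -> (e l <= e k)%N ->
      forall r, (0 < r <= e l)%N -> F@_(raise e k l r) = 0.
    move=> kl le r /andP [r0 lr]; apply/eqP; apply: contraT => /h.
    by rewrite leqNgt raise_qs.
  have [le|lt] := leqP (e j) (e i).
    rewrite (coef_rel1 ij (rel i j hi hj ij)) //; exact: Z.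
  have rel' : ('X_j - 'X_i) * Gf i j = 'X_j * 'X_i * (F^`M(j) - F^`M(i)).
    by rewrite -opprB mulNr (rel i j) // -mulrN opprB (mulrC 'X_i).
  rewrite (coef_rel1 ji rel') //; apply: Z => //; exact: ltnW.
have out l : ~~ (l < N)%N -> e l = 0%N by rewrite -leqNgt; apply: hN.
have -> : (\sum_(l < K | (l < N)%N) 'C(e l, 2) = qs (vs e))%N.
  rewrite qs_vs [RHS](bigID (fun l : 'I_K => (l < N)%N)) /=.
  by rewrite [X in (_ + X)%N]big1 ?addn0 // => l /out ->.
rewrite /eps mulrBl; congr (_ + _).
transitivity (2^-1 * - ((mn (vs e) * 2)%:R * F@_e)); last by rewrite natrM; field.
congr (_ * _); rewrite mn_vs mulr_natl.
rewrite [in RHS](bigID (fun l : 'I_K => (l < N)%N)) /= [X in (_ + X)%N]big1 ?addn0; last first.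
  by move=> i /out ->; apply: big1 => j _; rewrite min0n.
rewrite -sumrMnr -sumrN; apply: eq_bigr => i hi.
rewrite [in RHS](bigID (fun l : 'I_K => (l < N)%N)) /= [X in (_ + X)%N]big1 ?addn0; last first.
  by move=> j /andP [_ /out ->]; rewrite minn0.
rewrite -sumrMnr -sumrN; apply: eq_big => j; first by rewrite andbC.
by case/andP=> hj ji; rewrite H.
Qed.

(* Eigenfunctions are detected by their top exponent. *)
Lemma LBrel_uniq b N F c : LBrel b N F (c *: F) ->
  (forall e, F@_e != 0 -> in_vars N e /\ eps b (vs e) != c) -> F = 0.
Proof.
move=> rel h; apply/eqP; rewrite -msupp_eq0; apply/eqP.
case E : (msupp F) => [//|e0 r]; exfalso.
have h0 : e0 \in msupp F by rewrite E inE eqxx.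
have [e he max] : exists2 e, e \in msupp F &
    forall e', e' \in msupp F -> (qs (vs e') <= qs (vs e))%N.
  case: (@arg_maxnP (seq_sub (msupp F)) (SeqSub h0) xpredT (fun x => qs (vs (ssval x)))) => //.
  move=> x _ hx; exists (ssval x); first exact: ssvalP.
  by move=> e' he'; apply: (hx (SeqSub he')).
rewrite mcoeff_msupp in he; have [hN /eqP] := h e he; apply.
have := LBrel_top rel hN; rewrite mcoeffZ => /(_ _)/(mulIf he) -> // e'.
by rewrite -mcoeff_msupp; apply: max.
Qed.
End Coefficients.

(** * Restriction to fewer variables, symmetry, and injectivity of evaluation *)

Section Restriction.
Variables (R : realFieldType) (K : nat).
Implicit Types (f g h F G H : {mpoly R[K]}) (m e : 'X_{1..K}) (s b c : R) (i j k l : 'I_K).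
Local Notation evs s N := (comp_mpoly (evt K s N)).

Lemma evs_in_vars s N f e : (evs s N f)@_e != 0 -> in_vars N e.
Proof.
move=> he l hl; have := mcoeff_mulXd l (evs s N f) e.
rewrite mderiv_evs0 // mulr0 mcoeff0 => /esym/eqP.
by rewrite -mulr_natr mulf_eq0 (negbTE he) pnatr_eq0 => /eqP.
Qed.

Definition zero_vars N : K.-tuple {mpoly R[K]} := [tuple if (i < N)%N then 'X_i else 0 | i < K].

Lemma mcoeff_zero_vars N F e : in_vars N e -> (F \mPo zero_vars N)@_e = F@_e.
Proof.
elim/mpoly_indX: F e => [c|F G IHF IHG|i F IH] e he.
- by rewrite comp_mpolyC.
- by rewrite comp_mpolyD !mcoeffD IHF // IHG.
rewrite rmorphM /= comp_mpolyXU (nth_map i) ?size_enum_ord // nth_ord_enum mcoeff_mulXm.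
case: ifPn => hi; last first.
  by rewrite mul0r mcoeff0 lep1mP he //= leqNgt.
rewrite mcoeff_mulXm; case: ifP => // le; rewrite IH // => l hl.
by rewrite mnmBE he.
Qed.

Lemma zero_vars_evs s N f : evs s K f \mPo zero_vars N = evs s N f.
Proof.
elim/mpoly_indX: f => [c|f g IHf IHg|i f IH].
- by rewrite !comp_mpolyC.
- by rewrite !comp_mpolyD IHf IHg.
rewrite !rmorphM /= IH !evsX; congr (_ * _); rewrite comp_mpolyZ; congr (_ *: _).
rewrite /psx raddf_sum /= [RHS]big_mkcond [LHS]big_mkcond; apply: eq_bigr => j _.
rewrite ltn_ord rmorphXn /= comp_mpolyXU (nth_map i) ?size_enum_ord // nth_ord_enum.
by case: ifP => // _; rewrite expr0n.
Qed.

(** Passing from K to N variables sets the others to zero, which preserves the coefficients of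
    monomials in the first N. *)
Lemma mcoeff_evs s N f e : in_vars N e -> (evs s N f)@_e = (evs s K f)@_e.
Proof. by move=> he; rewrite -zero_vars_evs mcoeff_zero_vars. Qed.

Lemma evs_sym s f : evs s K f \is symmetric.
Proof.
apply: mcomp_sym => i; rewrite (nth_map i) ?size_enum_ord // nth_ord_enum.
apply: rpredZ; apply/issymP => p; rewrite /psx raddf_sum /=.
rewrite [RHS](reindex_inj (h := p) perm_inj) /=; apply: eq_big => j; first by rewrite !ltn_ord.
move=> _; rewrite rmorphXn /= msymX; congr (_ ^+ _).
congr mpolyX; apply/mnmP => l; rewrite mnmE !mnm1E.
by rewrite -(inj_eq (@perm_inj _ p)) permKV.
Qed.

Lemma perm_vs e e' : ts (vs e) =1 ts (vs e') -> perm_eq (vs e) (vs e').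
Proof.
move=> h; apply/allP => v _; apply/eqP; case: v => [|v]; last exact: ts_eq_count.
have c (x : 'X_{1..K}) : count_mem 0%N (vs x) = (K - conj_part (vs x) 0)%N.
  have := count_predC (fun y => 0 < y)%N (vs x); rewrite size_vs.
  have -> : count (predC (fun y => 0 < y)%N) (vs x) = count_mem 0%N (vs x).
    by apply: eq_count => y /=; rewrite lt0n negbK.
  by rewrite /conj_part; lia.
by rewrite !c (conj_part_ts h).
Qed.

(** Exponent vectors of length K with equal tails are permutations of each other, and evaluation in
    all K variables is symmetric; both coefficients can be read there. *)
Lemma evs_perm s N f e e' : in_vars N e -> in_vars N e' -> ts (vs e) =1 ts (vs e') ->
  (evs s N f)@_e = (evs s N f)@_e'.
Proof.
move=> he he' /perm_vs h; rewrite (mcoeff_evs s f he) (mcoeff_evs s f he').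
have sz (x : 'X_{1..K}) : size (vs x) == K by rewrite size_vs.
have /tuple_permP [p hp] : perm_eq (Tuple (sz e)) (Tuple (sz e')) by [].
rewrite -(msym_coeff e' p (evs_sym s f)); congr mcoeff; apply/mnmP => i; rewrite mnmE.
have := congr1 (fun r => nth 0%N r i) hp; rewrite /= (nth_map i) ?size_enum_ord //.
rewrite (nth_map i) ?size_enum_ord // !nth_ord_enum => ->.
by rewrite (tnth_nth 0%N) /= (nth_map i) ?size_enum_ord // nth_ord_enum.
Qed.

Lemma euler_evs s N f :
  \sum_(l < K) 'X_l * (evs s N f)^`M(l) = evs s N (weight_op f).
Proof.
rewrite /weight_op raddf_sum /=.
rewrite (bigID (fun l : 'I_K => (l < N)%N)) /= [X in _ + X]big1 ?addr0; last first.
  by move=> l; rewrite -leqNgt => h; rewrite mderiv_evs0 // mulr0.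
transitivity (\sum_(l < K | (l < N)%N) \sum_(k < K)
   (s * (k.+1)%:R) *: (evs s N f^`M(k) * 'X_l ^+ k.+1)).
  apply: eq_bigr => l h; rewrite mderiv_evs // mulr_sumr; apply: eq_bigr => k _.
  by rewrite -scalerAr exprS; congr (_ *: _); ring.
rewrite exchange_big /=; apply: eq_bigr => k _.
rewrite -scaler_sumr -mulr_sumr -/(psx R K N k.+1) comp_mpolyZ rmorphM /= evsX.
by rewrite -scalerAl scalerA mulrC [_%:R * s]mulrC [psx _ _ _ _ * _]mulrC.
Qed.

Lemma mdeg_evs s N n f e : wt n f -> (evs s N f)@_e != 0 -> mdeg e = n.
Proof.
move=> /wtP hf he; have := congr1 (mcoeff e) (euler_evs s N f).
rewrite hf comp_mpolyZ mcoeffZ raddf_sum /=.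
under eq_bigr => l _ do rewrite mcoeff_mulXd.
rewrite sumrMnr -mdegE -[LHS]mulr_natl => /(mulIf he)/eqP.
by rewrite eqr_nat => /eqP.
Qed.

(** Algebraic independence of the power sums, by induction on the degree. Differentiating in x_l
    shows that x_1, ..., x_K are roots of the polynomial of degree below K with coefficients (k+1)
    ev(df/dp_(k+1)). It is therefore zero, all the partial derivatives of [f] vanish by induction,
    and [f] is constant. *)
Lemma ev_inj f : evs 1 K f = 0 -> f = 0.
Proof.
suff H d g : (forall m, g@_m != 0 -> (mdeg m < d)%N) -> evs 1 K g = 0 -> g = 0.
  by apply: (H (msize f)) => m; rewrite -mcoeff_msupp; apply: msize_mdeg_lt.
elim: d g => [|d IH] {}f ltd h.
  by apply/mpolyP => m; rewrite mcoeff0; apply/eqP; apply: contraT => /ltd.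
have D k : f^`M(k) = 0.
  have rt l : \sum_(k < K) (k.+1)%:R *: (evs 1 K f^`M(k) * 'X_l ^+ k) = 0.
    have := @mderiv_evs _ _ l 1 K f (ltn_ord l); rewrite h mderiv0 => /esym.
    by under eq_bigr do rewrite mul1r.
  pose P : {poly {mpoly R[K]}} := \poly_(k < K) (if insub k is Some i then
     ((k.+1)%:R : R) *: evs 1 K f^`M(i) else 0).
  have P0 : P = 0.
    apply: (@roots_geq_poly_eq0 _ P [seq 'X_l | l <- enum 'I_K]).
    - apply/allP => _ /mapP [l _ ->]; rewrite /root horner_poly; apply/eqP.
      apply: etrans (rt l); apply: eq_bigr => i _; rewrite (valK (i : 'I_K)).
      by rewrite -scalerAl.
    - rewrite map_inj_uniq ?enum_uniq // => i j /(congr1 (mcoeff U_(i))).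
      rewrite !mcoeffXU eqxx; case: eqP => // _ /eqP.
      by rewrite oner_eq0.
    - by rewrite size_map size_enum_ord size_poly.
  apply: IH => [m|].
    rewrite mcoeff_mderiv -mulr_natr mulf_eq0 negb_or => /andP [/ltd + _].
    by rewrite mdegD mdeg1 addn1.
  have := congr1 (fun p : {poly _} => p`_k) P0.
  rewrite coef_poly ltn_ord (valK k) coef0.
  by move/eqP; rewrite scaler_eq0 pnatr_eq0 => /eqP.
have fC : f = (f@_0%MM)%:MP.
  apply/mpolyP => m; rewrite mcoeffC; case: eqVneq => [->|]; first by rewrite mulr1.
  rewrite -mdeg_eq0 mdegE sum_nat_eq0 => /forallPn [k]; rewrite implyTb => mk.
  have := mcoeff_mulXd k f m; rewrite D mulr0 mcoeff0 mulr0 => /esym/eqP.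
  by rewrite -mulr_natr mulf_eq0 pnatr_eq0 (negbTE mk) orbF => /eqP.
by rewrite fC; rewrite fC comp_mpolyC in h.
Qed.

Lemma wt_ev n f : (forall e, (evs 1 K f)@_e != 0 -> mdeg e = n) -> wt n f.
Proof.
move=> h; apply/wtP/eqP; rewrite -subr_eq0; apply/eqP/ev_inj.
rewrite comp_mpolyB comp_mpolyZ -euler_evs; apply/mpolyP => e.
rewrite mcoeffB mcoeffZ raddf_sum mcoeff0 /=.
under eq_bigr => l _ do rewrite mcoeff_mulXd.
rewrite sumrMnr -mdegE -[X in X - _]mulr_natl.
by have [->|/h ->] := eqVneq (evs 1 K f)@_e 0; rewrite ?mulr0 subrr.
Qed.

End Restriction.

(** * Power-sum monomials and the enumeration of partitions *)

Section PartitionMonomials.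
Variable K : nat.
Implicit Types (m e : 'X_{1..K}) (s u : seq nat).

Lemma count_le0 (v : nat) (s : seq nat) : (sumn s < v)%N -> count_mem v s = 0%N.
Proof.
move=> h; apply/count_memPn; apply/negP => /(allP (all_leq_sumn s)); lia.
Qed.

Lemma pmon_inj n n' s u : (n <= K)%N -> (n' <= K)%N ->
  is_partition n s -> is_partition n' u -> pmon K s = pmon K u -> s = u.
Proof.
move=> hs hu ps pu h; apply: (partition_count_inj ps pu) => v v0.
have [lt|ge] := ltnP K v.
  by rewrite !count_le0 // ?(partition_sumn ps) ?(partition_sumn pu); lia.
have lt : (v.-1 < K)%N by lia.
have := congr1 (fun m : 'X_{1..K} => m (Ordinal lt)) h.
by rewrite /pmon !mnmE /= prednK.
Qed.

Lemma wt_pmon s : all (fun x => 0 < x <= K)%N s -> mnmwgt (pmon K s) = sumn s.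
Proof.
rewrite /mnmwgt; elim: s => [|x s IH] /=; first by rewrite big1 // => i _; rewrite mnmE.
case/andP=> /andP [x0 xK] hs; rewrite -IH // addnC.
have lt : (x.-1 < K)%N by lia.
rewrite [LHS](bigD1 (Ordinal lt)) //= [in RHS](bigD1 (Ordinal lt)) //= !mnmE /= prednK // eqxx.
rewrite (eq_bigr (fun i => pmon K s i * i.+1)%N); first by lia.
move=> i ne; rewrite !mnmE /=; case: eqP => // e; case/eqP: ne.
by apply: val_inj; rewrite /= e.
Qed.

Lemma pmon_surj m : exists2 s, is_partition (mnmwgt m) s & pmon K s = m.
Proof.
pose s := sort geq (flatten [seq nseq (m i) (i : 'I_K).+1 | i <- enum 'I_K]).
have cnt v : count_mem v s = (\sum_(i < K) m i * (i.+1 == v))%N.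
  rewrite /s (seq.permP (permEl (perm_sort _ _))) count_flatten sumnE 2!big_map big_enum.
  by apply: eq_bigr => i _; rewrite count_nseq /= mulnC.
have pm : pmon K s = m.
  apply/mnmP => i; rewrite mnmE cnt (bigD1 i) //= eqxx muln1 big1 ?addn0 // => j ne.
  by rewrite eqSS (inj_eq val_inj) (negbTE ne) muln0.
have pos : all (fun x => 0 < x <= K)%N s.
  by rewrite all_sort; apply/allP => x /flattenP [_ /mapP [i _ ->]] /nseqP [-> _] /=.
exists s => //; apply/and3P; split.
- by apply: sort_sorted => x y; apply: leq_total.
- by apply: sub_all pos => x /andP [].
- by rewrite -(wt_pmon pos) pm.
Qed.

Lemma mem_partitions n s : (s \in partitions n) = is_partition n s.
Proof.
rewrite mem_filter; case: (boolP (is_partition n s)) => //= ps.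
have [/and3P [_ pos _] e] := (ps, partition_sumn ps).
have le : all (fun x => x <= n)%N s by rewrite -e all_leq_sumn.
apply/flattenP; exists [seq [seq nat_of_ord x | x <- tval t] | t <- enum {: (size s).-tuple 'I_n.+1}].
  apply/mapP; exists (size s) => //; rewrite mem_iota add0n ltnS /= -e.
  by rewrite (size_ts ps) ts0 leq_subr.
apply/mapP; exists (map_tuple inord (in_tuple s)); first by rewrite mem_enum.
rewrite /= -map_comp -[LHS]map_id; apply/eq_in_map => x /(allP le) hx /=.
by rewrite inordK.
Qed.

Lemma uniq_partitions n : uniq (partitions n).
Proof.
apply: filter_uniq; rewrite /seqs_upto.
elim: (iota 0 n.+1) (iota_uniq 0 n.+1) => //= k r IH /andP [kr ur].
rewrite cat_uniq IH // andbT map_inj_uniq ?enum_uniq /=; last first.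
  by move=> t t' /(inj_map val_inj)/val_inj.
apply/hasPn => x /flattenP [_ /mapP [k' hk' ->]] /mapP [t _ ->].
apply: contra kr => /mapP [t' _ /(congr1 size)].
by rewrite !size_map !size_tuple => <-.
Qed.
End PartitionMonomials.

(** * Exponent vectors attached to partitions *)

Section Exponents.
Variable K : nat.
Implicit Types (e : 'X_{1..K}) (s l : seq nat).

Lemma partition_size_le n l : is_partition n l -> (size l <= n)%N.
Proof. by move=> pl; rewrite (size_ts pl) ts0 (partition_sumn pl) leq_subr. Qed.

Lemma ts_xmon l t : (size l <= K)%N -> ts (vs (xmon K l)) t = ts l t.
Proof.
move=> h; rewrite ts_vs /ts (big_nth 0%N) big_mkord.
rewrite (big_ord_widen _ (fun i => (nth 0 l i - t)%N) h) [RHS]big_mkcond.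
by apply: eq_bigr => i _; rewrite mnmE; case: ltnP => // ge; rewrite nth_default.
Qed.

Lemma xmon_in_vars l N : (size l <= N)%N -> in_vars N (xmon K l).
Proof. by move=> h i hi; rewrite mnmE nth_default // (leq_trans h). Qed.

Lemma ts_xshape e t : ts (xshape e) t = ts (vs e) t.
Proof.
rewrite /xshape (ts_perm _ (permEl (perm_sort _ _))) -[RHS]ts_pos /vs filter_map.
by rewrite /enum_mem -filter_predI.
Qed.

Lemma xshape_sorted e : sorted geq (xshape e).
Proof. by apply: sort_sorted => x y; apply: leq_total. Qed.

Lemma domle_ts s u s' u' : ts s =1 ts s' -> ts u =1 ts u' -> domle s u -> domle s' u'.
Proof.
by move=> h1 h2 [e h]; split=> [|t]; rewrite -?h1 -?h2 // -!ts0 -h1 -h2 !ts0.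
Qed.

Lemma in_vars_conj_part N e : in_vars N e -> (conj_part (vs e) 0 <= N)%N.
Proof.
move=> h; have [le|/ltnW le] := leqP K N.
  by apply: leq_trans (count_size _ _) _; rewrite size_vs.
rewrite -(sum_lt le) /conj_part -sum1_count big_map big_enum_cond big_mkcond /=.
apply: leq_sum => i _; case: ifP => // hi; case: (ltnP i N) => // /h e0.
by rewrite e0 in hi.
Qed.
End Exponents.

(** * Elementary symmetric functions and the dual kernel *)
Section Elementary.
Variables (R : realFieldType) (K : nat).
Implicit Types (f g h F G H : {mpoly R[K]}) (m e : 'X_{1..K}) (a s b c : R) (i j k l : 'I_K).
Local Notation evs s N := (comp_mpoly (evt K s N)).

(** The list stores all earlier values, as the recursion needs them. It sums over p_1, ..., p_K
    only, so it is Newton's recursion up to index K; the duality [mcoeff_evs_dual] relies on the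
    truncated recursion itself, valid for all indices. *)
Fixpoint eh_seq (n : nat) : seq {mpoly R[K]} :=
  if n is n'.+1 then
    rcons (eh_seq n') (- (n%:R^-1 : R) *: \sum_(i < K | (i < n)%N) 'X_i * nth 0 (eh_seq n') (n' - i))
  else [:: 1].

(* Up to sign, the elementary symmetric functions in power sums (Newton recursion). *)
Definition eh n := nth 0 (eh_seq n) n.

Lemma size_eh_seq n : size (eh_seq n) = n.+1.
Proof. by elim: n => //= n IH; rewrite size_rcons IH. Qed.

Lemma nth_eh_seq n (k : nat) : (k <= n)%N -> nth 0 (eh_seq n) k = eh k.
Proof.
elim: n => [|n IH]; first by rewrite leqn0 => /eqP ->.
rewrite leq_eqVlt => /orP [/eqP -> //|lt]; rewrite /= nth_rcons size_eh_seq lt.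
exact: IH.
Qed.

Lemma eh0 : eh 0 = 1. Proof. by []. Qed.

Lemma ehS n : (n.+1)%:R *: eh n.+1 = - \sum_(i < K | (i < n.+1)%N) 'X_i * eh (n - i).
Proof.
rewrite {1}/eh /= nth_rcons size_eh_seq ltnn eqxx scalerA mulrN mulfV ?pnatr_eq0 //.
rewrite scaleN1r; congr (- _); apply: eq_bigr => i _.
by rewrite nth_eh_seq ?leq_subr.
Qed.

Lemma wtM n n' f g : wt n f -> wt n' g -> wt (n + n') (f * g).
Proof.
move=> hf hg m; rewrite -mcoeff_msupp => /msuppM_le /allpairsP [[m1 m2] /= [h1 h2 ->]].
by rewrite mnmwgtD (hf m1) -?mcoeff_msupp // (hg m2) -?mcoeff_msupp.
Qed.

Lemma wt1 : wt 0 (1 : {mpoly R[K]}).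
Proof. by move=> m; rewrite mcoeff1; case: (eqVneq m 0%MM) => [->|_]; rewrite ?mnmwgt0 ?eqxx. Qed.

Lemma wt_eh n : wt n (eh n).
Proof.
have [d] := ubnP n; elim: d n => // d IH [_|n ltd]; first by rewrite eh0; apply: wt1.
have n0 : (n.+1)%:R != 0 :> R by rewrite pnatr_eq0.
rewrite -[eh _]scale1r -(mulVf n0) -scalerA ehS; apply: wtZ.
rewrite -scaleN1r; apply: wtZ; apply: wt_sum => i hi.
have -> : n.+1 = (n - i + i.+1)%N by lia.
by apply/wt_mulX/IH; lia.
Qed.

Lemma wt_prod_eh (s : seq nat) : wt (sumn s) (\prod_(r <- s) eh r).
Proof.
elim: s => [|r s IH]; first by rewrite big_nil; apply: wt1.
by rewrite big_cons /=; apply: wtM => //; apply: wt_eh.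
Qed.

Lemma mcoeff0_evs s N f : (evs s N f)@_0%MM = f@_0%MM.
Proof.
elim/mpoly_indX: f => [c|f g IHf IHg|i f IH].
- by rewrite comp_mpolyC.
- by rewrite comp_mpolyD !mcoeffD IHf IHg.
have z j : (U_(j) <= (0%MM : 'X_{1..K}))%MM = false by rewrite lep1mP mnm0E.
rewrite mcoeff_mulXm z rmorphM /= evsX -scalerAl mcoeffZ /psx mulr_suml mcoeff_sum.
by rewrite big1 ?mulr0 // => j _; rewrite exprS -mulrA mcoeff_mulXm z.
Qed.

Lemma mcoeff_mulXn j (k : nat) f e : ('X_j ^+ k * f)@_e
  = if (k <= e j)%N then f@_(e - U_(j) *+ k) else 0.
Proof.
rewrite mpolyXn mcoeff_mulXm; congr (if _ then _ else _).
apply/mnm_lepP/idP => [/(_ j)|h i]; rewrite mulmnE mnm1E ?eqxx ?mul1n //.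
by case: eqVneq => [<-|_]; rewrite ?mul1n ?mul0n.
Qed.

(* The reproducing property of the kernel [prod (1 - x_i y_j)]. *)
Lemma mcoeff_evs_dual a f e : a != 0 ->
  (evs (- a) K f)@_e = pinner a f (\prod_(i < K) eh (e i)).
Proof.
move=> a0; have [d] := ubnP (mdeg e); elim: d e f => // d IH e f ltd.
have [->|] := eqVneq e 0%MM.
  rewrite mcoeff0_evs big1 => [|i _]; last by rewrite mnm0E eh0.
  rewrite pinnerC -mpolyX0 pinnerXl mdeg0 expr0 mulr1 /zee big1 ?mulr1 // => i _.
  by rewrite mnm0E.
rewrite -mdeg_eq0 mdegE sum_nat_eq0 => /forallPn [j]; rewrite implyTb -lt0n => ej.
have le : (U_(j) <= e)%MM by rewrite lep1mP -lt0n.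
have ej0 : (e j)%:R != 0 :> R by rewrite pnatr_eq0 -lt0n.
(* The exponent of x_j is lowered: on the left by d/dx_j and the chain rule, on the right by the
   recursion for [eh (e j)]. Multiplication by p_k being adjoint to a k d/dp_k, the two agree
   exactly for the scaling - a. *)
apply: (mulfI ej0); rewrite -pinnerZr (bigD1 j) //= scalerAl.
have := mcoeff_mderiv j (evs (- a) K f) (e - U_(j)).
rewrite submK // mnmBE mnm1E eqxx subn1 prednK // -[RHS]mulr_natl => <-.
have ehE : (e j)%:R *: eh (e j) = - \sum_(i < K | (i < e j)%N) 'X_i * eh ((e j).-1 - i).
  by case: (e j) ej => // n _; rewrite ehS.
rewrite mderiv_evs // mcoeff_sum ehE mulNr -scaleN1r pinnerZr mulN1r.
rewrite mulr_suml pinner_sumr -sumrN [RHS]big_mkcond; apply: eq_bigr => k _.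
rewrite mcoeffZ [_ * 'X_j ^+ k]mulrC mcoeff_mulXn mnmBE mnm1E eqxx subn1.
have -> : (k <= (e j).-1)%N = (k < e j)%N by lia.
case: ifP => kj; last by rewrite mulr0.
have kj' : (k <= e j - 1)%N by lia.
have ltd' : (mdeg (e - U_(j) - U_(j) *+ k) < d)%N.
  apply: leq_ltn_trans (mdegB _ _) _; rewrite -ltnS (leq_trans _ ltd) // ltnS.
  by rewrite -[X in (_ < mdeg X)%N](submK le) mdegD mdeg1 addn1.
rewrite (IH _ _ ltd') pinner_deriv //; set c := pinner _ _ _.
have -> : c = pinner a f ('X_k * eh ((e j).-1 - k) * \prod_(i < K | i != j) eh (e i)).
  rewrite /c -mulrA (bigD1 j) //= !mnmBE mulmnE mnm1E eqxx mul1n subn1.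
  congr (pinner _ _ (_ * (_ * _))); apply: eq_bigr => i ij.
  by rewrite !mnmBE mulmnE mnm1E eq_sym (negbTE ij) mul0n !subn0.
have k0 : (k.+1)%:R != 0 :> R by rewrite pnatr_eq0.
by field; rewrite nat1r k0.
Qed.

(** * Multiplication by x_1 ... x_N *)

Definition ones N : 'X_{1..K} := [multinom ((i < N)%N : nat) | i < K].

Lemma ones_le N e : (ones N <= e)%MM = [forall i : 'I_K, (i < N)%N ==> (0 < e i)%N].
Proof.
apply/mnm_lepP/forallP => h i; have := h i; rewrite mnmE; by case: (i < N)%N.
Qed.

Lemma vs_subm N e t : (N <= K)%N -> in_vars N e -> (ones N <= e)%MM ->
  ts (vs (e - ones N)) t = ts (vs e) t.+1.
Proof.
move=> hN he /mnm_lepP le; rewrite !ts_vs; apply: eq_bigr => i _; rewrite mnmBE mnmE.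
by case: ltnP => [_|/he ->]; lia.
Qed.

Lemma sumn_subm N e : (N <= K)%N -> (ones N <= e)%MM ->
  sumn (vs e) = (sumn (vs (e - ones N)) + N)%N.
Proof.
move=> hN le; rewrite !sumn_vs -{1}(submK le) mdegD; congr (_ + _)%N.
by rewrite mdegE -[RHS](sum_lt hN); apply: eq_bigr => i _; rewrite mnmE.
Qed.

Lemma LBrel_lin b N F F' G G' c c' : LBrel b N F G -> LBrel b N F' G' ->
  LBrel b N (c *: F + c' *: F') (c *: G + c' *: G').
Proof.
case=> Gf rel -> [Gf' rel' ->]; exists (fun i j => c *: Gf i j + c' *: Gf' i j) => [i j hi hj ij|].
  by rewrite mulrDr -!scalerAr rel // rel' // !mderivD !mderivZ -!mul_mpolyC; ring.
have -> : \sum_(l < K | (l < N)%N) 'X_l ^+ 2 * (c *: F + c' *: F')^`M(l)^`M(l)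
    = c *: \sum_(l < K | (l < N)%N) 'X_l ^+ 2 * F^`M(l)^`M(l)
    + c' *: \sum_(l < K | (l < N)%N) 'X_l ^+ 2 * F'^`M(l)^`M(l).
  rewrite !scaler_sumr -big_split; apply: eq_bigr => l _ /=.
  by rewrite !(mderivD, mderivZ) mulrDr -!scalerAr.
have -> : \sum_(i < K | (i < N)%N) \sum_(j < K | (j < N)%N && (j != i)) (c *: Gf i j + c' *: Gf' i j)
    = c *: (\sum_(i < K | (i < N)%N) \sum_(j < K | (j < N)%N && (j != i)) Gf i j)
    + c' *: (\sum_(i < K | (i < N)%N) \sum_(j < K | (j < N)%N && (j != i)) Gf' i j).
  rewrite !scaler_sumr -big_split; apply: eq_bigr => i _ /=.
  by rewrite !scaler_sumr -big_split.
by rewrite -!mul_mpolyC; ring.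
Qed.

Lemma mderiv_ones N (i : 'I_K) : (i < N)%N -> 'X_i * 'X_[R, ones N]^`M(i) = 'X_[ones N].
Proof.
move=> hi; rewrite mderivX mnmE hi scale1r -mpolyXD addmC submK //.
by rewrite lep1mP mnmE hi.
Qed.

Lemma mderiv2_ones N (i : 'I_K) : (i < N)%N -> 'X_[R, ones N]^`M(i)^`M(i) = 0.
Proof.
by move=> hi; rewrite !mderivX mderivZ mderivX mnmBE mnmE hi mnm1E eqxx scale0r scaler0.
Qed.

(** The cross terms of the second derivatives give b times the Euler operator, hence [b * d]. Each
    quotient becomes x_1 ... x_N times ([Gf i j] - F); half of the N (N - 1) ordered pairs accounts
    for ['C(N, 2)]. *)
Lemma LBrel_mul_ones b N d F G : (N <= K)%N -> LBrel b N F G ->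
  \sum_(l < K) 'X_l * F^`M(l) = d%:R *: F -> (forall l : 'I_K, (N <= l)%N -> F^`M(l) = 0) ->
  LBrel b N ('X_[ones N] * F) ('X_[ones N] * (G + (b * d%:R - 'C(N, 2)%:R) *: F)).
Proof.
move=> hN [Gf rel ->] eul out; exists (fun i j => 'X_[ones N] * (Gf i j - F)) => [i j hi hj ij|].
  have /(congr1 (fun x => 'X_[ones N] * x)) := rel i j hi hj ij.
  have Ei := mderiv_ones hi; have Ej := mderiv_ones hj.
  rewrite !mderivM => h; set m1 := 'X_[ones N] in Ei Ej h *.
  transitivity (m1 * (('X_i - 'X_j) * Gf i j) + ('X_j * ('X_i * m1^`M(i)) - 'X_i * ('X_j * m1^`M(j))) * F).
    by rewrite Ei Ej; ring.
  by rewrite h; ring.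
have -> : \sum_(l < K | (l < N)%N) 'X_l ^+ 2 * ('X_[ones N] * F)^`M(l)^`M(l)
    = 'X_[ones N] * (\sum_(l < K | (l < N)%N) 'X_l ^+ 2 * F^`M(l)^`M(l) + (2 * d%:R) *: F).
  rewrite -[(2 * _) *: F]scalerA -eul.
  rewrite [X in 2 *: X](bigID (fun l : 'I_K => (l < N)%N)) /= [X in 2 *: (_ + X)]big1 ?addr0; last first.
    by move=> l; rewrite -leqNgt => /out ->; rewrite mulr0.
  rewrite scaler_sumr -big_split mulr_sumr; apply: eq_bigr => l hl /=.
  have El := mderiv_ones hl; have El2 := mderiv2_ones hl.
  rewrite !(mderivM, mderivD) El2 mul0r add0r scaler_nat.
  set m1 := 'X_[ones N] in El El2 *.
  transitivity ('X_l * ('X_l * m1^`M(l)) * F^`M(l) *+ 2 + 'X_l ^+ 2 * m1 * F^`M(l)^`M(l)); first by ring.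
  by rewrite El; ring.
have -> : \sum_(i < K | (i < N)%N) \sum_(j < K | (j < N)%N && (j != i)) 'X_[ones N] * (Gf i j - F)
   = 'X_[ones N] * ((\sum_(i < K | (i < N)%N) \sum_(j < K | (j < N)%N && (j != i)) Gf i j) - ('C(N, 2) * 2)%:R *: F).
  have cnt : ('C(N, 2) * 2 = \sum_(i < K | (i < N)%N) \sum_(j < K | (j < N)%N && (j != i)) 1)%N.
    have sN : (\sum_(i < K | (i < N)%N) 1 = N)%N.
      by rewrite big_mkcond -[RHS](sum_lt hN) /=; apply: eq_bigr => i _; case: (i < N)%N.
    rewrite (eq_bigr (fun=> N.-1)) => [|i hi].
      rewrite -[N.-1]muln1 -big_distrr /= sN; have := bin2_sqr N.
      by case: {+}N => [|N'] /=; nia.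
    by have h := sN; rewrite (bigD1 i) //= in h; rewrite -[in RHS]h add1n.
  rewrite cnt natr_sum scaler_suml -sumrB mulr_sumr; apply: eq_bigr => i hi.
  rewrite natr_sum scaler_suml -sumrB mulr_sumr; apply: eq_bigr => j hj.
  by rewrite scale1r.
rewrite -!mul_mpolyC natrM mulrC.
have -> : (b * d%:R - 'C(N, 2)%:R)%:MP = (b / 2)%:MP * (2 * d%:R)%:MP - 2^-1%:MP * ('C(N, 2)%:R * 2)%:MP :> {mpoly R[K]}.
  by rewrite -!mpolyCM -mpolyCB; congr (_%:MP); field.
by ring.
Qed.

(** Exactly N entries are positive and all of them are among the first N. *)
Lemma in_vars_pos N e : (N <= K)%N -> in_vars N e -> conj_part (vs e) 0 = N ->
  (ones N <= e)%MM.
Proof.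
move=> hN he hc; have le i : ((0 < e i) <= (i < N))%N.
  by case: (ltnP i N) => [_|/he -> //]; apply: leq_b1.
have /leqifP := leqif_sum (fun (i : 'I_K) (_ : true) => leqif_eq (le i)).
rewrite (sum_lt hN); have -> : (\sum_(i < K) (0 < e i) = N)%N.
  rewrite -hc /conj_part -sum1_count big_map big_enum_cond [RHS]big_mkcond /=.
  by apply: eq_bigr => i _; case: (0 < e i)%N.
rewrite ltnn; case: forallP => // h _; rewrite ones_le; apply/forallP => i; apply/implyP => hi.
by have := h i; rewrite hi; case: (0 < e i)%N.
Qed.

(** * Newton's identities and the monomials of products of elementary functions *)

Lemma deriv_prod_seq (A : comNzRingType) (I : eqType) (r : seq I) (F : I -> {poly A}) : uniq r ->
  (\prod_(i <- r) F i)^`() = \sum_(i <- r) (F i)^`() * \prod_(j <- r | j != i) F j.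
Proof.
elim: r => [|x r IH] /=; first by rewrite !big_nil derivC.
case/andP=> xr ur; rewrite !big_cons derivM IH // eqxx /=; congr (_ * _ + _).
  rewrite big_seq_cond [RHS]big_seq_cond; apply: eq_bigl => j; rewrite andbT.
  by case: (eqVneq j x) => [->|_]; rewrite ?andbT // (negbTE xr).
rewrite mulr_sumr [LHS]big_seq [RHS]big_seq; apply: eq_bigr => i ir; rewrite big_cons.
by case: (eqVneq x i) => [e|_]; [rewrite e ir in xr|rewrite mulrCA].
Qed.

Definition el (n : nat) : {mpoly R[K]} := (-1) ^+ n *: mesym K R n.

Lemma coef_prod_el n :
  (\prod_(i < K) (1 - ('X_i : {mpoly R[K]})%:P * 'X))`_n = el n.
Proof.
under eq_bigr do rewrite addrC.
rewrite bigA_distr /= coef_sum /el /mesym scaler_sumr [RHS]big_mkcond /=.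
apply: eq_bigr => A _; rewrite -big_mkcond /= prodrN big_split /= prodr_const.
have -> : (-1) ^+ #|A| = ((-1) ^+ #|A|)%:P :> {poly {mpoly R[K]}} by rewrite rmorphXn rmorphN1.
rewrite -rmorph_prod /= mulrA -rmorphM /= coefCM coefXn eq_sym.
case: eqP => [->|_]; last by rewrite mulr0.
by rewrite mulr1 -mul_mpolyC rmorphXn rmorphN1.
Qed.

(** The coefficient of T^n in the derivative of the product of the 1 - x_i T. The product with one
    factor removed is expanded as a geometric series through the recursion [S]. *)
Lemma newton n :
  (n.+1)%:R *: el n.+1 = - \sum_(i < n.+1) psx R K K i.+1 * el (n - i).
Proof.
pose q i : {poly {mpoly R[K]}} := 1 - ('X_i)%:P * 'X.
pose P i := \prod_(j < K | j != i) q j.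
have elE (k : nat) : (\prod_(i < K) q i)`_k = el k by apply: coef_prod_el.
have PE i (k : nat) : (P i)`_k = \sum_(j < k.+1) 'X_i ^+ j * el (k - j).
  have S (r : nat) : (P i)`_r = el r + (if r is r'.+1 then 'X_i * (P i)`_r' else 0).
    rewrite -elE (bigD1 i) //= -/(P i) /q mulrBl mul1r coefB -mulrA coefCM coefXM.
    by case: r => [|r] /=; rewrite ?mulr0 ?subr0 ?addr0 ?subrK.
  elim: k => [|k IH]; first by rewrite S big_ord1 expr0 mul1r addr0.
  rewrite S IH [RHS]big_ord_recl expr0 mul1r subn0 mulr_sumr; congr (_ + _).
  by apply: eq_bigr => j _; rewrite mulrA -exprS.
have := congr1 (fun p : {poly _} => p`_n) (deriv_prod_seq q (index_enum_uniq _)).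
rewrite /= coef_deriv elE coef_sum -scaler_nat => ->.
rewrite -sumrN.
transitivity (\sum_(i < K) - \sum_(j < n.+1) 'X_i ^+ j.+1 * el (n - j)).
  apply: eq_bigr => i _; rewrite -/(P i) /q derivB derivC sub0r derivM derivC mul0r add0r.
  rewrite derivX mulr1 mulNr coefN coefCM PE mulr_sumr; congr (- _).
  by apply: eq_bigr => j _; rewrite mulrA -exprS.
rewrite [LHS]sumrN [RHS]sumrN; congr (- _); rewrite exchange_big /=; apply: eq_bigr => j _.
rewrite /psx mulr_suml; apply: eq_big => // i; by rewrite ltn_ord.
Qed.

Lemma el0 : el 0 = 1.
Proof. by rewrite /el expr0 scale1r mesym0E. Qed.

Lemma evs_eh n : (n <= K)%N -> evs 1 K (eh n) = el n.
Proof.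
have [d] := ubnP n; elim: d n => // d IH [_ _|n ltd hn].
  by rewrite eh0 el0 -mpolyC1 comp_mpolyC.
apply: (scalerI (a := (n.+1)%:R : R)); first by rewrite pnatr_eq0.
rewrite -comp_mpolyZ ehS newton comp_mpolyN evs_sum; congr (- _).
rewrite (big_ord_widen _ (fun t : nat => psx R K K t.+1 * el (n - t)) hn).
apply: eq_bigr => i hi; rewrite rmorphM /= evsX scale1r IH //; lia.
Qed.

Lemma evs_prod_eh (r : seq nat) : all (fun x => x <= K)%N r ->
  evs 1 K (\prod_(x <- r) eh x) = \prod_(x <- r) el x.
Proof.
move=> h; rewrite rmorph_prod /= big_seq [RHS]big_seq; apply: eq_bigr => x /(allP h).
exact: evs_eh.
Qed.

(** A monomial of e_x is squarefree of degree x, so it puts at most [minn #|A| x] units on the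
    variables in [A]. *)
Lemma supp_prod_el (r : seq nat) m : (\prod_(x <- r) el x)@_m != 0 ->
  mdeg m = sumn r /\
  forall A : {set 'I_K}, (\sum_(i in A) m i <= \sum_(x <- r) minn #|A| x)%N.
Proof.
elim: r m => [|x r IH] m.
  rewrite !big_nil mcoeff1; case: (eqVneq m 0%MM) => [-> _|_]; last by rewrite eqxx.
  by split=> [|A]; rewrite ?mdeg0 // big1 // => i _; rewrite mnm0E.
rewrite big_cons -mcoeff_msupp => /msuppM_le /allpairsP [[m1 m2] /= [h1 h2 ->]].
move: h2; rewrite mcoeff_msupp => /IH [d2 s2].
move: h1; rewrite mcoeff_msupp /el mcoeffZ mulf_eq0 negb_or => /andP [_].
rewrite -mcoeff_msupp mem_msupp_mesym => /andP [/eqP d1 /forallP s1].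
split=> [|A]; first by rewrite mdegD d1 d2.
rewrite big_cons (eq_bigr (fun i => m1 i + m2 i)%N) => [|i _]; last by rewrite mnmDE.
rewrite big_split leq_add //= leq_min; apply/andP; split.
  by rewrite -sum1_card; apply: leq_sum.
by rewrite -d1 mdegE [X in (_ <= X)%N](bigID (mem A)) leq_addr.
Qed.

(** The bound sum of [minn #|A| x] is the sum of the first [#|A|] column lengths of [r], so
    [domle_partial_sums] applies. *)
Lemma prod_el_domle (r : seq nat) m : all (fun x => x <= K)%N r ->
  (\prod_(x <- r) el x)@_m != 0 -> domle (vs m) (conj_seq K r).
Proof.
move=> hr /supp_prod_el [d s]; apply: domle_partial_sums; first by rewrite sumn_conj_seq // -d mdegE.
move=> A; apply: leq_trans (s A) _.
have cK : (#|A| <= K)%N by rewrite -[X in (_ <= X)%N]card_ord max_card.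
rewrite /conj_seq -map_take take_iota (minn_idPl cK) sumnE big_map -[in X in (_ <= X)%N](subn0 #|A|) big_mkord.
rewrite -(sum_lt_conj_part r (leqnn #|A|)); apply: leq_sum => t _.
by rewrite ltn_ord mul1n.
Qed.

Lemma subm_xmon n (l : seq nat) : is_partition n l ->
  (xmon K l - ones (size l))%MM = xmon K (drop_col l).
Proof.
move=> pl; apply/mnmP => i; rewrite mnmBE !mnmE (nth_drop_col i pl).
by case: ltnP => [_|h]; rewrite ?subn1 // (nth_default _ h).
Qed.

(** Since x^l involves exactly [size l] variables, only one squarefree monomial of that degree
    divides it, namely x_1 ... x_(size l). *)
Lemma mcoeff_el_mul n (l : seq nat) F : is_partition n l -> (n <= K)%N ->
  (el (size l) * F)@_(xmon K l) = (-1) ^+ size l * F@_(xmon K (drop_col l)).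
Proof.
move=> pl hn; have sl : (size l <= K)%N := leq_trans (partition_size_le pl) hn.
rewrite /el -scalerAl mcoeffZ; congr (_ * _).
rewrite mesymE mulr_suml mcoeff_sum.
pose A0 := [set i : 'I_K | (i < size l)%N].
have cA0 : #|A0| = size l.
  rewrite -sum1_card -[RHS](sum_lt sl) big_mkcond; apply: eq_bigr => i _.
  by rewrite inE; case: (i < size l)%N.
have mA0 : mesym1 A0 = ones (size l) by apply/mnmP => i; rewrite !mnmE inE.
rewrite (bigD1 A0) /= ?cA0 // big1 => [|A /andP [/eqP cA ne]].
  rewrite addr0 mA0 mcoeff_mulXm (subm_xmon pl); case: ifP => // /negbT/negP [].
  rewrite ones_le; apply/forallP => i; apply/implyP => hi.
  by rewrite mnmE (nth_partition_gt0 pl hi).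
rewrite mcoeff_mulXm; case: ifP => // /mnm_lepP le; case/eqP: ne.
apply/eqP; rewrite eqEcard cA cA0 leqnn andbT; apply/subsetP => i iA; rewrite inE.
have := le i; rewrite !mnmE iA; case: ltnP => // h; by rewrite (nth_default _ h).
Qed.

Lemma prod_el_lead n (l : seq nat) : is_partition n l -> (n <= K)%N ->
  (\prod_(x <- conj_seq K l) el x)@_(xmon K l) = (-1) ^+ n.
Proof.
have [d] := ubnP n; elim: d n l => // d IH n l ltd pl hn.
have [l0|l0] := eqVneq l [::].
  rewrite -(partition_sumn pl) l0 /conj_seq big_map (eq_bigr (fun=> 1)) => [|t _]; last exact: el0.
  rewrite big1_eq mcoeff1 (_ : xmon K [::] = 0%MM) ?eqxx ?expr0 //.
  by apply/mnmP => i; rewrite !mnmE nth_nil.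
have [posl lt] : all (fun x : nat => 0 < x)%N l /\ (sumn (drop_col l) < n)%N.
  by split; [case/and3P: pl|rewrite -[n in (_ < n)%N](partition_sumn pl) (sumn_drop_col_lt pl)].
have e := sumn_drop_col posl; rewrite (partition_sumn pl) in e.
have pl' := drop_col_partition pl.
(* With K = K' + 1, the column lengths of [l] begin with [size l]; those of [drop_col l] are the
   same list shifted by one and end with an empty column, where [el 0 = 1]. *)
have [K' [i1 i2 K'n]] : exists K', [/\ iota 0 K = 0%N :: iota 1 K',
    iota 0 K = rcons (iota 0 K') K' & (n <= K'.+1)%N].
  have -> : K = K.-1.+1 by lia.
  by exists K.-1; split=> //; [rewrite -cats1 -[X in iota 0 X]addn1 iotaD|lia].
have -> : \prod_(x <- conj_seq K l) el x = el (size l) * \prod_(x <- conj_seq K (drop_col l)) el x.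
  rewrite /conj_seq !big_map {1}i1 i2 big_cons conj_part0 // -cats1 big_cat big_seq1 /=.
  congr (_ * _).
  rewrite [conj_part _ K']conj_part_eq0 ?el0 ?mulr1; last first.
    by apply: all_leqW (all_leq_sumn _); lia.
  by rewrite -[1%N]addn0 iotaDl big_map; apply: eq_bigr => i _; rewrite conj_part_drop_col.
rewrite (mcoeff_el_mul _ pl hn) (IH _ _ _ pl') -?exprD; [|by lia|by lia].
by rewrite addnC e.
Qed.
End Elementary.

(** * Jack functions *)
Section Jack.
Variables (R : realFieldType) (K : nat) (a : R) (J : seq nat -> {mpoly R[K]}).
Hypotheses (a0 : 0 < a) (hJ : IsJack a J).
Implicit Types (f g h F G : {mpoly R[K]}) (m e : 'X_{1..K}) (n N : nat).
Implicit Types (l mu : seq nat).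
Local Notation evs s N := (comp_mpoly (evt K s N)).
Local Notation "<< f , g >>" := (pinner a f g) (at level 0, f at level 99).
Local Notation ones := (ones K).
Let a_neq0 : a != 0. Proof. exact: lt0r_neq0. Qed.

Lemma jack_orth n n' l mu : is_partition n l -> is_partition n' mu ->
  (n <= K)%N -> (n' <= K)%N -> l != mu -> <<J l, J mu>> = 0.
Proof.
move=> pl pm hn hn' ne; case: hJ => H _; apply: H => //.
- exact: partition_self pl.
- exact: partition_self pm.
- by rewrite (partition_sumn pl).
- by rewrite (partition_sumn pm).
Qed.

Lemma jack_supp n l e : is_partition n l -> (n <= K)%N ->
  (evs 1 K (J l))@_e != 0 -> domle (vs e) l.
Proof.
move=> pl hn he; case: hJ => _ /(_ l (partition_self pl)).
rewrite (partition_sumn pl) => /(_ hn) [H _].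
have /H : e \in msupp (ev (J l)) by rewrite mcoeff_msupp ev_evs.
move/(dominated_domle (xshape_sorted e)); apply: domle_ts => // t.
exact: ts_xshape.
Qed.

Lemma jack_lead n l : is_partition n l -> (n <= K)%N ->
  (evs 1 K (J l))@_(xmon K l) = hook_h a l.
Proof.
move=> pl hn; case: hJ => _ /(_ l (partition_self pl)).
by rewrite (partition_sumn pl) ev_evs => /(_ hn) [].
Qed.

Lemma wt_jack n l : is_partition n l -> (n <= K)%N -> wt n (J l).
Proof.
move=> pl hn; apply: wt_ev => e /(jack_supp pl hn) [he _].
by rewrite -sumn_vs he (partition_sumn pl).
Qed.

Lemma hook_neq0 l : hook_h a l != 0.
Proof. by rewrite lt0r_neq0 // hook_h_gt0. Qed.

Definition jack_norm l := <<J l, J l>>.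

Lemma jack_norm_gt0 n l : is_partition n l -> (n <= K)%N -> 0 < jack_norm l.
Proof.
move=> pl hn; apply: pinner_gt0 => //; apply/eqP => J0.
by have := jack_lead pl hn; rewrite J0 comp_mpoly0 mcoeff0 => /esym/eqP; rewrite (negbTE (hook_neq0 l)).
Qed.

Lemma jack_norm_neq0 n l : is_partition n l -> (n <= K)%N -> jack_norm l != 0.
Proof. by move=> pl hn; rewrite lt0r_neq0 // (jack_norm_gt0 pl). Qed.

(** Orthogonality says that [B] is a right inverse of the matrix [A] of power-sum coefficients. Both
    are square, the monomials of weight n being indexed by the partitions of n when n <= K, so [B]
    is also a left inverse; this is the expansion. *)
Lemma jack_expand n f : (n <= K)%N -> wt n f ->
  f = \sum_(l <- partitions n) (<<f, J l>> / jack_norm l) *: J l.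
Proof.
move=> hn; pose P := size (partitions n); pose p (i : 'I_P) := nth [::] (partitions n) i.
have pP i : is_partition n (p i) by rewrite -mem_partitions mem_nth.
pose r := [seq pmon K l | l <- partitions n].
have ur : uniq r.
  rewrite map_inj_in_uniq ?uniq_partitions // => l mu; rewrite !mem_partitions => pl pm.
  exact: (pmon_inj hn hn pl pm).
have rP m : (m \in r) = (mnmwgt m == n).
  apply/mapP/eqP => [[l]|e].
    rewrite mem_partitions => pl ->; rewrite wt_pmon ?(partition_sumn pl) //.
    apply/allP => x hx; case/and3P: (pl) => _ /allP /(_ x hx) -> _ /=.
    by apply: leq_trans hn; rewrite -(partition_sumn pl); apply: (allP (all_leq_sumn l)).
  by have [l] := pmon_surj m; rewrite e -mem_partitions => hl <-; exists l.
pose w m : R := a ^+ mdeg m * (zee m)%:R.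
have inner g h : wt n g -> <<g, h>> = \sum_(j < P) g@_(pmon K (p j)) * (h@_(pmon K (p j)) * w (pmon K (p j))).
  move=> hg; rewrite pinnerE (@sum_msupp_sub _ _ _ _ r) //; last first.
    by move=> m; rewrite mcoeff_msupp rP => /hg ->.
  rewrite big_map (big_nth [::]) big_mkord; apply: eq_bigr => j _.
  by rewrite /w !mulrA.
pose A := \matrix_(i < P, j < P) (J (p i))@_(pmon K (p j)).
pose B := \matrix_(j < P, i < P) ((J (p i))@_(pmon K (p j)) * w (pmon K (p j)) / jack_norm (p i)).
have AB : A *m B = 1%:M.
  apply/matrixP => i i'; rewrite !mxE.
  transitivity (<<J (p i), J (p i')>> / jack_norm (p i')).
    rewrite inner; last exact: wt_jack (pP i) hn.
    by rewrite mulr_suml; apply: eq_bigr => j _; rewrite !mxE !mulrA.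
  have [->|ne] := eqVneq i i'; first by rewrite divff // (jack_norm_neq0 (pP i')).
  rewrite (jack_orth (pP i) (pP i')) ?mul0r // /p nth_uniq ?uniq_partitions //.
move=> hf; apply/mpolyP => m; have [e|ne] := eqVneq (mnmwgt m) n; last first.
  have Z g : wt n g -> g@_m = 0.
    by move=> hg; apply/eqP; apply: contraNT ne => /hg ->.
  rewrite Z // Z // big_seq; apply: wt_sum => l; rewrite mem_partitions => pl.
  exact/wtZ/(wt_jack pl).
have /mapP [l hl ->] : m \in r by rewrite rP e.
have lt : (index l (partitions n) < P)%N by rewrite index_mem.
pose k := Ordinal lt; have -> : l = p k by rewrite /p nth_index.
have := congr1 (fun M : 'M_P => (\row_j f@_(pmon K (p j)) *m M) 0 k) (mulmx1C AB).
rewrite /= mulmx1 mxE => <-; rewrite mulmxA mxE raddf_sum /= (big_nth [::]) big_mkord.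
apply: eq_bigr => i _; rewrite mcoeffZ [A _ _]mxE -/(p i); congr (_ * _).
rewrite inner // mxE mulr_suml; apply: eq_bigr => j _.
by rewrite !mxE !mulrA.
Qed.

(* Unitriangularity: the Jack coefficients of [f] on an upper set of partitions are
   determined by its monomial coefficients on that set. *)
Lemma jack_triangular n f (U : seq nat -> Prop) : (n <= K)%N -> wt n f ->
  (forall l mu, is_partition n l -> is_partition n mu -> U l -> domle l mu -> U mu) ->
  (forall l, is_partition n l -> U l -> (evs 1 K f)@_(xmon K l) = 0) ->
  forall l, is_partition n l -> U l -> <<f, J l>> = 0.
Proof.
move=> hn hf up h0; have bd l : is_partition n l -> (qs l <= n * n)%N.
  move=> pl; have := all_leq_sumn l; rewrite (partition_sumn pl) => /qs_ts ->.
  have -> : (n * n = \sum_(t < n) n)%N by rewrite sum_nat_const card_ord.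
  apply: leq_sum => t _; rewrite -[X in (_ <= X)%N](partition_sumn pl) -ts0.
  by apply: leq_sum => x _; lia.
have [d hd] : {d | (n * n < d)%N} by exists (n * n).+1.
(* Downward induction along dominance, measured by [qs], which is strictly increasing there and at
   most [n * n]. *)
suff H k l : (n * n - qs l < k)%N -> is_partition n l -> U l -> <<f, J l>> = 0.
  by move=> l; apply: (H (n * n - qs l).+1).
elim: k l => // k IH l ltk pl Ul; have sl : (size l <= K)%N.
  exact: leq_trans (partition_size_le pl) hn.
have := congr1 (fun g => (evs 1 K g)@_(xmon K l)) (jack_expand hn hf).
rewrite /= h0 // evs_sum mcoeff_sum => /esym.
rewrite (bigD1_seq l) /= ?uniq_partitions ?mem_partitions // big_seq_cond big1 => [|mu].
  rewrite addr0 comp_mpolyZ mcoeffZ (jack_lead pl hn) => /eqP.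
  rewrite !mulf_eq0 invr_eq0 (negbTE (hook_neq0 l)) (negbTE (jack_norm_neq0 pl hn)) !orbF.
  by move/eqP.
rewrite mem_partitions => /andP [pm ne]; rewrite comp_mpolyZ mcoeffZ.
have [->|] := eqVneq (evs 1 K (J mu))@_(xmon K l) 0; first by rewrite mulr0.
move/(jack_supp pm hn)/(domle_ts (fun t => ts_xmon t sl) (fun=> erefl)) => le.
rewrite IH ?mul0r //; last exact: up le.
have := domle_qs_lt pl pm le; rewrite eq_sym => /(_ ne).
have := bd _ pm; lia.
Qed.

Lemma jack_evs_supp n N l e : is_partition n l -> (n <= K)%N ->
  (evs 1 N (J l))@_e != 0 -> in_vars N e /\ domle (vs e) l.
Proof.
move=> pl hn he; have hN := evs_in_vars he; split=> //.
by apply: (jack_supp pl hn); rewrite -(mcoeff_evs _ _ hN).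
Qed.

(** A monomial in N variables has at most N nonzero exponents, whereas an exponent dominated by [l]
    has at least [size l]. *)
Lemma jack_evs0 n N l : is_partition n l -> (n <= K)%N -> (N < size l)%N ->
  evs 1 N (J l) = 0.
Proof.
move=> pl hn lt; apply/mpolyP => e; rewrite mcoeff0; apply/eqP; apply: contraLR lt.
move/(jack_evs_supp pl hn) => [/in_vars_conj_part hN [he hle]]; rewrite -leqNgt.
apply: leq_trans hN; rewrite (size_ts pl) !ts0 -he.
by have := tsS (vs e) 0; have := hle 1%N; rewrite ts0; lia.
Qed.

(** The partitions with at most N rows form an upper set for dominance, and the coefficients of
    their monomials are visible in N variables. *)
Lemma jack_triangular_size n N f : (n <= K)%N -> wt n f -> evs 1 N f = 0 ->
  forall l, is_partition n l -> (size l <= N)%N -> <<f, J l>> = 0.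
Proof.
move=> hn hf f0; apply: (jack_triangular hn hf (U := fun l => (size l <= N)%N)).
  by move=> l mu pl pm hl le; apply: leq_trans hl; apply: domle_size pl pm le.
move=> l pl hl; rewrite -(mcoeff_evs _ _ (N := N)) ?f0 ?mcoeff0 //.
exact: xmon_in_vars.
Qed.

(** * Eigenvalues of Jack functions and removal of a column *)

Lemma LBrel_jack n N f : wt n f -> (n <= K)%N -> LBrel a N (evs 1 N f) (evs 1 N (LB_psum a f)).
Proof.
move=> hf hn; rewrite -[evs 1 N (LB_psum a f)]scale1r.
by apply: LBrel_evs hf hn _ _ _; rewrite ?mul1r ?mulr1.
Qed.

(** By [LBrel_support] the monomials of D J_mu stay below mu, so D J_mu pairs to zero with J_nu
    unless nu is below mu. Self-adjointness gives the reverse comparison, so D is diagonal; the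
    eigenvalue is read at the leading exponent. *)
Lemma LB_psum_jack n l : is_partition n l -> (n <= K)%N -> LB_psum a (J l) = eps a l *: J l.
Proof.
move=> pl hn; have sl : (size l <= K)%N := leq_trans (partition_size_le pl) hn.
have tri mu nu : is_partition n mu -> is_partition n nu -> ~ domle nu mu ->
    <<LB_psum a (J mu), J nu>> = 0.
  move=> pm pn; apply: (jack_triangular hn (U := fun nu => ~ domle nu mu)) pn.
  - exact/wt_LB_psum/(wt_jack pm).
  - by move=> x y _ _ hx le ly; apply: hx; apply: domle_trans ly.
  - move=> x px hx; have sx : (size x <= K)%N := leq_trans (partition_size_le px) hn.
    apply: (LBrel_support (LBrel_jack K (wt_jack pm hn) hn)) => e' le; apply/eqP.
    apply: contraT => /(jack_supp pm hn) le'; case: hx.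
    apply: domle_ts (domle_trans le le') => t //; exact: ts_xmon.
have E : LB_psum a (J l) = (<<LB_psum a (J l), J l>> / jack_norm l) *: J l.
  have hw := wt_LB_psum (a := a) (wt_jack pl hn).
  rewrite {1}(jack_expand hn hw) (bigD1_seq l) /= ?uniq_partitions ?mem_partitions //.
  rewrite big_seq_cond big1 ?addr0 // => mu; rewrite mem_partitions => /andP [pm ne].
  have [->|nz] := eqVneq <<LB_psum a (J l), J mu>> 0; first by rewrite mul0r scale0r.
  case/eqP: ne; apply: (partition_domle_anti pm pl).
    by case: (domle_dec mu l) => // h; rewrite tri ?eqxx in nz.
  case: (domle_dec l mu) => // h; move: nz; rewrite LB_psum_selfadj // pinnerC.
  by rewrite tri ?eqxx.
have qmax e' : (evs 1 K (J l))@_e' != 0 -> (qs (vs e') <= qs (vs (xmon K l)))%N.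
  move=> /(jack_supp pl hn) le; apply: domle_qs.
  by apply: domle_ts le => // t; rewrite ts_xmon.
have := LBrel_top (LBrel_jack K (wt_jack pl hn) hn) (xmon_in_vars sl) qmax.
rewrite E comp_mpolyZ mcoeffZ => /mulIf -> ; last by rewrite (jack_lead pl) ?hook_neq0.
by congr (_ *: _); apply: eps_ts => t; rewrite ts_xmon.
Qed.

(** Both sides are eigenfunctions for [eps a l], the shift on the right being that of
    [eps_drop_col], and the hook factors equalize the coefficients of x^l. In the difference all
    exponents lie below [l] and none is a permutation of [l], so by [eps_inj] none has this
    eigenvalue and [LBrel_uniq] applies. *)
Lemma jack_column n l : is_partition n l -> (n <= K)%N ->
  hook_h a (drop_col l) *: evs 1 (size l) (J l)
  = hook_h a l *: ('X_[ones (size l)] * evs 1 (size l) (J (drop_col l))).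
Proof.
move=> pl hn; set N := size l; set l' := drop_col l.
have pl' : is_partition (sumn l') l' := drop_col_partition pl.
have sl : (N <= K)%N := leq_trans (partition_size_le pl) hn.
have [_ pos _] := and3P pl.
have hn' : (sumn l' <= K)%N.
  by rewrite (leq_trans _ hn) // -(partition_sumn pl) -(sumn_drop_col pos) leq_addr.
have LX1 : LBrel a N (evs 1 N (J l)) (eps a l *: evs 1 N (J l)).
  by rewrite -comp_mpolyZ -(LB_psum_jack pl hn); apply: LBrel_jack (wt_jack pl hn) hn.
have LX2 : LBrel a N ('X_[ones N] * evs 1 N (J l')) (eps a l *: ('X_[ones N] * evs 1 N (J l'))).
  have h : LBrel a N (evs 1 N (J l')) (eps a l' *: evs 1 N (J l')).
    by rewrite -comp_mpolyZ -(LB_psum_jack pl' hn'); apply: LBrel_jack (wt_jack pl' hn') hn'.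
  have eul : \sum_(k < K) 'X_k * (evs 1 N (J l'))^`M(k) = (sumn l')%:R *: evs 1 N (J l').
    by rewrite euler_evs -comp_mpolyZ; congr comp_mpoly; apply/wtP/(wt_jack pl' hn').
  have := LBrel_mul_ones sl h eul (fun k hk => mderiv_evs0 1 (J l') hk).
  by rewrite -scalerDl -scalerAr addrA -(eps_drop_col a pos).
apply/eqP; rewrite -subr_eq0; apply/eqP; rewrite -scaleNr.
have LXH := LBrel_lin (hook_h a l') (- hook_h a l) LX1 LX2.
rewrite !scalerA ![_ * eps a l]mulrC -!scalerA -scalerDr in LXH.
apply: (LBrel_uniq LXH) => e he.
have mX F' : ('X_[ones N] * F')@_e = if (ones N <= e)%MM then F'@_(e - ones N) else 0.
  exact: mcoeff_mulXm.
have [hN le] : in_vars N e /\ domle (vs e) l.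
  move: he; rewrite mcoeffD !mcoeffZ mX.
  have [->|/(jack_evs_supp pl hn) [] //] := eqVneq (evs 1 N (J l))@_e 0.
  rewrite mulr0 add0r mulf_eq0 negb_or => /andP [_]; case: ifP => [ge he|]; last by rewrite eqxx.
  have [hv [h1 h2]] := jack_evs_supp pl' hn' he.
  have hv' : in_vars N e.
    by move=> i hi; have := hv i hi; rewrite mnmBE mnmE ltnNge hi subn0.
  have h0 : sumn (vs e) = sumn l by rewrite (sumn_subm sl ge) h1 (sumn_drop_col pos).
  split=> //; split=> // -[|t]; first by rewrite !ts0 h0.
  by rewrite -(vs_subm _ sl hv' ge) -ts_drop_col.
split=> //; apply/eqP => /(eps_inj a0 le) e_l; case/eqP: he.
have ge : (ones N <= e)%MM.
  by apply: in_vars_pos => //; rewrite (conj_part_ts e_l) conj_part0.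
rewrite mcoeffD !mcoeffZ mX ge.
have -> : (evs 1 N (J l))@_e = hook_h a l.
  have xl : in_vars N (xmon K l) by apply: xmon_in_vars.
  rewrite (@evs_perm _ _ _ _ _ _ (xmon K l)) // => [|t]; last by rewrite ts_xmon // e_l.
  by rewrite (mcoeff_evs _ _ xl) (jack_lead pl hn).
have -> : (evs 1 N (J l'))@_(e - ones N) = hook_h a l'.
  have xl : in_vars N (xmon K l') by apply: xmon_in_vars; apply: size_drop_col.
  have vl : in_vars N (e - ones N) by move=> i hi; rewrite mnmBE hN.
  rewrite (@evs_perm _ _ _ _ _ _ (xmon K l')) // => [|t]; last first.
    by rewrite ts_xmon ?(leq_trans (size_drop_col l)) // ts_drop_col -e_l vs_subm.
  by rewrite (mcoeff_evs _ _ xl) (jack_lead pl' hn').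
by rewrite mulNr mulrC subrr.
Qed.

(** * Pieri coefficients and principal specialization *)
Section Pieri.
Variables (o : 'I_K) (o0 : o = 0%N :> nat).

Definition pieri_coef l mu := <<(J l)^`M(o), J mu>>.

Lemma pieri_coefE l mu : <<'X_o * J mu, J l>> = a * pieri_coef l mu.
Proof. by rewrite pinner_mulX o0 mulr1 pinnerC. Qed.

Lemma E2perp_jack n l mu : is_partition n.+1 l -> is_partition n mu -> (n < K)%N ->
  <<E2perp (J l), J mu>> = (eps a l - eps a mu) * pieri_coef l mu.
Proof.
move=> pl pm hn; have := mderiv0_LB_psum a (J l) o0; rewrite (LB_psum_jack pl hn) mderivZ => e.
have -> : E2perp (J l) = eps a l *: (J l)^`M(o) - LB_psum a (J l)^`M(o) by rewrite e addrC addKr.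
by rewrite pinnerBl pinnerZl LB_psum_selfadj // (LB_psum_jack pm (ltnW hn)) pinnerZr -mulrBl.
Qed.

Definition ord_predn (k : 'I_K) : 'I_K := Ordinal (leq_ltn_trans (leq_pred k) (ltn_ord k)).

Lemma E2perpE f :
  E2perp f = \sum_(k < K | k != o) (k.+1)%:R *: ('X_(ord_predn k) * f^`M(k)).
Proof.
rewrite /E2perp (exchange_big_dep (fun j => j != o)) /= => [|i j _ /eqP e]; last first.
  by apply/eqP => jo; have := o0; rewrite -jo e.
apply: eq_bigr => k ko.
have k0 : (0 < k)%N by rewrite lt0n -o0; apply: contra ko => /eqP h; apply/eqP/val_inj.
rewrite (big_pred1 (ord_predn k)) => [|i]; last by rewrite /= -val_eqE /=; lia.
by rewrite /= prednK.
Qed.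

(** d/dx_l sends p_k to k x_l^(k-1), so summing over l replaces d/dp_k by k p_(k-1) d/dp_k. For k =
    1 the power sum p_0 is the number N of variables. *)
Lemma nabla_evs N f : (N <= K)%N ->
  \sum_(l < K | (l < N)%N) (evs 1 N f)^`M(l) = evs 1 N (N%:R *: f^`M(o) + E2perp f).
Proof.
move=> hN; transitivity (\sum_(k < K) (k.+1)%:R *: (evs 1 N f^`M(k) * psx R K N k)).
  transitivity (\sum_(l < K | (l < N)%N) \sum_(k < K) (k.+1)%:R *: (evs 1 N f^`M(k) * 'X_l ^+ k)).
    by apply: eq_bigr => l hl; rewrite mderiv_evs //; apply: eq_bigr => k _; rewrite mul1r.
  by rewrite exchange_big; apply: eq_bigr => k _ /=; rewrite -scaler_sumr -mulr_sumr.
rewrite comp_mpolyD comp_mpolyZ (bigD1 o) //=; congr (_ + _).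
  have -> : psx R K N o = N%:R.
    rewrite /psx o0 (eq_bigr (fun=> 1%:R)) => [|i _]; last by rewrite expr0.
    by rewrite -natr_sum big_mkcond -[in RHS](sum_lt hN); congr (_%:R); apply: eq_bigr => i _; case: (i < N)%N.
  by rewrite o0 scale1r mulr_natr scaler_nat.
rewrite E2perpE evs_sum; apply: eq_bigr => k ko; rewrite comp_mpolyZ rmorphM /= evsX scale1r.
by rewrite mulrC prednK // lt0n -o0; apply: contra ko => /eqP h; apply/eqP/val_inj.
Qed.

(** In [size l] variables J_mu already vanishes, hence so does p_1 J_mu. *)
Lemma pieri_size_lt n l mu : is_partition n.+1 l -> is_partition n mu -> (n < K)%N ->
  (size l < size mu)%N -> <<'X_o * J mu, J l>> = 0.
Proof.
move=> pl pm hn lt; have hw : wt n.+1 ('X_o * J mu).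
  by have := wt_mulX (k := o) (wt_jack pm (ltnW hn)); rewrite o0 addn1.
apply: (jack_triangular_size (N := size l) hn hw) => //.
by rewrite rmorphM /= (jack_evs0 pm (ltnW hn) lt) mulr0.
Qed.

(** In N = [size l] - 1 variables J_l vanishes, hence so does N dJ_l/dp_1 + E_2^perp J_l. Its
    coefficient on J_mu is proportional to N + E_l - E_mu times [pieri_coef l mu], and is zero
    because mu has at most N rows. *)
Lemma pieri_new_row_eps n l mu : is_partition n.+1 l -> is_partition n mu -> (n < K)%N ->
  (size mu < size l)%N -> pieri_coef l mu != 0 ->
  eps a l - eps a mu = - (size l).-1%:R.
Proof.
move=> pl pm hn lt nz; set N := (size l).-1.
have lN : (N < size l)%N by rewrite /N; case: (size l) lt.
have hN : (N <= K)%N.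
  by apply: ltnW (leq_trans lN _); apply: leq_trans (partition_size_le pl) hn.
have hw := wt_jack pl hn.
have hwd : wt n (N%:R *: (J l)^`M(o) + E2perp (J l)).
  apply: wtD; last exact: wt_E2perp.
  by apply: wtZ; apply: wt_deriv; rewrite o0 addn1.
have e0 : evs 1 N (N%:R *: (J l)^`M(o) + E2perp (J l)) = 0.
  rewrite -nabla_evs // (jack_evs0 pl hn lN).
  by apply: big1 => k _; rewrite mderiv0.
have := jack_triangular_size (ltnW hn) hwd e0 pm; rewrite -ltnS (prednK (leq_ltn_trans _ lt)) //.
move=> /(_ lt); rewrite pinnerDl pinnerZl (E2perp_jack pl pm hn) -mulrDl => /eqP.
by rewrite mulf_eq0 (negbTE nz) orbF addrC addr_eq0 => /eqP.
Qed.

(** Setting x_(N+1) = 0 after differentiating kills every derivative except the one in x_(N+1),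
    which removes that factor. *)
Lemma mcoeff_nabla_ones N F e : (N < K)%N -> in_vars N e ->
  (\sum_(l < K | (l < N.+1)%N) ('X_[ones N.+1] * F)^`M(l))@_e = ('X_[ones N] * F)@_e.
Proof.
move=> hN he; pose i := Ordinal hN; rewrite mcoeff_sum (bigD1 i) //= big1 => [|l /andP [_ li]].
  rewrite addr0 mcoeff_mderiv he // mulr1n !mcoeff_mulXm.
  have E : (e + U_(i) - ones N.+1)%MM = (e - ones N)%MM.
    by apply/mnmP => k; rewrite !(mnmBE, mnmDE) !mnmE -val_eqE /=; have := he k; lia.
  rewrite E; congr (if _ then _ else _); rewrite !ones_le.
  apply/forallP/forallP => h k; apply/implyP => hk; have := h k; rewrite mnmDE mnm1E.
    by rewrite ltnS (ltnW hk) /= -val_eqE /= (gtn_eqF hk) addn0.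
  move: hk; rewrite ltnS leq_eqVlt => /orP [/eqP hk _|hk]; last by rewrite hk => /= /ltn_addr.
  by rewrite -val_eqE /= hk eqxx addn1.
rewrite mcoeff_mderiv mcoeff_mulXm ones_le; case: forallP => [/(_ i)|]; last by rewrite mul0rn.
by rewrite ltnSn /= mnmDE mnm1E (negbTE li) addn0 he.
Qed.

Lemma rcons1_drop_col n l : is_partition n (rcons l 1%N) ->
  is_partition n.-1 l /\ drop_col (rcons l 1%N) = drop_col l.
Proof.
case/and3P=> ss ps /eqP e; split; last first.
  by rewrite /drop_col -cats1 filter_cat map_cat /= cats0.
apply/and3P; split.
- by move: ss; rewrite -cats1 => /cat_sorted2 [].
- by move: ps; rewrite all_rcons => /andP [].
- by rewrite -e -cats1 sumn_cat /= addn0 addn1.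
Qed.

(** In N + 1 = [size l] variables, sum_i d/dx_i is applied to J_l, which is proportional to x_1 ...
    x_(N+1) J_(drop_col l), and then x_(N+1) is set to 0. The result [f] pairs with J_mu to
    [pieri_coef l mu] itself, since E_l - E_mu = - N; in N variables it turns out to be zero or
    proportional to a single Jack polynomial. *)
Lemma pieri_new_row n l mu : is_partition n.+1 l -> is_partition n mu -> (n < K)%N ->
  (size mu < size l)%N -> pieri_coef l mu != 0 -> l = rcons mu 1%N.
Proof.
move=> pl pm hn lt nz; have ce := pieri_new_row_eps pl pm hn lt nz.
move sl: (size l) => [|N]; first by rewrite sl in lt.
rewrite sl /= in ce; rewrite sl ltnS in lt.
have hN : (N < K)%N by apply: leq_trans hn; rewrite -sl; apply: partition_size_le pl.
have hw := wt_jack pl hn.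
pose f := N.+1%:R *: (J l)^`M(o) + E2perp (J l).
have hf : wt n f.
  apply: wtD; last exact: wt_E2perp.
  by apply: wtZ; apply: wt_deriv; rewrite o0 addn1.
have f_mu : <<f, J mu>> = pieri_coef l mu.
  rewrite pinnerDl pinnerZl (E2perp_jack pl pm hn) -mulrDl ce -natr1.
  by rewrite addrAC subrr add0r mul1r.
have ef : hook_h a (drop_col l) *: evs 1 N f = hook_h a l *: ('X_[ones N] * evs 1 N (J (drop_col l))).
  apply/mpolyP => e; rewrite !mcoeffZ mcoeff_mulXm.
  have [/forallP he|/forallPn [k]] := boolP [forall k : 'I_K, (N <= k)%N ==> (e k == 0)%N]; last first.
    rewrite negb_imply => /andP [hk ek].
    have -> : (evs 1 N f)@_e = 0.
      by apply/eqP; apply: contraNT ek => /evs_in_vars -> //.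
    rewrite mulr0; case: ifP => _; rewrite ?mulr0 //.
    have -> : (evs 1 N (J (drop_col l)))@_(e - ones N) = 0; last by rewrite mulr0.
    apply/eqP; apply: contraNT ek => /evs_in_vars /(_ k hk).
    by rewrite mnmBE mnmE ltnNge hk subn0 => ->.
  have {}he : in_vars N e by move=> k hk; apply/eqP; have := he k; rewrite hk.
  have he1 : in_vars N.+1 e by move=> k hk; apply/he/ltnW.
  have -> : (evs 1 N f)@_e = (evs 1 N.+1 f)@_e by rewrite (mcoeff_evs _ _ he) (mcoeff_evs _ _ he1).
  rewrite -mcoeffZ -nabla_evs // scaler_sumr.
  have := jack_column pl hn; rewrite sl => col.
  under eq_bigr => k _ do rewrite -mderivZ col mderivZ.
  rewrite -scaler_sumr mcoeffZ (mcoeff_nabla_ones _ hN he) mcoeff_mulXm.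
  apply: (congr1 (fun x => hook_h a l * x)).
  case: (ones N <= e)%MM; last exact: erefl.
  have he2 : in_vars N (e - ones N) by move=> k hk; rewrite mnmBE he.
  have he3 : in_vars N.+1 (e - ones N) by move=> k hk; apply/he2/ltnW.
  by rewrite (mcoeff_evs _ _ he2) (mcoeff_evs _ _ he3).
have [ss _ _] := and3P pl.
have pd : is_partition (sumn (drop_col l)) (drop_col l) := drop_col_partition pl.
have hd : (sumn (drop_col l) <= K)%N.
  have [_ pos _] := and3P pl.
  by rewrite (leq_trans _ hn) // -(partition_sumn pl) -(sumn_drop_col pos) leq_addr.
(* Without a row of length 1, [drop_col l] still has N + 1 rows and [f] would vanish in N
   variables. *)
have [lt1|ge1] := ltnP N (size (drop_col l)).
  have f0 : evs 1 N f = 0.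
    move: ef; rewrite (jack_evs0 pd hd lt1) mulr0 scaler0 => /eqP.
    by rewrite scaler_eq0 (negbTE (hook_neq0 _)) => /eqP.
  have := jack_triangular_size (ltnW hn) hf f0 pm lt; rewrite f_mu => z.
  by rewrite z eqxx in nz.
have last1 : nth 0%N l N = 1%N.
  apply/eqP; rewrite eqn_leq -[X in _ && X]/(0 < _)%N (nth_partition_gt0 pl) ?sl // andbT.
  rewrite leqNgt nth_conj_part // -conj_part_drop_col conj_part0 -?leqNgt //.
  by have [_ ->] := and3P pd.
have lE : l = rcons (take N l) 1%N.
  by rewrite -last1 -take_nth ?sl // take_oversize ?sl.
set mu0 := take N l in lE; rewrite lE; congr rcons; apply/eqP; apply: contraTT nz => ne.
have := pl; rewrite {1}lE => /rcons1_drop_col [pm0 d0]; rewrite -lE in d0.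
have s0 : size mu0 = N by rewrite size_takel // sl.
(* Removing the final row of length 1 does not change [drop_col], so the column formula for [mu0]
   has the right-hand side of [ef] up to a scalar. *)
have := jack_column pm0 (ltnW hn); rewrite s0 -d0 => col0.
have z0 : evs 1 N (hook_h a mu0 *: f - hook_h a l *: J mu0) = 0.
  apply: (scalerI (hook_neq0 (drop_col l))); rewrite scaler0 comp_mpolyB !comp_mpolyZ scalerBr.
  have sCA (c d : R) (x : {mpoly R[K]}) : c *: (d *: x) = d *: (c *: x).
    by rewrite !scalerA mulrC.
  by rewrite sCA ef (sCA (hook_h a (drop_col l)) (hook_h a l)) col0 sCA subrr.
have hw0 : wt n (hook_h a mu0 *: f - hook_h a l *: J mu0).
  by apply: wtB; apply: wtZ => //; apply: wt_jack pm0 (ltnW hn).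
have := jack_triangular_size (ltnW hn) hw0 z0 pm lt.
rewrite pinnerBl !pinnerZl (jack_orth pm0 pm) ?(ltnW hn) // f_mu mulr0 subr0 => /eqP.
by rewrite mulf_eq0 (negbTE (hook_neq0 _)) => /eqP ->; rewrite eqxx.
Qed.
Lemma jack_column' n l : is_partition n l -> (n <= K)%N ->
  'X_[ones (size l)] * evs 1 (size l) (J (drop_col l))
  = (hook_h a (drop_col l) / hook_h a l) *: evs 1 (size l) (J l).
Proof.
move=> pl hn; rewrite [_ / _]mulrC -scalerA (jack_column pl hn) scalerA mulVf ?scale1r //.
exact: hook_neq0.
Qed.

Lemma hook_ratio l mu : hook_h a l / hook_h a mu * (hook_h a mu / hook_h a l) = 1.
Proof. by rewrite mulrA divfK ?divff ?hook_neq0. Qed.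

Lemma ones_neq0 N : 'X_[R, ones N] != 0.
Proof. by rewrite -msupp_eq0 msuppX. Qed.

(** In N = [size l] variables the expansion of p_1 J_mu keeps only shapes with N rows: longer ones
    vanish, shorter ones have coefficient zero. Dividing by x_1 ... x_N gives an expansion of p_1
    J_(drop_col mu) whose coefficients are nonzero multiples of the original ones. *)
Lemma pieri_column n l mu : is_partition n.+1 l -> is_partition n mu -> (n < K)%N ->
  size mu = size l -> pieri_coef l mu != 0 -> pieri_coef (drop_col l) (drop_col mu) != 0.
Proof.
move=> pl pm hn sz; apply: contra => /eqP c0.
set N := size l in sz *; set mu' := drop_col mu in c0 *.
have [posl posm] : all (fun k => 0 < k)%N l /\ all (fun k => 0 < k)%N mu.
  by split; [case/and3P: pl|case/and3P: pm].
have n'E : (sumn mu' + N = n)%N by rewrite -sz sumn_drop_col // (partition_sumn pm).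
have pm' : is_partition (sumn mu') mu' := drop_col_partition pm.
have pd s : is_partition n.+1 s -> size s = N -> is_partition (sumn mu').+1 (drop_col s).
  move=> ps ss; rewrite (_ : (sumn mu').+1 = sumn (drop_col s)); first exact: drop_col_partition ps.
  have [_ poss _] := and3P ps; have := sumn_drop_col poss; rewrite (partition_sumn ps) ss.
  by lia.
have hn' : ((sumn mu').+1 <= K)%N by lia.
have NK : (N <= K)%N by lia.
have wX g k : wt k g -> wt k.+1 ('X_o * g).
  by move=> hg; have := wt_mulX (k := o) hg; rewrite o0 addn1.
pose c s := <<'X_o * J mu, J s>> / jack_norm s.
pose f := \sum_(s <- partitions n.+1 | size s == N) (c s * (hook_h a s / hook_h a (drop_col s))) *: J (drop_col s)
   - (hook_h a mu / hook_h a mu') *: ('X_o * J mu').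
have hf : wt (sumn mu').+1 f.
  apply: wtB; last exact/wtZ/wX/(wt_jack pm' (ltnW hn')).
  rewrite big_seq_cond; apply: wt_sum => s; rewrite mem_partitions => /andP [ps /eqP ss].
  exact/wtZ/(wt_jack (pd s ps ss) hn').
have f0 : evs 1 N f = 0.
  apply: (mulfI (ones_neq0 N)); rewrite mulr0 comp_mpolyB mulrBr evs_sum mulr_sumr.
  rewrite comp_mpolyZ rmorphM /= -scalerAr mulrCA -sz (jack_column' pm (ltnW hn)) sz.
  rewrite -scalerAr scalerA hook_ratio scale1r.
  rewrite big_seq_cond (eq_bigr (fun s => evs 1 N (c s *: J s))) => [|s]; last first.
    rewrite mem_partitions => /andP [ps /eqP ss].
    rewrite !comp_mpolyZ -scalerAr -ss (jack_column' ps hn) scalerA -mulrA hook_ratio.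
    by rewrite mulr1.
  rewrite -big_seq_cond -rmorphM /= (jack_expand hn (wX _ _ (wt_jack pm (ltnW hn)))) evs_sum.
  rewrite [X in _ - X](bigID (fun s => size s == N)) /= opprD addrA subrr sub0r.
  apply/eqP; rewrite oppr_eq0; apply/eqP; rewrite big_seq_cond big1 // => s.
  rewrite mem_partitions => /andP [ps]; case: ltngtP => // ss _.
    by rewrite (pieri_size_lt ps pm hn) ?sz // mul0r scale0r comp_mpoly0.
  by rewrite comp_mpolyZ (jack_evs0 ps hn ss) scaler0.
have pl' := pd l pl erefl.
have := jack_triangular_size hn' hf f0 pl' (size_drop_col l).
rewrite pinnerBl pinnerZl (pieri_coefE) c0 !mulr0 subr0 pinner_suml.
rewrite -big_filter (bigD1_seq l) /=; first last.
- exact/filter_uniq/uniq_partitions.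
- by rewrite mem_filter mem_partitions pl eqxx.
rewrite big_seq_cond big1 => [|s]; last first.
  rewrite mem_filter mem_partitions => /andP [/andP [/eqP ss ps] sl].
  rewrite pinnerZl (jack_orth (pd s ps ss) pl') ?mulr0 //.
  by apply: contraNneq sl => h; apply/eqP/(drop_col_inj ps pl).
rewrite addr0 pinnerZl -/(jack_norm (drop_col l)) /c pieri_coefE => /eqP.
by rewrite !mulf_eq0 !invr_eq0 !(negbTE (hook_neq0 _)) (negbTE (jack_norm_neq0 pl hn))
   (negbTE (jack_norm_neq0 pl' hn')) (negbTE a_neq0) !orbF.
Qed.

(* [l] is [mu] plus one box, of content [eps a l - eps a mu]. *)
Lemma pieri_contents n l mu x : is_partition n.+1 l -> is_partition n mu -> (n < K)%N ->
  pieri_coef l mu != 0 ->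
  (content_poly a l).[x] = (content_poly a mu).[x] * (x + (eps a l - eps a mu)).
Proof.
have [d] := ubnP n; elim: d n l mu x => // d IH n l mu x ltd pl pm hn nz.
have [posl posm] : all (fun k => 0 < k)%N l /\ all (fun k => 0 < k)%N mu.
  by split; [case/and3P: pl|case/and3P: pm].
case: (ltngtP (size l) (size mu)) => sz.
- have := pieri_size_lt pl pm hn sz; rewrite pieri_coefE => /eqP.
  by rewrite mulf_eq0 (negbTE a_neq0) (negbTE nz).
- rewrite (pieri_new_row_eps pl pm hn sz nz) (pieri_new_row pl pm hn sz nz) !content_polyE size_rcons.
  rewrite big_ord_recr /= nth_rcons ltnn eqxx big_ord1 mulr0 addr0; congr (_ * _).
  by apply: eq_bigr => i _; rewrite nth_rcons ltn_ord.
have N0 : (0 < size l)%N.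
  by case: (l) pl => // /partition_sumn.
have e1 := sumn_drop_col posl; have e2 := sumn_drop_col posm.
rewrite (partition_sumn pl) in e1; rewrite (partition_sumn pm) -sz in e2.
have pl' : is_partition (sumn (drop_col mu)).+1 (drop_col l).
  by rewrite (_ : (sumn (drop_col mu)).+1 = sumn (drop_col l)); [exact: drop_col_partition pl|lia].
(* The first columns of [l] and [mu] have equal length and cancel. E_l - E_mu exceeds the difference
   for the truncated shapes by a, since [drop_col l] has one box more than [drop_col mu]; this is
   the shift from x to x + a. *)
have := IH _ _ _ (x + a) _ pl' (drop_col_partition pm) _ (pieri_column pl pm hn (esym sz) nz).
rewrite (content_poly_drop_col a x pl) (content_poly_drop_col a x pm) -sz => ->; [|by lia|by lia].
rewrite (eps_drop_col a posl) (eps_drop_col a posm) -sz (partition_sumn pl') -natr1.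
by ring.
Qed.

(** * Principal specialization of Jack functions *)

Lemma poly_eq_evals (p q : {poly R}) : (forall x, p.[x] = q.[x]) -> p = q.
Proof.
move=> h; apply/eqP; rewrite -subr_eq0; apply/eqP.
apply: (@roots_geq_poly_eq0 _ _ [seq i%:R | i <- iota 0 (size (p - q))]).
- by apply/allP => x _; rewrite rootE !hornerE h subrr.
- by rewrite map_inj_uniq ?iota_uniq // => i j /eqP; rewrite eqr_nat => /eqP.
- by rewrite size_map size_iota.
Qed.

(* Principal specialization at [x = (1, ..., 1)], the number of ones being the indeterminate. *)
Definition pspec : {mpoly R[K]} -> {poly R} := mmap (@polyC R) (fun _ => 'X).

Lemma pspecD f g : pspec (f + g) = pspec f + pspec g. Proof. exact: mmapD. Qed.

Lemma pspecZ c f : pspec (c *: f) = c *: pspec f.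
Proof. by rewrite /pspec mmapZ mul_polyC. Qed.

Lemma pspecM f g : pspec (f * g) = pspec f * pspec g. Proof. exact: rmorphM. Qed.

Lemma pspecC c : pspec c%:MP = c%:P. Proof. exact: mmapC. Qed.

Lemma pspecX k : pspec 'X_k = 'X. Proof. by rewrite /pspec mmapX mmap1U. Qed.

Lemma pspec_sum (I : Type) (r : seq I) (P : pred I) (F : I -> {mpoly R[K]}) :
  pspec (\sum_(x <- r | P x) F x) = \sum_(x <- r | P x) pspec (F x).
Proof. exact: raddf_sum. Qed.

(** All p_k have the same image X, so for k > 1 the terms k p_k d/dp_k and k p_(k-1) d/dp_k are not
    distinguished; the term k = 1 remains. *)
Lemma pspec_weight_op f : pspec (weight_op f) = pspec (E2perp f) + 'X * pspec f^`M(o).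
Proof.
rewrite /weight_op pspec_sum (bigD1 o) //= pspecZ pspecM pspecX o0 scale1r [LHS]addrC E2perpE.
by congr (_ + _); rewrite pspec_sum; apply: eq_bigr => k _; rewrite !pspecZ !pspecM !pspecX.
Qed.

Lemma meval_pspec s N f : (N <= K)%N -> (evs s N f).@[fun=> 1] = (pspec f).[s * N%:R].
Proof.
move=> hN; elim/mpoly_indX: f => [c|f g IHf IHg|i f IH].
- by rewrite comp_mpolyC mevalC pspecC hornerC.
- by rewrite comp_mpolyD mevalD pspecD hornerD IHf IHg.
rewrite rmorphM mevalM pspecM hornerM IH pspecX hornerX /= evsX mevalZ; congr (_ * _ * _).
rewrite /psx raddf_sum /= (eq_bigr (fun=> 1%:R)) => [|j _]; last first.
  by rewrite rmorphXn /= mevalXU expr1n.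
by rewrite -natr_sum big_mkcond -[in RHS](sum_lt hN); congr (_%:R);
  apply: eq_bigr => j _; case: (j < N)%N.
Qed.

Lemma coef_pspec f i : (pspec f)`_i = \sum_(m <- msupp f) f@_m * (mdeg m == i)%:R.
Proof.
rewrite /pspec /mmap coef_sum; apply: eq_bigr => m _; rewrite coefCM /mmap1.
by rewrite prodrXr -mdegE coefXn eq_sym.
Qed.

(** The only power-sum monomial of weight n with a single factor is p_n. *)
Lemma theta_pspec n f : (0 < n)%N -> (n <= K)%N -> wt n f -> theta f [:: n] = (pspec f)`_1.
Proof.
move=> n0 hn hf; have lt : (n.-1 < K)%N by lia.
have pU : pmon K [:: n] = U_(Ordinal lt)%MM.
  by apply/mnmP => i; rewrite !mnmE /= -val_eqE /=; lia.
have U1 m : f@_m != 0 -> mdeg m = 1%N -> m = U_(Ordinal lt)%MM.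
  move=> /hf h /eqP; rewrite mdeg_eq1 => /existsP [i /eqP e]; rewrite e.
  by congr U_(_)%MM; apply: val_inj; rewrite /= -h e mnmwgt1.
rewrite /theta pU coef_pspec; set u := U_(_)%MM in U1 *.
have [f0|fn] := eqVneq f@_u 0.
  rewrite f0 big_seq big1 // => m; rewrite mcoeff_msupp => fm.
  case: eqP => [/(U1 _ fm) e|_]; last by rewrite mulr0.
  by rewrite e f0 eqxx in fm.
rewrite (bigD1_seq u) ?msupp_uniq ?mcoeff_msupp //= mdeg1 eqxx mulr1.
rewrite big_seq_cond big1 ?addr0 // => m /andP []; rewrite mcoeff_msupp => fm mu.
by case: eqP => [/(U1 _ fm) e|_]; [rewrite e eqxx in mu|rewrite mulr0].
Qed.

Lemma coef_es0 n f : (0 < n)%N -> wt n f -> (pspec f)`_0 = 0.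
Proof.
move=> n0 hf; rewrite coef_pspec big_seq big1 // => m; rewrite mcoeff_msupp => /hf e.
rewrite mdeg_eq0; case: eqP => [m0|_]; last by rewrite mulr0.
by move: e n0; rewrite m0 mnmwgt0 => <-.
Qed.

Lemma wt0E f : wt 0 f -> f = (f@_0%MM)%:MP.
Proof.
move=> hf; apply/mpolyP => m; rewrite mcoeffC.
case: eqVneq => [->|m0]; first by rewrite mulr1.
rewrite mulr0; apply/eqP; apply: contraNT m0 => /hf e.
by rewrite -mdeg_eq0 -leqn0 -e leq_mdeg_mnmwgt.
Qed.

(** By the Euler identity (n+1) J_l specializes to a combination of the (X + E_l - E_mu)
    [pspec (J mu)]; by induction and [pieri_contents] each one with nonzero coefficient is a
    multiple of [content_poly a l]. *)
Lemma jack_pspec_prop n l : is_partition n l -> (n <= K)%N ->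
  exists kappa, pspec (J l) = kappa *: content_poly a l.
Proof.
elim: n l => [|n IH] l pl hn.
  have l0 : l = [::].
    by apply/eqP; rewrite -size_eq0 -leqn0; apply: partition_size_le pl.
  exists (J l)@_0; have hw := wt_jack pl hn.
  by rewrite (wt0E hw) pspecC mcoeffC eqxx mulr1 l0 /content_poly big_ord0 alg_polyC.
have hw := wt_jack pl hn.
have hd : wt n (J l)^`M(o) by apply: wt_deriv; rewrite o0 addn1.
have e1 := jack_expand (ltnW hn) (wt_E2perp hw).
have e2 := jack_expand (ltnW hn) hd.
have main : (n.+1)%:R *: pspec (J l) = \sum_(mu <- partitions n)
    (pieri_coef l mu / jack_norm mu) *: (('X + (eps a l - eps a mu)%:P) * pspec (J mu)).
  rewrite -pspecZ -(wtP n.+1 (J l)).1 // pspec_weight_op e1 {1}e2 !pspec_sum mulr_sumr -big_split /=.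
  rewrite big_seq [RHS]big_seq; apply: eq_bigr => mu; rewrite mem_partitions => pm.
  by rewrite !pspecZ (E2perp_jack pl pm hn) -/(pieri_coef l mu) -!mul_polyC !polyCM; ring.
have F mu : mu \in partitions n -> exists k, (pieri_coef l mu / jack_norm mu) *:
    (('X + (eps a l - eps a mu)%:P) * pspec (J mu)) = k *: content_poly a l.
  rewrite mem_partitions => pm; have [->|nz] := eqVneq (pieri_coef l mu) 0.
    by exists 0; rewrite mul0r !scale0r.
  have [k ->] := IH mu pm (ltnW hn); exists (pieri_coef l mu / jack_norm mu * k).
  rewrite -scalerAr scalerA; congr (_ *: _); apply: poly_eq_evals => x.
  by rewrite (pieri_contents x pl pm hn nz) hornerM hornerD hornerX hornerC mulrC.
have [k hk] : exists k, (n.+1)%:R *: pspec (J l) = k *: content_poly a l.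
  rewrite main; elim: (partitions n) F => [|mu r IHr] F.
    by exists 0; rewrite big_nil scale0r.
  have [k1 e] := F mu (mem_head _ _).
  have [|k2 e'] := IHr; first by move=> nu hnu; apply: F; rewrite inE hnu orbT.
  by exists (k1 + k2); rewrite big_cons e e' scalerDl.
exists ((n.+1)%:R^-1 * k); rewrite -scalerA -hk scalerA mulVf ?scale1r //.
by rewrite pnatr_eq0.
Qed.

Lemma meval_ones N : ('X_[R, ones N]).@[fun=> 1] = 1.
Proof. by rewrite mevalX big1 // => i _; rewrite expr1n. Qed.

(** The scalar left open by [jack_pspec_prop] is found by evaluating [jack_column] at x = (1, ...,
    1) and comparing with [hook_h_col]. *)
Lemma jack_pspec n l : is_partition n l -> (n <= K)%N -> pspec (J l) = content_poly a l.
Proof.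
have [d] := ubnP n; elim: d n l => // d IH n l ltd pl hn.
have [k hk] := jack_pspec_prop pl hn.
have sl : (size l <= K)%N := leq_trans (partition_size_le pl) hn.
have [l0|l0] := eqVneq l [::].
  have := jack_lead pl hn; have hw := wt_jack pl hn.
  have n0 : n = 0%N by rewrite -(partition_sumn pl) l0.
  rewrite n0 in hw.
  have x0 : xmon K l = 0%MM by apply/mnmP => i; rewrite !mnmE l0 nth_nil.
  rewrite (wt0E hw) comp_mpolyC mcoeffC x0 eqxx mulr1 => ->; rewrite pspecC.
  by rewrite l0 /hook_h /content_poly !big_ord0.
have [posl lt] : all (fun k => 0 < k)%N l /\ (sumn (drop_col l) < n)%N.
  by split; [case/and3P: pl|rewrite -[n in (_ < n)%N](partition_sumn pl) (sumn_drop_col_lt pl)].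
have pl' := drop_col_partition pl.
have := congr1 (meval (fun=> 1)) (jack_column pl hn).
rewrite !mevalZ mevalM meval_ones mul1r !meval_pspec // mul1r hk.
rewrite (IH _ _ _ pl') ?(leq_trans _ hn) ?(ltnW lt) //; last by rewrite (leq_trans lt).
rewrite -(hook_h_col a pl) hornerZ mulrCA [_ * hook_h a _]mulrC => e.
suff -> : k = 1 by rewrite scale1r.
have F0 : (content_poly a l).[(size l)%:R] != 0 by rewrite lt0r_neq0 // content_poly_gt0.
by apply: (mulIf (mulf_neq0 (hook_neq0 (drop_col l)) F0)); rewrite e mul1r.
Qed.

Lemma theta_pieri n l mu : is_partition n.+1 l -> is_partition n mu -> (n < K)%N -> (0 < n)%N ->
  pieri_coef l mu != 0 ->
  theta (J l) [:: n.+1] = (eps a l - eps a mu) * theta (J mu) [:: n].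
Proof.
move=> pl pm hn n0 nz; have hwl := wt_jack pl hn; have hwm := wt_jack pm (ltnW hn).
rewrite !theta_pspec ?(ltnW hn) //.
have -> : pspec (J l) = pspec (J mu) * ('X + (eps a l - eps a mu)%:P).
  apply: poly_eq_evals => x; rewrite (jack_pspec pl hn) (jack_pspec pm (ltnW hn)).
  by rewrite (pieri_contents x pl pm hn nz) hornerM hornerD hornerX hornerC.
(* The specialization of J_mu has no constant term because n > 0. *)
by rewrite mulrDr coefD coefMX coefMC /= (coef_es0 n0 hwm) add0r mulrC.
Qed.
End Pieri.

(** * Norm formula *)
Section Norm.
Variables (o : 'I_K) (o0 : o = 0%N :> nat).

(** The coefficient of x^e is the pairing of J_l with a product of elementary functions whose
    monomials lie below the conjugate of e; triangularity makes it zero unless [l] lies there as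
    well. *)
Lemma jack_dual_supp n (m : nat) l (e : 'X_{1..K}) : is_partition n l -> (n <= K)%N ->
  (evs (- a) m (J l))@_e != 0 -> in_vars m e /\ domle l (conj_seq K (vs e)).
Proof.
move=> pl hn he; have hv := evs_in_vars he; split=> //.
have de := mdeg_evs (wt_jack pl hn) he.
rewrite (mcoeff_evs _ _ hv) (mcoeff_evs_dual _ _ a_neq0) pinnerC in he.
have PE : \prod_(i < K) @eh R K (e i) = \prod_(x <- vs e) @eh R K x by rewrite big_map big_enum.
have wP : wt n (\prod_(i < K) @eh R K (e i)) by rewrite PE -de -sumn_vs; apply: wt_prod_eh.
case: (domle_dec l (conj_seq K (vs e))) => // h; case/eqP: he.
apply: (jack_triangular hn wP (U := fun mu => ~ domle mu (conj_seq K (vs e)))) pl h.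
  by move=> x y _ _ hx le ly; apply: hx; apply: domle_trans ly.
have hK : all (fun x => x <= K)%N (vs e) by apply: all_leqW (vs_leq e); rewrite de.
move=> x px hx; apply/eqP; apply: contraT; rewrite PE (evs_prod_eh _ hK) => /(prod_el_domle hK) le.
case: hx; apply: domle_ts le => // t; rewrite ts_xmon //.
exact: leq_trans (partition_size_le px) hn.
Qed.

(** The product P of the elementary functions indexed by the columns of [l] is expanded in Jack
    functions and read at x^l. Any other mu that contributed would lie both above and below [l], so
    (-1)^n is [hook_h a l] times the coefficient of J_l in P. *)
Lemma jack_dual_lead n (m : nat) l : is_partition n l -> (n <= K)%N -> all (fun x => x <= m)%N l ->
  (evs (- a) m (J l))@_(xmon K (conj_seq K l)) = (-1) ^+ n * jack_norm l / hook_h a l.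
Proof.
move=> pl hn hm; have sl : (size l <= K)%N := leq_trans (partition_size_le pl) hn.
have hK : all (fun x => x <= K)%N l.
  by apply: all_leqW (all_leq_sumn l); rewrite (partition_sumn pl).
set e := xmon K (conj_seq K l).
have eE (i : 'I_K) : e i = conj_part l i by rewrite mnmE nth_mkseq.
have hv : in_vars m e by move=> i hi; rewrite eE conj_part_eq0 //; apply: all_leqW hi hm.
have tse t : ts (vs e) t = ts (conj_seq K l) t by rewrite ts_xmon // size_mkseq.
rewrite (mcoeff_evs _ _ hv) (mcoeff_evs_dual _ _ a_neq0) pinnerC.
set P := \prod_(i < K) @eh R K (e i).
have PE : P = \prod_(x <- conj_seq K l) @eh R K x.
  rewrite /conj_seq big_map -[X in iota 0 X]subn0 -/(index_iota 0 K) big_mkord.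
  by apply: eq_bigr => i _; rewrite eE.
have hcj : all (fun x => x <= K)%N (conj_seq K l).
  by apply/allP => x /mapP [t _ ->]; apply: leq_trans (count_size _ _) sl.
have wP : wt n P.
  by rewrite PE -(partition_sumn pl) -(sumn_conj_seq hK); apply: wt_prod_eh.
have := congr1 (fun g => (evs 1 K g)@_(xmon K l)) (jack_expand hn wP).
rewrite /= {1}PE (evs_prod_eh _ hcj) (prod_el_lead _ pl hn) evs_sum mcoeff_sum.
rewrite (bigD1_seq l) /= ?uniq_partitions ?mem_partitions // big_seq_cond big1 => [|mu].
  rewrite addr0 comp_mpolyZ mcoeffZ (jack_lead pl hn) => ->.
  by rewrite [_ * jack_norm l]mulrAC divfK ?(jack_norm_neq0 pl hn) // mulfK // hook_neq0.
rewrite mem_partitions => /andP [pm ne]; rewrite comp_mpolyZ mcoeffZ.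
have [->|nz] := eqVneq (evs 1 K (J mu))@_(xmon K l) 0; first by rewrite mulr0.
have le1 := domle_ts (fun t => ts_xmon t sl) (fun=> erefl) (jack_supp pm hn nz).
have [->|] := eqVneq <<P, J mu>> 0; first by rewrite !mul0r.
rewrite pinnerC -(mcoeff_evs_dual _ _ a_neq0) => /(jack_dual_supp pm hn) [_ le2].
case/eqP: ne; apply: (partition_domle_anti pm pl) le1.
apply: domle_ts le2 => // t; apply: esym; apply: ts_conj_seq_swap => //.
Qed.

Lemma conj_part_row (m : nat) l : is_partition (sumn (m :: l)) (m :: l) -> (sumn (m :: l) <= K)%N ->
  conj_part (conj_seq K (m :: l)) 0 = m.
Proof.
move=> pl hn; have [sl _ _] := and3P pl.
have H k : (k < conj_part (conj_seq K (m :: l)) 0)%N = (k < m)%N.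
  rewrite conj_part_conj_seq -(nth_conj_part _ _ sl) /=; case: (ltnP k m) => h; last by rewrite andbF.
  by rewrite andbT (leq_trans h) // (leq_trans _ hn) //= leq_addr.
move: (conj_part _ _) H => c H; have := H c; have := H m.
by rewrite !ltnn; case: ltngtP.
Qed.

(* Jack polynomials in dual variables: removing the first row [m] amounts to dividing by
   [x_1 ... x_m]. *)
Lemma jack_dual_row (m : nat) l : is_partition (sumn (m :: l)) (m :: l) -> (sumn (m :: l) <= K)%N ->
  (evs (- a) m (J l))@_(xmon K (conj_seq K l)) *: evs (- a) m (J (m :: l))
  = (evs (- a) m (J (m :: l)))@_(xmon K (conj_seq K (m :: l))) *: ('X_[ones m] * evs (- a) m (J l)).
Proof.
move=> pl hn; have [pl' m0 lm] := partition_cons pl.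
have hn' : (sumn l <= K)%N by apply: leq_trans hn; apply: leq_addl.
have hmK : (m <= K)%N by apply: leq_trans hn; apply: leq_addr.
set L := m :: l in pl hn *; set F1 := evs (- a) m (J L); set F' := evs (- a) m (J l).
set B' := F'@_ _; set B := F1@_ _.
have LXj n mu : is_partition n mu -> (n <= K)%N ->
    LBrel a^-1 m (evs (- a) m (J mu)) ((- a^-1 * eps a mu) *: evs (- a) m (J mu)).
  move=> pm hm; rewrite -scalerA -comp_mpolyZ -(LB_psum_jack pm hm).
  apply: LBrel_evs (wt_jack pm hm) hm _ _ _; first by rewrite mulrNN divff.
    by rewrite mulNr mulVf // mulrN mulVf.
  by rewrite mulNr mulrBr mulVf // mulr1 opprB.
have LX1 : LBrel a^-1 m F1 ((- a^-1 * eps a L) *: F1) := LXj _ _ pl hn.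
have LX2 : LBrel a^-1 m ('X_[ones m] * F') ((- a^-1 * eps a L) *: ('X_[ones m] * F')).
  have eul : \sum_(k < K) 'X_k * F'^`M(k) = (sumn l)%:R *: F'.
    by rewrite euler_evs -comp_mpolyZ; congr comp_mpoly; apply/wtP/(wt_jack pl' hn').
  have := LBrel_mul_ones hmK (LXj _ _ pl' hn') eul (fun k hk => mderiv_evs0 (- a) (J l) hk).
  rewrite -scalerDl -scalerAr; congr (LBrel _ _ _ (_ *: _)).
  by rewrite (eps_cons a lm); field.
apply/eqP; rewrite -subr_eq0; apply/eqP; rewrite -scaleNr.
have := LBrel_lin B' (- B) LX1 LX2.
rewrite !scalerA ![_ * (- a^-1 * _)]mulrC -!scalerA -!scalerDr scalerA => LXH.
apply: (LBrel_uniq LXH) => e he.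
have mX : ('X_[ones m] * F')@_e = if (ones m <= e)%MM then F'@_(e - ones m) else 0.
  exact: mcoeff_mulXm.
have [hv le hK] : [/\ in_vars m e, domle L (conj_seq K (vs e)) & all (fun x => x <= K)%N (vs e)].
  move: he; rewrite mcoeffD !mcoeffZ mX.
  have [->|he _] := eqVneq F1@_e 0; last first.
    have [h1 h2] := jack_dual_supp pl hn he; split=> //.
    by apply: all_leqW (vs_leq e); rewrite (mdeg_evs (wt_jack pl hn) he).
  rewrite mulr0 add0r mulf_eq0 negb_or => /andP [_]; case: ifP => [ge he|]; last by rewrite eqxx.
  have [hv [h1 h2]] := jack_dual_supp pl' hn' he.
  have hv' : in_vars m e.
    by move=> i hi; have := hv i hi; rewrite mnmBE mnmE ltnNge hi subn0.
  have de := mdeg_evs (wt_jack pl' hn') he.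
  have hK : all (fun x => x <= K)%N (vs e).
    by apply: all_leqW (all_leq_sumn _); rewrite (sumn_subm hmK ge) sumn_vs de addnC.
  have c0 : conj_part (vs e) 0 = m.
    have := tsS (vs e) 0; rewrite ts0 (sumn_subm hmK ge) -ts0 (vs_subm _ hmK hv' ge); lia.
  (* The conjugate of [e] is [m] followed by the conjugate of the exponent divided by x_1 ...
     x_m. *)
  have E t : ts (conj_seq K (vs e)) t = ((m - t) + ts (conj_seq K (vs (e - ones m))) t)%N.
    rewrite -[X in (X - t)%N]c0; apply: ts_conj_seq_shift => // t'; apply: esym.
    have := tsS (vs (e - ones m)) t'; have := tsS (vs e) t'.+1.
    by rewrite !(vs_subm _ hmK hv' ge); lia.
  split=> //; split=> [|t]; first by rewrite -!ts0 E /= subn0 !ts0 /= h1.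
  by rewrite ts_cons E leq_add2l.
split=> //; apply/eqP => ee; case/eqP: he.
(* Dominance is known for the conjugate of [e], so the eigenvalue for 1 / a is first translated into
   the eigenvalue of that conjugate for a. *)
have tse : ts (vs e) =1 ts (conj_seq K L).
  apply: ts_conj_seq_swap; first exact: hK; first by rewrite size_vs.
  by apply: (eps_inj a0 le); rewrite eps_conj_seq // ee mulrA mulrNN divff ?mul1r.
have c0 : conj_part (vs e) 0 = m by rewrite (conj_part_ts tse) conj_part_row.
have ge : (ones m <= e)%MM by apply: in_vars_pos.
have inv mu : all (fun x => x <= m)%N mu -> in_vars m (xmon K (conj_seq K mu)).
  by move=> h i hi; rewrite mnmE nth_mkseq // conj_part_eq0 //; apply: all_leqW hi h.
have tsx mu t : ts (vs (xmon K (conj_seq K mu))) t = ts (conj_seq K mu) t.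
  by rewrite ts_xmon // size_mkseq.
rewrite mcoeffD !mcoeffZ mX ge.
have -> : F1@_e = B.
  apply: evs_perm => //; first by apply: inv; rewrite /= leqnn.
  by move=> t; rewrite tsx.
have -> : F'@_(e - ones m) = B'.
  apply: evs_perm; [by move=> i hi; rewrite mnmBE hv|exact: inv|].
  move=> t; rewrite tsx (vs_subm _ hmK hv ge) tse /ts !big_map; apply: eq_bigr => j _.
  rewrite conj_part_cons; case: (ltnP j m) => h; first by lia.
  by rewrite conj_part_eq0 //; apply: all_leqW h lm.
by rewrite mulNr mulrC subrr.
Qed.

(** [jack_dual_row] is evaluated at x = (1, ..., 1) in m variables. There p_k becomes - a m, and by
    [content_poly_row] the ratio of the two specializations is, up to sign, the part of [hook_h']
    from the first row; the leading coefficients carry the norms. *)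
Lemma jack_normE n l : is_partition n l -> (n <= K)%N -> jack_norm l = jfun a l.
Proof.
elim: l n => [|m l IH] n pl hn.
  have n0 : n = 0%N by rewrite -(partition_sumn pl).
  have hw := wt_jack pl hn; rewrite n0 in hw.
  have E := jack_lead pl hn; rewrite /hook_h big_ord0 in E.
  have x0 : xmon K [::] = 0%MM by apply/mnmP => i; rewrite !mnmE nth_nil.
  rewrite (wt0E hw) comp_mpolyC mcoeffC x0 eqxx mulr1 in E.
  rewrite /jack_norm /jfun /hook_h /hook_h' !big_ord0 (wt0E hw) E.
  rewrite mpolyC1 -mpolyX0 pinnerXl mcoeffX eqxx mdeg0 expr0 !mul1r /zee.
  by rewrite big1 // => i _; rewrite mnm0E.
rewrite -(partition_sumn pl) in hn; have {}pl := partition_self pl; have [pl' m0 lm] := partition_cons pl.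
have hn' : (sumn l <= K)%N by apply: leq_trans hn; apply: leq_addl.
have hmK : (m <= K)%N by apply: leq_trans hn; apply: leq_addr.
have := congr1 (meval (fun=> 1)) (jack_dual_row pl hn).
rewrite !mevalZ mevalM meval_ones mul1r !(meval_pspec _ _ hmK) !(jack_pspec o0 pl) // (jack_pspec o0 pl' hn').
rewrite mulNr (content_poly_row a pl) (jack_dual_lead pl hn) ?(jack_dual_lead pl' hn' lm) /= ?leqnn //.
rewrite mulrA => /(mulIf (content_poly_row_neq0 a0 lm)).
rewrite prodrN /= card_ord exprD (IH _ pl' hn') {1}/jfun => E.
rewrite /jfun (hook_h'_row a pl).
have s0 k : (-1) ^+ k != 0 :> R by rewrite expf_neq0 // oppr_eq0 oner_neq0.
apply: (mulfI (mulf_neq0 (s0 m) (s0 (sumn l)))); apply: (mulIf (invr_neq0 (hook_neq0 (m :: l)))).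
rewrite -E; field; rewrite !hook_neq0 //.
Qed.
End Norm.
End Jack.

(** * The Laplace-Beltrami operator in the variables *)
Lemma symmetrized_quotient (F : fieldType) (x y u v : F) : x - y != 0 ->
  (x - y) * (x * y / (x - y) * u + y * x / (y - x) * v) = x * y * (u - v).
Proof. by move=> h; field; rewrite h -opprB oppr_eq0 h. Qed.

Section LaplaceBeltrami.
Variables (R : realFieldType) (K : nat).
Implicit Types (f g F G : {mpoly R[K]}) (a c : R).
Local Notation evs s N := (comp_mpoly (evt K s N)).
Local Notation fr := (@FracField.tofrac {mpoly R[K]}).

(** Adding the double sum to itself with i and j exchanged turns each pair of fractions into the
    polynomial quotient [Gf i j]; halving gives the factor of [LBrel]. *)
Lemma LB_LBrel a F G : LBrel a K F G -> LB a F = Defs.frac G.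
Proof.
case=> Gf rel ->; rewrite /LB /Defs.frac.
pose d i j : {fraction {mpoly R[K]}} :=
  fr ('X_i * 'X_j) / fr ('X_i - 'X_j) * fr F^`M(i).
have two : fr 2 != 0 :> {fraction {mpoly R[K]}}.
  by rewrite tofrac_eq0 -mpolyC_nat mpolyC_eq0 pnatr_eq0.
have sym : \sum_(i < K) \sum_(j < K | j != i) d i j + \sum_(i < K) \sum_(j < K | j != i) d i j
    = fr (\sum_(i < K) \sum_(j < K | j != i) Gf i j).
  rewrite [X in _ + X](exchange_big_dep xpredT) //= -big_split rmorph_sum /=.
  apply: eq_bigr => i _; rewrite [X in _ + X](eq_bigl (fun j => j != i)); last first.
    by move=> j; rewrite eq_sym.
  rewrite -big_split rmorph_sum /=; apply: eq_bigr => j ji.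
  have Xij : fr 'X_i - fr 'X_j != 0 :> {fraction {mpoly R[K]}}.
    rewrite -tofracB tofrac_eq0 subr_eq0; apply: contra ji => /eqP/(congr1 (mcoeff U_(i)))/eqP.
    rewrite !mcoeffX eqxx; case: (@eqP _ U_(j)%MM U_(i)%MM) => [h|_]; last by rewrite oner_eq0.
    by have := congr1 (fun m : 'X_{1..K} => m i) h; rewrite !mnm1E eqxx; case: eqP.
  have := congr1 (@FracField.tofrac _) (rel i j (ltn_ord i) (ltn_ord j) _).
  rewrite eq_sym ji => /(_ isT); rewrite !tofracM tofracB => e.
  apply: (mulfI Xij); rewrite e /d !tofracM !tofracB.
  exact: symmetrized_quotient.
rewrite tofracD; congr (_ + _).
  rewrite mul_mpolyC; congr (fr (_ *: _)); apply: eq_bigl => l; by rewrite ltn_ord.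
apply: (mulfI two); rewrite -tofracM -mul_mpolyC mulrA -mpolyC_nat -mpolyCM mulfV ?pnatr_eq0 //.
rewrite mpolyC1 mul1r mpolyC_nat -[2]/(1 + 1) tofracD tofrac1 mulrDl mul1r sym; congr (fr _).
apply: eq_big => [i|i _]; first by rewrite ltn_ord.
by apply: eq_bigl => j; rewrite ltn_ord.
Qed.

Lemma LB_evs a n f : wt n f -> (n <= K)%N -> LB a (ev f) = Defs.frac (ev (LB_psum a f)).
Proof.
move=> hf hn; apply: LB_LBrel; rewrite !ev_evs -[evs 1 K (LB_psum a f)]scale1r.
by apply: LBrel_evs hf hn _ _ _; rewrite ?mul1r ?mulr1.
Qed.

(** [Dop] is known only after evaluation. In weight at most K the evaluation of [LB_psum] gives the
    same fraction, and evaluation is injective. *)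
Lemma IsLBop_LB_psum a n (Dop : {mpoly R[K]} -> {mpoly R[K]}) f :
  IsLBop a Dop -> wt n f -> (n <= K)%N -> Dop f = LB_psum a f.
Proof.
move=> hD hf hn; apply/eqP; rewrite -subr_eq0; apply/eqP/ev_inj.
apply/eqP; rewrite comp_mpolyB subr_eq0 -!ev_evs -tofrac_eq; apply/eqP.
by have := hD f; rewrite (LB_evs a hf hn).
Qed.
End LaplaceBeltrami.

(** * The identity *)
Section Tensors.
Variables (R : realFieldType) (K : nat).
Implicit Types (f g : {mpoly R[K]}) (c : R).

Lemma tens_suml (I : Type) (r : seq I) (P : pred I) (F : I -> {mpoly R[K]}) g :
  tens (\sum_(x <- r | P x) F x) g = \sum_(x <- r | P x) tens (F x) g.
Proof. by rewrite /tens rmorph_sum /= mulr_suml. Qed.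

Lemma tens_sumr (I : Type) (r : seq I) (P : pred I) f (F : I -> {mpoly R[K]}) :
  tens f (\sum_(x <- r | P x) F x) = \sum_(x <- r | P x) tens f (F x).
Proof. by rewrite /tens (raddf_sum (map_mpoly (@mpolyC K R))) mulr_sumr. Qed.

Lemma tensZr c f g : tens f (c *: g) = tens (c *: f) g.
Proof.
rewrite /tens -[c *: f]mul_mpolyC mpolyCM -mulrA [RHS]mulrCA; congr (_ * _).
by rewrite (map_mpolyZ (@mpolyC K R)) -mul_mpolyC.
Qed.
End Tensors.

Section Commutator.
Variables (R : realFieldType) (K : nat) (a : R) (J : seq nat -> {mpoly R[K]}).
Hypotheses (a0 : 0 < a) (hJ : IsJack a J).
Variables (o : 'I_K) (o0 : o = 0%N :> nat).

(** Adjointness of [E2] and [E2perp] yields one factor E_l - E_mu; commuting with the self-adjoint D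
    yields the other. *)
Lemma commutator_jack n l mu : is_partition n.+1 l -> is_partition n mu -> (n < K)%N ->
  pinner a (LB_psum a (E2 (J mu)) - E2 (LB_psum a (J mu))) (J l)
  = (eps a l - eps a mu) ^+ 2 * pieri_coef a J o l mu.
Proof.
move=> pl pm hn; have a1 : a != 0 by apply: lt0r_neq0.
have e : pinner a (E2 (J mu)) (J l) = (eps a l - eps a mu) * pieri_coef a J o l mu.
  by rewrite E2_adj // pinnerC (E2perp_jack a0 hJ o0 pl pm hn).
rewrite pinnerBl LB_psum_selfadj // (LB_psum_jack a0 hJ pl hn) pinnerZr e.
rewrite E2_adj // (LB_psum_jack a0 hJ pm (ltnW hn)) pinnerZl -E2_adj // e.
by ring.
Qed.

Lemma tens_jack n : (n < K)%N -> (0 < n)%N ->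
  \sum_(rho <- partitions n.+1)
     tens ((theta (J rho) [:: n.+1] / jfun a rho) *: J rho) (E2perp (J rho))
  = \sum_(ga <- partitions n)
     tens ((theta (J ga) [:: n] / jfun a ga) *: (LB_psum a (E2 (J ga)) - E2 (LB_psum a (J ga))))
          (J ga).
Proof.
move=> hn n0.
transitivity (\sum_(rho <- partitions n.+1) \sum_(ga <- partitions n)
    tens ((theta (J rho) [:: n.+1] / jfun a rho
       * ((eps a rho - eps a ga) * pieri_coef a J o rho ga / jfun a ga)) *: J rho) (J ga)).
  rewrite big_seq [RHS]big_seq; apply: eq_bigr => rho; rewrite mem_partitions => pr.
  have := wt_E2perp (wt_jack hJ pr hn).
  have := fun ga pg => E2perp_jack a0 hJ o0 pr (mu := ga) pg hn.
  move: (E2perp (J rho)) => f hf hw.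
  rewrite {1}(jack_expand a0 hJ (ltnW hn) hw).
  rewrite tens_sumr.
  rewrite [LHS]big_seq.
  rewrite [RHS]big_seq.
  apply: eq_bigr => ga; rewrite mem_partitions => pg.
  rewrite tensZr scalerA mulrC (jack_normE a0 hJ o0 pg (ltnW hn)).
  by rewrite (hf _ pg).
rewrite exchange_big /= big_seq [RHS]big_seq; apply: eq_bigr => ga; rewrite mem_partitions => pg.
have hg := wt_jack hJ pg (ltnW hn).
have : wt n.+1 (LB_psum a (E2 (J ga)) - E2 (LB_psum a (J ga))).
  apply: wtB; first exact/wt_LB_psum/wt_E2.
  exact/wt_E2/wt_LB_psum.
have := fun rho pr => @commutator_jack n rho ga pr pg hn.
move: (_ - _ : {mpoly R[K]}) => f hf hw.
rewrite {1}(jack_expand a0 hJ hn hw) scaler_sumr tens_suml big_seq [RHS]big_seq.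
apply: eq_bigr => rho; rewrite mem_partitions => pr.
rewrite scalerA (hf _ pr) (jack_normE a0 hJ o0 pr hn); congr (tens (_ *: _) _).
(* Both coefficients carry the factor [pieri_coef], so the relation between the theta coefficients
   is required only where it is nonzero. *)
have [->|nz] := eqVneq (pieri_coef a J o rho ga) 0; first by rewrite !(mulr0, mul0r).
by rewrite (theta_pieri a0 hJ o0 pr pg hn n0 nz); ring.
Qed.
End Commutator.

Theorem theorem6 (R : realFieldType) (a : R) (n : nat)
    (J : seq nat -> {mpoly R[n.+1]})
    (Dop : {mpoly R[n.+1]} -> {mpoly R[n.+1]}) :
  0 < a -> (1 <= n)%N ->
  IsJack a J -> IsLBop a Dop ->
  \sum_(rho <- partitions n.+1)
     tens ((theta (J rho) [:: n.+1] / jfun a rho) *: J rho) (E2perp (J rho))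
  = \sum_(ga <- partitions n)
     tens ((theta (J ga) [:: n] / jfun a ga) *: (Dop (E2 (J ga)) - E2 (Dop (J ga))))
          (J ga).
Proof.
move=> a0 n0 hJ hD; have o0 : @ord0 n = 0%N :> nat by [].
rewrite (tens_jack a0 hJ o0 (ltnSn n) n0) big_seq [RHS]big_seq.
apply: eq_bigr => ga; rewrite mem_partitions => pg.
have hg := wt_jack hJ pg (leqnSn n).
(* [E2 (J ga)] has weight n + 1, exactly the number of power sums at hand, so [Dop] can be replaced
   there too. *)
by rewrite (IsLBop_LB_psum hD hg (leqnSn n)) (IsLBop_LB_psum hD (wt_E2 hg) (leqnn _)).
Qed.
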